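(* Let $m\ge 1$ be an integer. The differential equation $(\mathfrak{E}_m)$: $\frac{d^2}{dx^2}\Phi(x)=\frac{P_m(x,\underline a)}{x^2}\Phi(x)$, with $P_m(x,\underline a)=x^m+a_1x^{m-1}+\cdots+a_m$, $\underline a=(a_1,\dots,a_m)\in\mathbb{C}^m$, admits a unique solution $\Phi_0(x,\underline a)$ satisfying the following condition 1. 1. $\Phi_0$ is analytic in $x$ in the sector $\Sigma_0=\{|x|>0,\ |\arg(x)|<\frac{3\pi}{m}\}$ and, in any strict sub-sector of $\Sigma_0$, $\Phi_0$ admits an asymptotic expansion at infinity of the form $$T\Phi_0(x,\underline a)=x^{r(\underline a)}e^{-S(x,\underline a)}\phi_0(x,\underline a),$$ uniformly with respect to $\underline a$ in any compact subset of $\mathbb{C}^m$, where: (i) if $m$ is odd, $S(x,\underline a)=\frac2m x^{\frac m2}+\sum_{k=1}^{\frac{m-1}{2}}\frac{b_{\frac m2-k}(\underline a)}{\frac m2-k}x^{\frac m2-k}\in\mathbb{C}[\underline a][x^{1/2}]$, $r(\underline a)=\frac12-\frac m4$, and $\phi_0\in\mathbb{C}[\underline a][[x^{-1/2}]]$ has constant term $1$; (ii) if $m$ is even, $S(x,\underline a)=\frac2m x^{\frac m2}+\sum_{k=1}^{\frac m2-1}\frac{b_{\frac m2-k}(\underline a)}{\frac m2-k}x^{\frac m2-k}\in\mathbb{C}[\underline a][x]$, $r(\underline a)=\frac12-\frac m4-b_0(\underline a)$, and $\phi_0\in\mathbb{C}[\underline a][[x^{-1}]]$ has constant term $1$. Moreover: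 2. $\Phi_0$ extends analytically in $x$ to the universal covering of $\mathbb{C}^\star$, and is an entire function of $\underline a$. 3. The derivative of $\Phi_0$ with respect to $x$ admits an asymptotic expansion at infinity of the form $$T\Big(\frac{d}{dx}\Phi_0(x,\underline a)\Big)=\frac{d}{dx}\big(T\Phi_0(x,\underline a)\big)=x^{r(\underline a)+\frac m2-1}e^{-S(x,\underline a)}(-1+o(1))$$ when $x$ tends to infinity in any strict sub-sector of $\Sigma_0$, uniformly with respect to $\underline a$ in any compact subset of $\mathbb{C}^m$.
   Context: The variable $x$ is regarded as an element of the universal covering of $\mathbb{C}^\star$ (base point $1$), so it has a well-defined argument $\arg(x)\in\mathbb{R}$; $x^\alpha=\exp(\alpha\ln x)$ with $\ln x$ real for $\arg x=0$. The coefficients $b_{\frac m2-k}(\underline a)\in\mathbb{C}[\underline a]$ are defined by the expansion at infinity $\frac{\sqrt{P_m(x,\underline a)}}{x}=x^{\frac m2-1}+\sum_{k\ge1}b_{\frac m2-k}(\underline a)x^{\frac m2-k-1}$. A strict sub-sector of $\Sigma_0$ is a sector $\{\alpha\le\arg x\le\beta\}$ with $-\frac{3\pi}m<\alpha\le\beta<\frac{3\pi}m$. Saying that $\Phi$ has asymptotic expansion $x^{r}e^{-S}\phi_0$ means that $x^{-r}e^{S}\Phi$ is asymptotic, in the sense of Poincaré, to the formal series $\phi_0$ as $|x|\to\infty$. *)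

(* Defs.v *)
From HB Require Import structures.
From mathcomp Require Import all_boot all_order all_algebra.
From mathcomp Require Import all_classical all_reals all_analysis.
From mathcomp Require Import complex.
(* The notations of mpoly clash with those of MathComp-Analysis. *)
From mathcomp Require Import -(notations) mpoly.

Set Implicit Arguments.
Unset Strict Implicit.
Unset Printing Implicit Defensive.

Import Order.TTheory GRing.Theory Num.Theory numFieldNormedType.Exports.

Local Open Scope classical_set_scope.
Local Open Scope ring_scope.
Local Open Scope complex_scope.

(* R[i] as a normed space over itself: [derivable f t 1] and [derive1] below
   are then complex differentiability and the complex derivative, and
   [differentiable] on 'rV[R[i]]_m is complex (holomorphic) differentiability. *)
HB.instance Definition _ (R : realType) := NormedModule.copy R[i] R[i]^o.

Section UniversalCovering.
Variable R : realType.
Local Notation C := R[i].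

Definition cexp (z : C) : C :=
  (expR (complex.Re z) * cos (complex.Im z))
    +i* (expR (complex.Re z) * sin (complex.Im z)).

(* The universal covering of C^* is exp : C -> C^*, so a point x of it is
   represented by its logarithm t (the base point 1 being t = 0). *)
Definition absx (t : C) : R := expR (complex.Re t).
Definition argx (t : C) : R := complex.Im t.
Definition powx (alpha t : C) : C := cexp (alpha * t).

(* d/dx = e^(-t) d/dt, as x = e^t. *)
Definition ddx (F : C -> C) (t : C) : C := derive1 F t / cexp t.

End UniversalCovering.

Section Equation.
Variables (R : realType) (m : nat).
Local Notation C := R[i].
Local Notation Ca := (mpoly m R[i]).

(* The parameter a_(i+1) is the coordinate [a 0 i]. *)
Definition Pm (x : C) (a : 'rV[C]_m) : C :=
  x ^+ m + \sum_(i < m) a 0 i * x ^+ (m - i.+1).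

Definition ev (p : Ca) (a : 'rV[C]_m) : C := meval (a 0) p.

(* Coefficient of z^k in z^m P_m(1/z, a) = 1 + a_1 z + ... + a_m z^m. *)
Definition Pcoef (k : nat) : Ca :=
  (k == 0%N)%:R + \sum_(i < m | i.+1 == k) mpolyX C (mnm1 i).

Fixpoint sqrtP_seq (n : nat) : seq Ca :=
  if n is n'.+1 then
    let s := sqrtP_seq n' in
    rcons s (2^-1 *: (Pcoef n - \sum_(1 <= i < n) s`_i * s`_(n - i)))
  else [:: 1].

(* With z = 1/x, the expansion of sqrt(P_m(x, a)) / x at infinity is
   x^(m/2 - 1) times the power series in z with constant term 1 whose square is
   1 + a_1 z + ... + a_m z^m (see [bcoef0] and [bcoef_sqr]); hence
   [bcoef k] is b_(m/2 - k). *)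
Definition bcoef (k : nat) : Ca := (sqrtP_seq k)`_k.

Lemma bcoef0 : bcoef 0 = 1.
Proof. by []. Qed.

Lemma size_sqrtP_seq n : size (sqrtP_seq n) = n.+1.
Proof. by elim: n => //= n IHn; rewrite size_rcons IHn. Qed.

Lemma nth_sqrtP_seq n i : (i <= n)%N -> (sqrtP_seq n)`_i = bcoef i.
Proof.
elim: n => [|n IHn]; first by rewrite leqn0 => /eqP->.
rewrite leq_eqVlt => /predU1P[->//|ltin].
by rewrite /= nth_rcons size_sqrtP_seq ltin IHn.
Qed.

Lemma bcoef_sqr n : \sum_(i < n.+1) bcoef i * bcoef (n - i) = Pcoef n.
Proof.
case: n => [|n].
  by rewrite big_ord1 /Pcoef big_pred0 // bcoef0 mulr1 addr0.
rewrite big_ord_recl big_ord_recr /= subnn subn0 bcoef0 mul1r mulr1.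
have -> : bcoef n.+1 = 2^-1 *:
    (Pcoef n.+1 - \sum_(i < n) bcoef i.+1 * bcoef (n.+1 - i.+1)).
  rewrite {1}/bcoef /= nth_rcons size_sqrtP_seq ltnn eqxx.
  congr (_ *: (_ - _)); rewrite big_add1 big_mkord; apply: eq_bigr => i _.
  by rewrite !nth_sqrtP_seq // subSS leq_subr.
set s := \sum_(i < n) _; set p := Pcoef _.
rewrite addrCA -scalerDl.
have -> : 2^-1 + 2^-1 = 1 :> C.
  by rewrite -mulr2n -[2^-1 *+ 2]mulr_natr mulVf // pnatr_eq0.
by rewrite scale1r addrC subrK.
Qed.

Definition Sfun (t : C) (a : 'rV[C]_m) : C :=
  2 / m%:R * powx (m%:R / 2) t
  + \sum_(1 <= k < m | (k.*2 < m)%N)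
      ev (bcoef k) a / (m%:R / 2 - k%:R) * powx (m%:R / 2 - k%:R) t.

Definition rexp : Ca :=
  mpolyC m (2^-1 - m%:R / 4) - (if odd m then 0 else bcoef m./2).

(* A sequence phi : nat -> C[a] stands for the formal series
   sum_j phi_j x^(-j/2); it lies in C[a][[x^(-1)]] when phi_j = 0 for odd j. *)
Definition formal_phi0 (phi : nat -> Ca) : Prop :=
  phi 0%N = 1 /\ (~~ odd m -> forall j, odd j -> phi j = 0).

(* x^(1 - m/2) dS/dx = sum_(2 k < m) b_(m/2 - k) x^(-k). *)
Definition dS (n : nat) : Ca :=
  if ~~ odd n && (n < m)%N then bcoef n./2 else 0.

(* Formal derivative: d/dx (x^r e^(-S) phi) = x^(r + m/2 - 1) e^(-S) psi, where
   psi = x^(-m/2) (r phi + x dphi/dx) - (x^(1 - m/2) dS/dx) phi. *)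
Definition formal_ddx (phi : nat -> Ca) (n : nat) : Ca :=
  (if (m <= n)%N
   then (rexp - mpolyC m ((n - m)%:R / 2)) * phi (n - m)%N else 0)
  - \sum_(i < n.+1) dS i * phi (n - i)%N.

Definition Sigma0 : set C := [set t | `|argx t| < 3 * pi / m%:R].

(* f tends to 0 at infinity in every strict sub-sector of Sigma_0, uniformly
   with respect to a in compact sets. *)
Definition small_at_infinity (f : C -> 'rV[C]_m -> C) : Prop :=
  forall (alpha beta : R) (K : set 'rV[C]_m),
    - (3 * pi / m%:R) < alpha -> alpha <= beta -> beta < 3 * pi / m%:R ->
    compact K ->
    forall eps : R, 0 < eps -> exists M : R,
      forall t a, alpha <= argx t <= beta -> M <= absx t -> K a ->
        `|f t a| <= eps%:C.

(* Phi has the Poincare asymptotic expansion x^rho e^(-S) phi. *)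
Definition has_expansion (Phi : C -> 'rV[C]_m -> C) (rho : Ca)
    (phi : nat -> Ca) : Prop :=
  forall N : nat, small_at_infinity (fun t a =>
    powx (N%:R / 2) t *
    (powx (- ev rho a) t * cexp (Sfun t a) * Phi t a
     - \sum_(j < N.+1) ev (phi j) a * powx (- (j%:R / 2)) t)).

Definition solution (Phi : C -> 'rV[C]_m -> C) : Prop :=
  forall t a, Sigma0 t ->
    [/\ derivable (Phi ^~ a) t 1,
        derivable (ddx (Phi ^~ a)) t 1
      & ddx (ddx (Phi ^~ a)) t = Pm (cexp t) a / cexp t ^+ 2 * Phi t a].

Definition condition1 (Phi : C -> 'rV[C]_m -> C) (phi : nat -> Ca) : Prop :=
  [/\ forall t a, Sigma0 t -> derivable (Phi ^~ a) t 1,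
      formal_phi0 phi
    & has_expansion Phi rexp phi].

End Equation.

(* Main.v *)
Require Import Defs.
From HB Require Import structures.
From mathcomp Require Import all_boot all_order all_algebra.
From mathcomp Require Import all_classical all_reals all_analysis.
From mathcomp Require Import complex.
From mathcomp Require Import -(notations) mpoly.
From mathcomp Require Import ring lra zify.
Import Order.TTheory GRing.Theory Num.Theory numFieldNormedType.Exports.
Local Open Scope classical_set_scope.
Local Open Scope ring_scope.
Local Open Scope complex_scope.
Set Implicit Arguments.
Unset Strict Implicit.
Unset Printing Implicit Defensive.
Import Normc.

(** With x = e^t the equation becomes F'' = F' + P_m(e^t, a) F. The quotient
    v = x^(-r) e^S F satisfies v'' = x^(m/2) (D v' - g v), where D tends to 2 and
    g = O(x^(-1/2)); the formal solution phi_0 in y = x^(-1/2) is determined by this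
    equation and its constant term. The error e left by a truncation of phi_0 is
    controlled by the energy |e|^2 + K rho^(1-m) |e'|^2, rho = |x|^(1/2), which
    Gronwall's lemma propagates along every line t0 + s d of the t-plane with
    Re (x^(m/2) d) <= - c |x|^(m/2): there the term x^(m/2) D v' is a damping. Going
    backward along the real axis, the solutions F_n which agree with x^r e^(-S) at
    t = n converge to a solution F having the expansion for arg x = 0; lines of slope
    +-tan eta in the t-plane carry the expansion to the sector |arg x| < 3 pi / m. As
    Taylor series in t, and their locally uniform limits, F depends on a through
    locally uniform limits of polynomials, hence holomorphically.

    For uniqueness, let u = (Psi - F) / F, which tends to 0 on the real axis. Then
    H = u' satisfies H' = (1 - 2 F'/F) H with 1 - 2 F'/F ~ 2 x^(m/2), so that H <> 0
    would force u to be unbounded. *)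

(** * Complex derivatives and the exponential *)

(** The weight K rho^(1-m) brings every term to the order of rho: it turns the damping c rho^m into
    2 rho and the coupling x^(m/2) g, of size rho^(m-1), into a bounded one. Products |e| |e'| are
    then absorbed by the damping at the cost |e|^2 / rho, and 1 / rho = e^(-Re t / 2) has an
    integral along the real axis bounded independently of the starting point.

    Damping exists only in directions in which |e^(-S)| grows. This forces backward transport on the
    real axis and fixes the opening of the sector: with phi = (m/2) arg x, a line of angle eta is
    allowed when |phi + eta - pi| < pi/2, and leaving the axis requires eta > 0, whence phi < 3 pi /
    2.

    At t = n the solution F_n misses the truncation by O(e^(-n/2)) only, whatever its order N. At a
    fixed point this error disappears as n grows, and only the effect of the residual, O(rho^(-N)),
    remains; so a single limit F has the expansion to every order. Only the Cauchy data at t = 0 are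
    passed to the limit, and F is solved for again from them: it is an exact solution, entire in
    t. *)

Section Basics.
Variable R : realType.
Local Notation C := R[i].
Implicit Types (z w t : C) (F G : C -> C).

Definition cder F t (l : C) := is_derive (t : C) (1 : C) F l.

Lemma ler_eq (x y : R) : x = y -> x <= y. Proof. by move=> ->. Qed.
Lemma normCE z : `|z| = (normc z)%:C. Proof. by []. Qed.
Lemma lec_real (x y : R) : (x%:C <= y%:C) = (x <= y).
Proof. by rewrite lecE /= eqxx. Qed.
Lemma ltc_real (x y : R) : (x%:C < y%:C) = (x < y).
Proof. by rewrite ltcE /= eqxx. Qed.
Lemma normc_ge0 z : 0 <= normc z.
Proof. by rewrite -lec_real -normCE normr_ge0. Qed.
Lemma posc_real (e : C) : 0 < e -> exists2 r : R, 0 < r & e = r%:C.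
Proof. by case: e => a b; rewrite ltcE /= => /andP[/eqP -> a0]; exists a. Qed.

Lemma normc_real (x : R) : normc x%:C = `|x|.
Proof. by rewrite /normc /= expr0n /= addr0 sqrtr_sqr. Qed.

Lemma normc_Re z : `|complex.Re z| <= normc z.
Proof. by rewrite -lec_real -normCE normc_ge_Re. Qed.

Lemma normc_sq z : normc z ^+ 2 = complex.Re z ^+ 2 + complex.Im z ^+ 2.
Proof. by case: z => a b /=; rewrite sqr_sqrtr // addr_ge0 ?sqr_ge0. Qed.

Lemma normc_Im z : `|complex.Im z| <= normc z.
Proof.
rewrite -(@ler_sqr R) ?nnegrE ?normc_ge0 // normc_sq real_normK ?num_real //.
by rewrite lerDr sqr_ge0.
Qed.

Lemma normc_le_ReIm z : normc z <= `|complex.Re z| + `|complex.Im z|.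
Proof.
rewrite -(@ler_sqr R) ?nnegrE ?normc_ge0 ?addr_ge0 // normc_sq sqrrD.
by rewrite !real_normK ?num_real // addrAC lerDl mulrn_wge0 // mulr_ge0.
Qed.

Lemma normcD z w : normc (z + w) <= normc z + normc w.
Proof. exact: le_normcD. Qed.
Lemma normcB z w : normc (z - w) <= normc z + normc w.
Proof. by rewrite -[normc w]normcN; exact: normcD. Qed.
Lemma normcBC z w : normc (z - w) = normc (w - z).
Proof. by rewrite -normcN opprB. Qed.
Lemma normc_dist z w x : normc (z - w) <= normc (z - x) + normc (x - w).
Proof. by have := normcD (z - x) (x - w); rewrite addrA subrK. Qed.
Lemma normcX z n : normc (z ^+ n) = normc z ^+ n.
Proof. by elim: n => [|n IH]; rewrite ?expr0 ?normc1 // !exprS normcM IH. Qed.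
Lemma normc_sum (I : Type) (r : seq I) (P : pred I) (F : I -> C) :
  normc (\sum_(i <- r | P i) F i) <= \sum_(i <- r | P i) normc (F i).
Proof.
elim/big_ind2: _ => [|a b c d h1 h2|//]; first by rewrite normc0.
exact: le_trans (normcD _ _) (lerD h1 h2).
Qed.
Lemma normcn n : normc (n%:R : C) = n%:R.
Proof.
have -> : (n%:R : C) = (n%:R : R)%:C by rewrite rmorph_nat.
by rewrite normc_real normr_nat.
Qed.

(** A division-free estimate with real [e] and [d], from which the chain rule, the differentiation
    of power series and the restriction to real lines all start. *)
Lemma cderP F t l : cder F t l <-> forall e : R, 0 < e -> exists d : R, 0 < d /\
  forall h, normc h < d -> normc (F (t + h) - F t - h * l) <= e * normc h.
Proof.
have E h : h != 0 ->
    l - h^-1 *: (F (h *: 1 + t) - F t) = - (h^-1 * (F (t + h) - F t - h * l)).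
  move=> h0; rewrite /GRing.scale /= mulr1 [h + t]addrC.
  by field.
have H : ((h^-1 *: (F (h *: 1 + t) - F t)) @[h --> (0:C)^'] --> l) <-> forall e : R, 0 < e -> exists d : R, 0 < d /\
  forall h, normc h < d -> normc (F (t + h) - F t - h * l) <= e * normc h.
  split.
  - move=> /cvgrPdist_le h e e0.
    have := h e%:C; rewrite ltc_real => /(_ e0).
    move=> /nbhs_ballP [r /= /posc_real[d d0 ->] hd].
    exists d; split => // k kd; have [->|k0] := eqVneq k 0.
      by rewrite addr0 subrr mul0r subr0 normc0 mulr0.
    have /hd : ball (0:C) d%:C k by rewrite -ball_normE /= sub0r normrN normCE ltc_real.
    move=> /(_ k0); rewrite E // normrN normrM normfV -lec_real -normCE rmorphM /= -normCE => H.
    by rewrite -ler_pdivrMr ?normr_gt0// mulrC.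
  - move=> h; apply/cvgrPdist_le => e /posc_real[r r0 ->].
    have [d [d0 hd]] := h _ r0.
    apply/nbhs_ballP; exists d%:C; first by rewrite /= ltc_real.
    move=> k; rewrite -ball_normE /= sub0r normrN normCE ltc_real => /hd H k0.
    rewrite E // normrN normrM normfV mulrC ler_pdivrMr ?normr_gt0//.
    by rewrite !normCE -rmorphM lec_real.
rewrite -H; split.
  by case=> h <-; exact: h.
move=> h; split; first by apply/cvg_ex; exists l.
by apply: cvg_lim h; apply: norm_hausdorff.
Qed.

Lemma cderM F G t l k : cder F t l -> cder G t k ->
  cder (fun z => F z * G z) t (l * G t + F t * k).
Proof.
move=> hF hG; have h := @is_deriveM _ _ F G t 1 l k hF hG.
by apply: is_derive_eq h _; rewrite addrC /GRing.scale /= [G t * l]mulrC.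
Qed.

Lemma cder_eq F t l l' : cder F t l -> l = l' -> cder F t l'.
Proof. by move=> h <-. Qed.

Lemma cder_ext F G t l : F =1 G -> cder F t l -> cder G t l.
Proof. by move=> /funext ->. Qed.

Lemma cderD F G t l k : cder F t l -> cder G t k ->
  cder (fun z => F z + G z) t (l + k).
Proof. by move=> hF hG; apply: is_deriveD. Qed.

Lemma cderB F G t l k : cder F t l -> cder G t k ->
  cder (fun z => F z - G z) t (l - k).
Proof. by move=> hF hG; apply: is_deriveB. Qed.

Lemma cder_cst (c t : C) : cder (fun=> c) t 0.
Proof. exact: is_derive_cst. Qed.

Lemma cder_id t : cder id t 1.
Proof. exact: is_derive_id. Qed.

Lemma cderZ (c : C) F t l : cder F t l -> cder (fun z => c * F z) t (c * l).
Proof. by move=> h; have := cderM (cder_cst c t) h; rewrite mul0r add0r. Qed.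

Lemma cder_sum (I : Type) (r : seq I) (P : pred I) (F : I -> C -> C) t (l : I -> C) :
  (forall i, P i -> cder (F i) t (l i)) ->
  cder (fun z => \sum_(i <- r | P i) F i z) t (\sum_(i <- r | P i) l i).
Proof.
move=> h; elim: r => [|i r IH].
  rewrite big_nil; apply: (cder_ext _ (cder_cst 0 t)) => z.
  by rewrite big_nil.
rewrite big_cons; case: ifPn => Pi; last first.
  by apply: (cder_ext _ IH) => z; rewrite big_cons (negPf Pi).
by apply: (cder_ext _ (cderD (h i Pi) IH)) => z; rewrite big_cons Pi.
Qed.

Lemma cder_comp F G t l k : cder G t k -> cder F (G t) l ->
  cder (fun z => F (G z)) t (k * l).
Proof.
move=> /cderP hG /cderP hF; apply/cderP => e e0.
have l0 := normc_ge0 l; have k0 := normc_ge0 k.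
have e20 : 0 < e / (2 * (normc k + 1)) by apply: divr_gt0 => //; lra.
have e10 : 0 < Num.min 1 (e / (2 * (normc l + 1))).
  by rewrite lt_min ltr01 /=; apply: divr_gt0 => //; lra.
have [d1 [d10 h1]] := hG _ e10; have [d2 [d20 h2]] := hF _ e20.
exists (Num.min d1 (d2 / (normc k + 1))); split.
  by rewrite lt_min d10 divr_gt0 //; lra.
move=> h; rewrite lt_min ltr_pdivlMr; last by lra.
move=> /andP[hd1 hd2]; have {h1} := h1 h hd1.
set u := G (t + h) - G t => hu.
have n0 := normc_ge0 h.
have hu1 : normc (u - h * k) <= normc h.
  apply: le_trans hu _; rewrite -[leRHS]mul1r; apply: ler_wpM2r => //.
  by rewrite ge_min lexx.
have hu2 : normc (u - h * k) * (normc l + 1) <= e / 2 * normc h.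
  apply: le_trans (_ : e / (2 * (normc l + 1)) * normc h * (normc l + 1) <= _).
    apply: ler_wpM2r; first lra.
    by apply: le_trans hu _; apply: ler_wpM2r => //; rewrite ge_min lexx orbT.
  by apply: ler_eq; field; apply/eqP => E; lra.
have hu3 : normc u <= normc h * (normc k + 1).
  have : normc u <= normc (u - h * k) + normc (h * k).
    by have := normcD (u - h * k) (h * k); rewrite subrK.
  by rewrite normcM; lra.
have {h2} := h2 u (le_lt_trans hu3 hd2).
have -> : G t + u = G (t + h) by rewrite /u; ring.
move=> h2.
have -> : F (G (t + h)) - F (G t) - h * (k * l) =
  (F (G (t + h)) - F (G t) - u * l) + (u - h * k) * l by ring.
apply: le_trans (normcD _ _) _; rewrite normcM.
have h3 : e / (2 * (normc k + 1)) * normc u <= e / 2 * normc h.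
  apply: le_trans (_ : e / (2 * (normc k + 1)) * (normc h * (normc k + 1)) <= _).
    by apply: ler_wpM2l => //; exact: ltW.
  by apply: ler_eq; field; apply/eqP => E; lra.
have : 0 <= normc (u - h * k) := normc_ge0 _.
lra.
Qed.

Lemma cder_derivable F t l : cder F t l -> derivable F t 1.
Proof. by case. Qed.

Lemma cder_derive1 F t l : cder F t l -> derive1 F t = l.
Proof. by case=> _ <-; rewrite derive1E. Qed.

Lemma ReD z w : complex.Re (z + w) = complex.Re z + complex.Re w.
Proof. by case: z; case: w. Qed.
Lemma ImD z w : complex.Im (z + w) = complex.Im z + complex.Im w.
Proof. by case: z; case: w. Qed.
Lemma mulcE (a b c d : R) :
  (a +i* b) * (c +i* d) = (a * c - b * d) +i* (a * d + b * c).
Proof. by []. Qed.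
Lemma cexpD z w : cexp (z + w) = cexp z * cexp w.
Proof.
rewrite /cexp ReD ImD mulcE expRD cosD sinD.
by congr (_ +i* _); ring.
Qed.
Lemma cexp0 : cexp (0 : C) = 1.
Proof. by rewrite /cexp /= expR0 cos0 sin0 mulr0 mul1r. Qed.
Lemma cexpV z : cexp z * cexp (- z) = 1.
Proof. by rewrite -cexpD subrr cexp0. Qed.
Lemma cexp_neq0 z : cexp z != 0.
Proof. by apply/eqP => h; have /esym := cexpV z; rewrite h mul0r => /eqP; rewrite oner_eq0. Qed.
Lemma cexpMn n z : cexp (n%:R * z) = cexp z ^+ n.
Proof.
elim: n => [|n IH]; first by rewrite mul0r cexp0.
by rewrite -natr1 mulrDl mul1r cexpD IH exprSr.
Qed.
Lemma normc_cexp z : normc (cexp z) = expR (complex.Re z).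
Proof.
apply: (@pexpIrn R 2); rewrite ?nnegrE ?normc_ge0 ?expR_ge0 //.
rewrite normc_sq /cexp /= !exprMn -mulrDr cos2Dsin2 mulr1 //.
Qed.

Lemma cexp_prim_root n : (0 < n)%N ->
  n.-primitive_root (cexp (0 +i* (2 * pi / n%:R)) : C).
Proof.
move=> n0; have nR : n%:R != 0 :> R by rewrite pnatr_eq0 -lt0n.
apply/andP; split=> //; apply/forallP => i; rewrite unity_rootE -cexpMn.
have -> : i.+1%:R * (0 +i* (2 * pi / n%:R)) = 0 +i* ((i.+1%:R * pi / n%:R) *+ 2) :> C.
  have -> : (i.+1%:R : C) = (i.+1%:R : R)%:C by rewrite rmorph_nat.
  by rewrite mulcE; congr (_ +i* _); field.
rewrite /cexp /= expR0 !mul1r; apply/eqP; have [->|ni] := eqVneq i.+1 n.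
  have -> : (n%:R * pi / n%:R : R) = pi by field.
  by rewrite cos2pi sin2pi eqxx.
(* With theta = (i + 1) pi / n in (0, pi), cos (2 theta) = 1 would force sin theta = 0. *)
apply/negbTE/eqP => -[+ _]; rewrite cos_mulr2n cos2sin2 => h.
have : 0 < sin (i.+1%:R * pi / n%:R : R).
  apply: sin_gt0_pi; rewrite divr_gt0 ?mulr_gt0 ?pi_gt0 ?ltr0n //=.
  rewrite ltr_pdivrMr ?ltr0n // mulrC ltr_pM2l ?pi_gt0 // ltr_nat.
  by rewrite ltn_neqAle ni ltn_ord.
move=> s0; have := exprn_gt0 2 s0; lra.
Qed.

Lemma rderP (f : R -> R) x l : is_derive x (1 : R) f l -> forall e : R, 0 < e ->
  exists d : R, 0 < d /\
    forall h, `|h| < d -> `|f (x + h) - f x - h * l| <= e * `|h|.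
Proof.
move=> [hd hl] e e0.
have /cvgrPdist_le /(_ e e0) /nbhs_ballP [d /= d0 hd'] := hd.
exists d; split => // h hh; have [->|h0] := eqVneq h 0.
  by rewrite addr0 subrr mul0r subr0 normr0 mulr0.
have := hd' h; rewrite -ball_normE /= sub0r normrN => /(_ hh h0).
have -> : lim ((fun h => h^-1 *: (f (h *: (1 : R) + x) - f x)) h @[h --> 0^'])%classic = l.
  by rewrite -hl.
rewrite /GRing.scale /= mulr1 [h + x]addrC.
have -> : l - h^-1 * (f (x + h) - f x) = - (h^-1 * (f (x + h) - f x - h * l)) by field.
by rewrite normrN normrM normfV mulrC ler_pdivrMr ?normr_gt0.
Qed.

Lemma cder_cexp0 : cder (@cexp R) 0 1.
Proof.
apply/cderP => e' e'00; rewrite cexp0.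
pose e := Num.min 1 e'.
have e0 : 0 < e by rewrite lt_min ltr01.
have e1 : e <= 1 by rewrite ge_min lexx.
have ee' : e <= e' by rewrite ge_min lexx orbT.
have e'0 : 0 < e / 8 by lra.
have [d1 [d10 h1]] := rderP (is_derive_expR (0 : R)) e'0.
have [d2 [d20 h2]] := rderP (is_derive_cos (0 : R)) e'0.
have [d3 [d30 h3]] := rderP (is_derive_sin (0 : R)) e'0.
(* The bound 1/2 keeps [|1 + a|] below 2; the bound [e / 8] absorbs the product
   [(expR a - 1) * sin b], which is at most 3 n^2 for n = |a + i b|. *)
pose d := Num.min (Num.min d1 d2) (Num.min d3 (Num.min (1/2) (e / 8))).
have d0 : 0 < d by rewrite /d !lt_min d10 d20 d30 /=; lra.
exists d; split => // -[a b] hd.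
have ha := normc_Re (a +i* b); have hb := normc_Im (a +i* b).
rewrite [complex.Re _]/= in ha; rewrite [complex.Im _]/= in hb.
set n := normc (a +i* b) in hd ha hb *.
have hn : 0 <= n := normc_ge0 _.
move: hd; rewrite /d !lt_min => /andP[/andP[n1 n2] /andP[n3 /andP[n4 n5]]].
have {h1} := h1 a (le_lt_trans ha n1); rewrite add0r expR0 mulr1 => h1.
have {h2} := h2 b (le_lt_trans hb n2); rewrite add0r cos0 sin0 oppr0 mulr0 subr0 => h2.
have {h3} := h3 b (le_lt_trans hb n3); rewrite add0r sin0 cos0 mulr1 subr0 => h3.
rewrite add0r mulr1; apply: le_trans (normc_le_ReIm _) _ => /=.
have cosl : `|cos b| <= 1 by rewrite ler_norml cos_geN1 cos_le1.
have Hn : e / 8 * `|a| <= e / 8 * n by apply: ler_wpM2l => //; lra.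
have Hb : e / 8 * `|b| <= e / 8 * n by apply: ler_wpM2l => //; lra.
have r1 : `|expR a * cos b - 1 - a| <= 4 * (e / 8 * n).
  have -> : expR a * cos b - 1 - a = (expR a - 1 - a) * cos b + (1 + a) * (cos b - 1).
    by ring.
  apply: le_trans (ler_normD _ _) _; rewrite !normrM.
  have A1 : `|expR a - 1 - a| * `|cos b| <= e / 8 * n.
    by rewrite -[leRHS]mulr1; apply: ler_pM => //; apply: le_trans h1 Hn.
  have A2 : `|1 + a| * `|cos b - 1| <= 2 * (e / 8 * n).
    apply: ler_pM => //; last exact: le_trans h2 Hb.
    by apply: le_trans (ler_normD _ _) _; rewrite normr1; lra.
  have : 0 <= e / 8 * n by apply: mulr_ge0 => //; lra.
  lra.
have r2 : `|expR a * sin b - 0 - b| <= 4 * (e / 8 * n).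
  have -> : expR a * sin b - 0 - b = (expR a - 1) * sin b + (sin b - b) by ring.
  apply: le_trans (ler_normD _ _) _; rewrite !normrM.
  have A0 : `|expR a - 1| <= 3 / 2 * n.
    have -> : expR a - 1 = (expR a - 1 - a) + a by ring.
    apply: le_trans (ler_normD _ _) _.
    have : e / 8 * n <= 1 / 2 * n by apply: ler_wpM2r => //; lra.
    lra.
  have B0 : `|sin b| <= 2 * n.
    have -> : sin b = (sin b - b) + b by ring.
    apply: le_trans (ler_normD _ _) _.
    have : e / 8 * n <= 1 / 2 * n by apply: ler_wpM2r => //; lra.
    lra.
  have A1 : `|expR a - 1| * `|sin b| <= 3 / 2 * n * (2 * n) by exact: ler_pM.
  have : n * n <= n * (e / 8) by apply: ler_wpM2l => //; exact: ltW.
  lra.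
apply: (@le_trans _ _ (e * n)); first lra.
exact: ler_wpM2r.
Qed.

Lemma cder_cexp t : cder (@cexp R) t (cexp t).
Proof.
have h0 : cder (fun z => z - t) t 1.
  by apply: cder_eq (cderB (cder_id t) (cder_cst t t)) _; rewrite subr0.
have h1 : cder (@cexp R) (t - t) 1 by rewrite subrr; exact: cder_cexp0.
apply: cder_ext (cder_eq (cderZ (cexp t) (cder_comp h0 h1)) _) => [z|].
  by rewrite -cexpD addrC subrK.
by rewrite !mulr1.
Qed.

Lemma cder_cexpM (c : C) t : cder (fun z => cexp (c * z)) t (c * cexp (c * t)).
Proof.
have h0 : cder (fun z => c * z) t c.
  by apply: cder_eq (cderZ c (cder_id t)) _; rewrite mulr1.
exact: cder_comp h0 (cder_cexp _).
Qed.

Lemma cder_line F (t0 d l : C) (s : R) : cder F (t0 + s%:C * d) l ->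
  is_derive s (1 : R) (fun u => complex.Re (F (t0 + u%:C * d))) (complex.Re (d * l))
  /\ is_derive s (1 : R) (fun u => complex.Im (F (t0 + u%:C * d))) (complex.Im (d * l)).
Proof.
move=> /cderP h.
(* Real and imaginary part at once: both are real-linear and bounded by the modulus. *)
have key (p : C -> R) : (forall z, `|p z| <= normc z) ->
    (forall z w, p (z - w) = p z - p w) -> (forall (x : R) z, p (x%:C * z) = x * p z) ->
  is_derive s (1 : R) (fun u => p (F (t0 + u%:C * d))) (p (d * l)).
  move=> p1 pB pZ.
  have H : ((u^-1 *: (p (F (t0 + (u *: (1 : R) + s)%:C * d)) - p (F (t0 + s%:C * d))))
     @[u --> (0 : R)^'] --> p (d * l)).
    apply/cvgrPdist_le => e e0.
    have e'0 : 0 < e / (normc d + 1).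
      by apply: divr_gt0 => //; have := normc_ge0 d; lra.
    have [r [r0 hr]] := h _ e'0.
    have d0 := normc_ge0 d.
    apply/nbhs_ballP; exists (r / (normc d + 1)) => /=; first by rewrite divr_gt0 //; lra.
    move=> u; rewrite -ball_normE /= sub0r normrN => hu u0.
    have hu' : normc (u%:C * d) < r.
      rewrite normcM normc_real.
      apply: (@le_lt_trans _ _ (`|u| * (normc d + 1))).
        by apply: ler_wpM2l => //; lra.
      by rewrite -ltr_pdivlMr //; lra.
    have := hr _ hu'.
    have -> : t0 + s%:C * d + u%:C * d = t0 + (u + s)%:C * d.
      by rewrite rmorphD /=; ring.
    rewrite /GRing.scale /= mulr1 => H.
    have -> : p (d * l) - u^-1 * (p (F (t0 + (u + s)%:C * d)) - p (F (t0 + s%:C * d)))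
      = - (u^-1 * p (F (t0 + (u + s)%:C * d) - F (t0 + s%:C * d) - u%:C * d * l)).
      by rewrite !pB -mulrA pZ; field.
    rewrite normrN normrM normfV mulrC ler_pdivrMr ?normr_gt0 //.
    apply: le_trans (p1 _) _; apply: le_trans H _.
    rewrite normcM normc_real.
    apply: (@le_trans _ _ (e / (normc d + 1) * (`|u| * (normc d + 1)))).
      apply: ler_wpM2l; first exact: ltW.
      by apply: ler_wpM2l => //; lra.
    by apply: ler_eq; field; apply/eqP => E; lra.
  split; first by apply/cvg_ex; exists (p (d * l)).
  by apply: cvg_lim H; exact: Rhausdorff.
split.
  apply: (key (@complex.Re R)) => [z|[a b] [a' b']|x [a b]] //=; first exact: normc_Re.
  by rewrite mul0r subr0.
apply: (key (@complex.Im R)) => [z|[a b] [a' b']|x [a b]] //=; first exact: normc_Im.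
by rewrite mul0r addr0.
Qed.

Lemma is_derive_sumsq (f g : R -> R) (s f' g' : R) :
  is_derive s (1 : R) f f' -> is_derive s (1 : R) g g' ->
  is_derive s (1 : R) (fun u => f u ^+ 2 + g u ^+ 2) (2 * (f s * f' + g s * g')).
Proof.
move=> h1 h2; have h : is_derive s (1 : R) (fun u => f u ^+ 2 + g u ^+ 2) _ :=
  is_deriveD (is_deriveX 2 h1) (is_deriveX 2 h2).
by apply: is_derive_eq h _; rewrite /GRing.scale /= !expr1; ring.
Qed.

Lemma cder_line_sq F (t0 d l : C) (s : R) : cder F (t0 + s%:C * d) l ->
  is_derive s (1 : R) (fun u => normc (F (t0 + u%:C * d)) ^+ 2)
    (2 * complex.Re ((F (t0 + s%:C * d))^* * (d * l))).
Proof.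
move=> /cder_line [h1 h2].
have -> : (fun u => normc (F (t0 + u%:C * d)) ^+ 2) =
    (fun u => complex.Re (F (t0 + u%:C * d)) ^+ 2 + complex.Im (F (t0 + u%:C * d)) ^+ 2).
  by apply/funext => u; rewrite normc_sq.
apply: is_derive_eq (is_derive_sumsq h1 h2) _.
case: (F _) => a b; case: (d * l) => a' b'.
by rewrite [X in _ = 2 * X]/= mulNr opprK.
Qed.

Lemma Re_conjM_le z w : complex.Re (z^* * w) <= normc z * normc w.
Proof.
apply: le_trans (ler_norm _) _; apply: le_trans (normc_Re _) _.
rewrite normcM; apply: ler_eq; congr (_ * _).
by case: z => a b /=; rewrite sqrrN.
Qed.

Lemma nonincr_of_derive (f f' : R -> R) (L : R) : 0 <= L ->
  (forall s : R, 0 <= s <= L -> is_derive s (1 : R) f (f' s)) ->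
  (forall s : R, 0 <= s <= L -> f' s <= 0) -> f L <= f 0.
Proof.
move=> L0 hf f'0.
have H1 x : x \in `]0, L[ -> is_derive x (1 : R) f (f' x).
  by rewrite in_itv /= => /andP[a b]; apply: hf; rewrite !ltW.
have H2 : {within `[0, L], continuous f}.
  apply: derivable_within_continuous => x; rewrite in_itv /= => xin.
  by have [] := hf x xin.
have [x] := MVT_segment L0 H1 H2.
rewrite in_itv /= subr0 => /f'0 h e.
by rewrite -subr_le0 e mulr_le0_ge0.
Qed.

(** [K] is a primitive of the growth rate, so that U e^(-K) is nonincreasing and no integral has to
    be formed. *)
Lemma gronwall (U U' K K' : R -> R) (L : R) : 0 <= L ->
  (forall s : R, 0 <= s <= L -> is_derive s (1 : R) U (U' s)) ->
  (forall s : R, 0 <= s <= L -> is_derive s (1 : R) K (K' s)) ->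
  (forall s : R, 0 <= s <= L -> U' s <= K' s * U s) ->
  U L <= expR (K L - K 0) * U 0.
Proof.
move=> L0 hU hK h.
have := @nonincr_of_derive (fun s => U s * expR (- K s))
  (fun s => (U' s - K' s * U s) * expR (- K s)) L L0.
have H1 : forall s : R, 0 <= s <= L -> is_derive s (1 : R) (fun s => U s * expR (- K s))
   ((U' s - K' s * U s) * expR (- K s)).
  move=> s hs; have hUs := hU s hs; have hKs := hK s hs.
  have hN : is_derive s (1 : R) (fun u => - K u) (- K' s) by exact: is_deriveN.
  have hE : is_derive s (1 : R) (fun u => expR (- K u)) (- K' s * expR (- K s)).
    have h1 : is_derive s (1 : R) (fun u => expR (- K u)) _ :=
      @is_derive1_comp R expR (fun u => - K u) s _ _ (is_derive_expR (- K s)) hN.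
    by apply: is_derive_eq h1 _; rewrite mulrC.
  have h2 : is_derive s (1 : R) (fun u => U u * expR (- K u)) _ := is_deriveM hUs hE.
  by apply: is_derive_eq h2 _; rewrite /GRing.scale /=; ring.
have H2 : forall s : R, 0 <= s <= L -> (U' s - K' s * U s) * expR (- K s) <= 0.
  by move=> s hs; apply: mulr_le0_ge0; rewrite ?expR_ge0 // subr_le0 h.
move=> /(_ H1 H2).
rewrite expRN ler_pdivrMr ?expR_gt0 // => /le_trans; apply.
by rewrite expRD expRN; apply: ler_eq; ring.
Qed.

End Basics.

(** * Locally uniform limits of polynomials in the parameters *)

Lemma differentiable_eps (R : realType) (V W : normedModType R[i]) (f : V -> W)
  (d : {linear V -> W}) (a : V) : continuous d ->
  (forall e : R[i], 0 < e -> exists2 s : R[i], 0 < s &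
    forall h, `|h| < s -> `|f (h + a) - (f a + d h)| <= e * `|h|) ->
  differentiable f a.
Proof.
move=> dC hf; have E : f \o shift a = cst (f a) + d +o_ 0 id.
  apply/eqaddoP => e /hf[s s0 hs]; apply/nbhs_ballP; exists s => // h.
  by rewrite -ball_normE /= sub0r normrN => /hs.
by apply/diff_locallyP; rewrite (diff_unique dC E).
Qed.

Section LinePoly.
Variables (R : realType) (m : nat).
Local Notation C := R[i].
Local Notation V := 'rV[C]_m.
Implicit Types (f g : V -> C) (a h : V).

Definition bnd (A : R) a := forall i, normc (a 0 i) <= A.

(* Polynomial along every complex line, with a first-order coefficient which is
   linear in the direction; this is all that Cauchy's estimates need. *)
Definition linepoly g :=
  (forall A, exists M, forall a, bnd A a -> normc (g a) <= M) /\
  forall a, exists l : 'I_m -> C, forall h, exists p : {poly C},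
    (forall z, g (a + z *: h) = p.[z]) /\ p`_1 = \sum_i h 0 i * l i.

(** This class plays the part of the entire functions of a: it is closed under sums, products and,
    by the triangle inequality, limits that are uniform on polydiscs, and its members are complex
    differentiable ([ent_differentiable]). *)
Definition ent f := forall A e : R, 0 < e -> exists2 g, linepoly g &
  forall a, bnd A a -> normc (g a - f a) <= e.

Lemma linepoly_cst (c : C) : linepoly (fun=> c).
Proof.
split=> [A|a]; first by exists (normc c).
exists (fun=> 0) => h; exists c%:P; split=> [z|]; first by rewrite hornerC.
by rewrite coefC /= big1 // => i _; rewrite mulr0.
Qed.

Lemma linepoly_coord i : linepoly (fun a => a 0 i).
Proof.
split=> [A|a]; first by exists A => a; apply.
exists (fun j => (j == i)%:R) => h; exists ((a 0 i)%:P + (h 0 i)%:P * 'X).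
split=> [z|]; first by rewrite !hornerE !mxE mulrC.
rewrite coefD coefC coefCM coefX /= mulr1 add0r (bigD1 i) //= eqxx mulr1.
by rewrite big1 ?addr0 // => j /negPf ->; rewrite mulr0.
Qed.

Lemma linepolyD f g : linepoly f -> linepoly g -> linepoly (fun a => f a + g a).
Proof.
move=> [bf lf] [bg lg]; split=> [A|a].
  have [M hM] := bf A; have [N hN] := bg A; exists (M + N) => a ha.
  by apply: le_trans (normcD _ _) _; apply: lerD; [exact: hM|exact: hN].
have [l hl] := lf a; have [k hk] := lg a; exists (fun i => l i + k i) => h.
have [p [hp p1]] := hl h; have [q [hq q1]] := hk h; exists (p + q).
split=> [z|]; first by rewrite hornerD hp hq.
by rewrite coefD p1 q1 -big_split; apply: eq_bigr => i _; rewrite mulrDr.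
Qed.

Lemma linepolyM f g : linepoly f -> linepoly g -> linepoly (fun a => f a * g a).
Proof.
move=> [bf lf] [bg lg]; split=> [A|a].
  have [M hM] := bf A; have [N hN] := bg A; exists (M * N) => a ha.
  by rewrite normcM; apply: ler_pM; rewrite ?normc_ge0 //; [exact: hM|exact: hN].
have [l hl] := lf a; have [k hk] := lg a.
exists (fun i => f a * k i + l i * g a) => h.
have [p [hp p1]] := hl h; have [q [hq q1]] := hk h; exists (p * q).
split=> [z|]; first by rewrite hornerM hp hq.
rewrite coefM !big_ord_recl big_ord0 /= p1 q1 addr0.
have -> : p`_0 = f a by rewrite -horner_coef0 -hp scale0r addr0.
have -> : q`_0 = g a by rewrite -horner_coef0 -hq scale0r addr0.
rewrite mulr_sumr mulr_suml -big_split; apply: eq_bigr => i _ /=.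
by ring.
Qed.

Lemma ent_linepoly g : linepoly g -> ent g.
Proof.
by move=> hg A e e0; exists g => // a _; rewrite subrr normc0 ltW.
Qed.

Lemma ent_cst (c : C) : ent (fun=> c).
Proof. exact: ent_linepoly (linepoly_cst c). Qed.

Lemma ent_coord i : ent (fun a => a 0 i).
Proof. exact: ent_linepoly (linepoly_coord i). Qed.

Lemma ent_ext f g : f =1 g -> ent f -> ent g.
Proof. by move=> /funext ->. Qed.

Lemma ent_bounded f : ent f ->
  forall A, exists M, forall a, bnd A a -> normc (f a) <= M.
Proof.
move=> hf A; have [g [bg _] hg] := hf A _ (@ltr01 R).
have [M hM] := bg A; exists (M + 1) => a ha.
have := normcB (g a) (g a - f a); rewrite subKr => /le_trans; apply.
by apply: lerD; [exact: hM|exact: hg].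
Qed.

Lemma ent_lim f : (forall A e : R, 0 < e -> exists2 g, ent g &
  forall a, bnd A a -> normc (g a - f a) <= e) -> ent f.
Proof.
move=> h A e e0; have e20 : 0 < e / 2 by rewrite divr_gt0.
have [g /(_ A _ e20)[k lk hk] hg] := h A _ e20.
exists k => // a ha; apply: le_trans (normc_dist _ _ (g a)) _.
by rewrite [leRHS]splitr; apply: lerD; [exact: hk|exact: hg].
Qed.

Lemma entD f g : ent f -> ent g -> ent (fun a => f a + g a).
Proof.
move=> hf hg A e e0; have e20 : 0 < e / 2 by rewrite divr_gt0.
have [f' lf' hf'] := hf A _ e20; have [g' lg' hg'] := hg A _ e20.
exists (fun a => f' a + g' a); first exact: linepolyD.
move=> a ha; rewrite opprD addrACA; apply: le_trans (normcD _ _) _.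
by rewrite [leRHS]splitr; apply: lerD; [exact: hf'|exact: hg'].
Qed.

Lemma entM f g : ent f -> ent g -> ent (fun a => f a * g a).
Proof.
move=> hf hg A e e0; have [M hM] := ent_bounded hf A.
have [N hN] := ent_bounded hg A.
pose K := `|M| + `|N| + 1.
have K1 : 1 <= K by rewrite /K lerDr addr_ge0.
have MK : M <= K by rewrite /K; have := ler_norm M; have := normr_ge0 N; lra.
have NK : N <= K by rewrite /K; have := ler_norm N; have := normr_ge0 M; lra.
have K0 : 0 < K by lra.
pose d := Num.min 1 (e / (3 * K)).
have d0 : 0 < d by rewrite lt_min ltr01 divr_gt0 ?mulr_gt0.
have d1 : d <= 1 by rewrite ge_min lexx.
have d2 : d * (3 * K) <= e by rewrite -ler_pdivlMr ?mulr_gt0 // ge_min lexx orbT.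
have [f' lf' hf'] := hf A _ d0; have [g' lg' hg'] := hg A _ d0.
exists (fun a => f' a * g' a); first exact: linepolyM.
move=> a ha.
(* Each of the three summands is at most d K, whence the choice of [d] with 3 K d <= e. *)
have -> : f' a * g' a - f a * g a = (f' a - f a) * (g' a - g a) +
  (f' a - f a) * g a + f a * (g' a - g a) by ring.
apply: le_trans (normcD _ _) _; apply: le_trans (lerD (normcD _ _) (lexx _)) _.
rewrite !normcM.
have h1 : normc (f' a - f a) * normc (g' a - g a) <= d * 1.
  apply: ler_pM; rewrite ?normc_ge0 //; first exact: hf'.
  exact: le_trans (hg' a ha) d1.
have h2 : normc (f' a - f a) * normc (g a) <= d * K.
  apply: ler_pM; rewrite ?normc_ge0 //; first exact: hf'.
  exact: le_trans (hN a ha) NK.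
have h3 : normc (f a) * normc (g' a - g a) <= K * d.
  apply: ler_pM; rewrite ?normc_ge0 //; last exact: hg'.
  exact: le_trans (hM a ha) MK.
have h4 : d * 1 <= d * K by apply: ler_wpM2l => //; exact: ltW.
by lra.
Qed.

Lemma entZ (c : C) f : ent f -> ent (fun a => c * f a).
Proof. exact: entM (ent_cst c). Qed.

Lemma ent_sum (I : Type) (r : seq I) (P : pred I) (F : I -> V -> C) :
  (forall i, P i -> ent (F i)) -> ent (fun a => \sum_(i <- r | P i) F i a).
Proof.
move=> h; elim: r => [|i r IH].
  by apply: ent_ext (ent_cst 0) => a; rewrite big_nil.
case: (boolP (P i)) => Pi.
  by apply: ent_ext (entD (h i Pi) IH) => a; rewrite big_cons Pi.
by apply: ent_ext IH => a; rewrite big_cons (negPf Pi).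
Qed.

Lemma entX f n : ent f -> ent (fun a => f a ^+ n).
Proof.
move=> hf; elim: n => [|n IH]; first exact: ent_cst.
by apply: ent_ext (entM hf IH) => a; rewrite exprS.
Qed.

(* Cauchy's estimate, by averaging over the n-th roots of unity, n > deg p. *)
Lemma poly_cauchy (p : {poly C}) (M : R) :
  (forall z, normc z <= 1 -> normc p.[z] <= M) -> forall k, normc p`_k <= M.
Proof.
move=> hM k; pose n := (maxn (size p) k).+1.
have n0 : (0 < n)%N by [].
have [w pw] : exists w : C, n.-primitive_root w.
  by exists (cexp (0 +i* (2 * pi / n%:R))); exact: cexp_prim_root.
have w1 : normc w = 1.
  apply: (@pexpIrn R n); rewrite ?nnegrE ?normc_ge0 ?ler01 //.
  by rewrite -normcX (prim_expr_order pw) normc1 expr1n.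
have kn : (k < n)%N by rewrite /n ltnS leq_maxr.
(* Orthogonality of the n-th roots of unity, with n - k in place of the exponent -k. *)
have sumw i : (i < n)%N -> \sum_(j < n) (w ^+ j) ^+ i * (w ^+ j) ^+ (n - k) =
    if i == k then n%:R else 0.
  move=> lin.
  under eq_bigr do rewrite -exprD -exprM mulnC exprM.
  have [->|ik] := eqVneq i k.
    rewrite subnKC ?(ltnW kn) // (prim_expr_order pw).
    by under eq_bigr do rewrite expr1n; rewrite sumr_const card_ord.
  set v := w ^+ _.
  have v1 : v != 1.
    rewrite /v -(prim_order_dvd pw); apply: contra ik => /dvdnP[c hc].
    apply/eqP; have : (c = 1)%N by nia.
    by move=> c1; move: hc; rewrite c1; lia.
  apply/eqP; rewrite -(mulrI_eq0 _ (mulfI (_ : v - 1 != 0))) ?subr_eq0 //.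
  by rewrite -subrX1 /v -exprM mulnC exprM (prim_expr_order pw) expr1n subrr.
have E : \sum_(j < n) p.[w ^+ j] * (w ^+ j) ^+ (n - k) = n%:R * p`_k.
  have sp : (size p <= n)%N by rewrite /n leqW // leq_maxl.
  under eq_bigr do rewrite (horner_coef_wide _ sp) mulr_suml.
  rewrite exchange_big /= (bigD1 (Ordinal kn)) //= [X in _ + X]big1 ?addr0.
    under eq_bigr do rewrite -mulrA.
    by rewrite -mulr_sumr sumw // eqxx mulrC.
  move=> i ik; under eq_bigr do rewrite -mulrA.
  rewrite -mulr_sumr sumw // ifN ?mulr0 //.
have nR : 0 < n%:R :> R by rewrite ltr0n.
rewrite -(ler_pM2l nR) -normcn -normcM -E.
apply: le_trans (normc_sum _ _ _) _.
apply: (@le_trans _ _ (\sum_(j < n) M)).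
  apply: ler_sum => j _; rewrite normcM !normcX w1 !expr1n mulr1.
  by apply: hM; rewrite normcX w1 expr1n.
by rewrite sumr_const card_ord normcn mulr_natl.
Qed.

Lemma geom_half_le (x : R) n : 0 <= x <= 2^-1 -> \sum_(i < n) x ^+ i <= 2.
Proof.
move=> /andP[x0 x2].
have h : \sum_(i < n) x ^+ i <= 2 - 2 * x ^+ n.
  elim: n => [|n IH]; first by rewrite big_ord0 expr0; lra.
  rewrite big_ord_recr /= exprS.
  have : 0 <= x ^+ n by rewrite exprn_ge0.
  have : x * x ^+ n <= 2^-1 * x ^+ n by rewrite ler_wpM2r // exprn_ge0.
  by lra.
by apply: le_trans h _; rewrite lerBlDr lerDl mulr_ge0 ?exprn_ge0.
Qed.

Lemma poly_taylor1 (p : {poly C}) (M : R) (z : C) :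
  (forall k, normc p`_k <= M) -> normc z <= 2^-1 ->
  normc (p.[z] - p`_0 - z * p`_1) <= 2 * M * normc z ^+ 2.
Proof.
move=> hM hz; have M0 : 0 <= M := le_trans (normc_ge0 _) (hM 0%N).
have sp : (size p <= (size p).+2)%N by rewrite leqW.
rewrite (horner_coef_wide _ sp) !big_ord_recl /= expr0 mulr1 expr1.
set S := \sum_(i < _) _.
have -> : p`_0 + (p`_1 * z + S) - p`_0 - z * p`_1 = S by ring.
apply: le_trans (normc_sum _ _ _) _.
apply: (@le_trans _ _ (\sum_(i < size p) M * normc z ^+ 2 * normc z ^+ i)).
  apply: ler_sum => i _; rewrite normcM normcX /bump /= !add1n -mulrA -exprD add2n.
  by apply: ler_wpM2r; rewrite ?exprn_ge0 ?normc_ge0.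
rewrite -mulr_sumr mulrC -mulrA; apply: ler_pM => //.
- by apply: sumr_ge0 => i _; rewrite exprn_ge0 ?normc_ge0.
- by rewrite mulr_ge0 // exprn_ge0 ?normc_ge0.
- by apply: geom_half_le; rewrite normc_ge0.
Qed.

(** Any two of the intervals [u n - b n, u n + b n] meet, so the supremum of their left ends lies in
    all of them. The explicit distance [b n] to the limit is what later gives uniformity in a. *)
Lemma real_cauchy (u b : nat -> R) :
  (forall n k, (n <= k)%N -> `|u k - u n| <= b n) ->
  exists l, forall n, `|l - u n| <= b n.
Proof.
move=> h; pose E : set R := [set x | exists n, x = u n - b n].
have key n k : u n - b n <= u k + b k.
  have h1 := h n (maxn n k) (leq_maxl _ _); have h2 := h k (maxn n k) (leq_maxr _ _).
  by move: h1 h2; rewrite !ler_norml => /andP[? ?] /andP[? ?]; lra.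
have ubE k : ubound E (u k + b k) by move=> _ [n ->].
have neE : E !=set0 by exists (u 0%N - b 0%N), 0%N.
have hsE : has_sup E by split => //; exists (u 0%N + b 0%N).
exists (sup E) => n; rewrite ler_norml; apply/andP; split.
  suff : u n - b n <= sup E by lra.
  by apply: ub_le_sup; [case: hsE|exists n].
suff : sup E <= u n + b n by lra.
exact: ge_sup.
Qed.

Lemma complex_cauchy (u : nat -> C) (b : nat -> R) :
  (forall n k, (n <= k)%N -> normc (u k - u n) <= b n) ->
  exists l, forall n, normc (l - u n) <= 2 * b n.
Proof.
move=> h.
have [x hx] : exists x, forall n, `|x - complex.Re (u n)| <= b n.
  apply: (@real_cauchy (fun n => complex.Re (u n))) => n k /h; apply: le_trans.
  by have := normc_Re (u k - u n); case: (u k) => ? ?; case: (u n).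
have [y hy] : exists y, forall n, `|y - complex.Im (u n)| <= b n.
  apply: (@real_cauchy (fun n => complex.Im (u n))) => n k /h; apply: le_trans.
  by have := normc_Im (u k - u n); case: (u k) => ? ?; case: (u n).
exists (x +i* y) => n; apply: le_trans (normc_le_ReIm _) _.
have := hx n; have := hy n; case: (u n) => a b' /=; lra.
Qed.

Lemma le_of_eps (x B b : R) : 0 <= b ->
  (forall e : R, 0 < e -> x <= B + b * e) -> x <= B.
Proof.
move=> b0 h; apply/ler_addgt0Pr => e e0.
apply: (le_trans (h (e / (b + 1)) _)); first by rewrite divr_gt0 //; lra.
rewrite lerD2l mulrA ler_pdivrMr; last by lra.
by rewrite mulrC; apply: ler_wpM2l; lra.
Qed.

Lemma bndD A B a h (z : C) : bnd A a -> bnd 1 h -> normc z <= B -> bnd (A + B) (a + z *: h).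
Proof.
move=> ha hh hz i; rewrite !mxE; apply: le_trans (normcD _ _) _.
apply: lerD; first exact: ha.
by rewrite normcM -[leRHS]mulr1; apply: ler_pM; rewrite ?normc_ge0.
Qed.

Lemma bnd_exists a : exists A, bnd A a.
Proof.
exists (\sum_i normc (a 0 i)) => i; rewrite (bigD1 i) //= lerDl.
by apply: sumr_ge0 => j _; exact: normc_ge0.
Qed.

(** The partial derivatives [l'] are limits of the first-order coefficients of the approximations
    g_n: Cauchy's estimate for g_k - g_n on a unit disc makes these a Cauchy sequence. The
    second-order remainder of g_n has a bound independent of n and so survives the limit. *)
Lemma ent_taylor1 f a : ent f -> exists (l : 'I_m -> C) (M : R), 0 <= M /\
  forall h z, bnd 1 h -> normc z <= 2^-1 ->
    normc (f (a + z *: h) - f a - z * \sum_i h 0 i * l i) <= M * normc z ^+ 2.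
Proof.
(* The extra 1 keeps the unit disc around a, in every direction bounded by 1, inside the polydisc on
   which the approximations are uniform. *)
move=> hf; have [A0 hA0] := bnd_exists a; pose A := A0 + 1.
pose b n : R := n.+1%:R^-1.
have b0 n : 0 < b n by rewrite invr_gt0 ltr0n.
have /choice[g hg] : forall n, exists g, linepoly g /\
    forall a, bnd A a -> normc (g a - f a) <= b n.
  by move=> n; have [g] := hf A (b n) (b0 n); exists g.
have /choice[l hl] := fun n => (hg n).1.2 a.
have line n h z : bnd 1 h -> normc z <= 1 ->
    normc (g n (a + z *: h) - f (a + z *: h)) <= b n.
  by move=> hh hz; apply: (hg n).2; exact: bndD.
have [l' hl'] : exists l' : 'I_m -> C, forall i n, normc (l' i - l n i) <= 2 * (2 * b n).
  suff H (i : 'I_m) : exists x : C, forall n, normc (x - l n i) <= 2 * (2 * b n).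
    by have [l' hl'] := choice H; exists l'.
  apply: complex_cauchy => n k nk.
  (* Along the i-th basis vector the first-order coefficient of g_n is [l n i] itself. *)
  pose h : V := delta_mx 0 i.
  have hh : bnd 1 h.
    by move=> j; rewrite mxE /=; case: (_ == _); rewrite ?normc1 ?normc0.
  have lE p : \sum_j h 0 j * l p j = l p i.
    rewrite (bigD1 i) //= mxE !eqxx mul1r big1 ?addr0 // => j ji.
    by rewrite mxE (negPf ji) mul0r.
  have [p [hp p1]] := hl n h; have [q [hq q1]] := hl k h.
  rewrite -!lE -p1 -q1 -coefB; apply: poly_cauchy => z hz.
  rewrite hornerD hornerN -hp -hq.
  apply: le_trans (normc_dist _ _ (f (a + z *: h))) _.
  have h1 := line k h z hh hz; have := line n h z hh hz; rewrite normcBC => h2.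
  have : b k <= b n by rewrite lef_pV2 ?posrE ?ltr0n // ler_nat.
  by lra.
have [M0 hM0] := ent_bounded hf A; pose M := `|M0| + 1.
have M1 : 1 <= M by rewrite /M lerDr.
exists l', (2 * M); split; first lra.
move=> h z hh hz.
apply: (@le_of_eps _ _ (2 + 4 * m%:R)); first by rewrite addr_ge0 // mulr_ge0.
move=> e e0.
have [n ne] : exists n, b n <= e.
  have [n hn] := ltr_add_invr e0.
  by exists n; rewrite /b; move: hn; rewrite add0r => /ltW.
have [p [hp p1]] := hl n h.
have hz1 : normc z <= 1 by apply: le_trans hz _; lra.
have bp k : normc p`_k <= M.
  apply: poly_cauchy => w hw; rewrite -hp.
  have h1 := line n h w hh hw.
  have h2 := hM0 _ (bndD hA0 hh hw).
  have h3 := normcD (g n (a + w *: h) - f (a + w *: h)) (f (a + w *: h)).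
  rewrite subrK in h3; rewrite /M.
  have h4 : b n <= 1 by rewrite invf_le1 ?ltr0n // ler1n.
  have := ler_norm M0; lra.
have T := poly_taylor1 bp hz.
have p0 : p`_0 = g n a by rewrite -horner_coef0 -hp scale0r addr0.
have A1 := line n h z hh hz1.
have z0 : normc (0 : C) <= 1 by rewrite normc0 ler01.
have A2 := line n h 0 hh z0; rewrite scale0r addr0 in A2.
rewrite p1 p0 -hp in T.
have A3 : normc (z * (\sum_i h 0 i * l n i - \sum_i h 0 i * l' i)) <= 4 * m%:R * b n.
  rewrite -sumrB normcM -[leRHS]mul1r; apply: ler_pM; rewrite ?normc_ge0 //.
  apply: le_trans (normc_sum _ _ _) _.
  apply: (@le_trans _ _ (\sum_(i < m) 4 * b n)).
    apply: ler_sum => i _; rewrite -mulrBr normcM -[leRHS]mul1r.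
    apply: ler_pM; [exact: normc_ge0|exact: normc_ge0|exact: hh|].
    by rewrite normcBC; apply: le_trans (hl' i n) _; lra.
  by rewrite sumr_const card_ord -[leLHS]mulr_natr; lra.
have -> : f (a + z *: h) - f a - z * (\sum_i h 0 i * l' i) =
  (g n (a + z *: h) - g n a - z * (\sum_i h 0 i * l n i))
  - (g n (a + z *: h) - f (a + z *: h)) + (g n a - f a)
  + z * (\sum_i h 0 i * l n i - \sum_i h 0 i * l' i) by ring.
apply: le_trans (normcD _ _) _; apply: le_trans (lerD (normcD _ _) (lexx _)) _.
apply: le_trans (lerD (lerD (normcB _ _) (lexx _)) (lexx _)) _.
have : (2 + 4 * m%:R) * b n <= (2 + 4 * m%:R) * e.
  by apply: ler_wpM2l => //; rewrite addr_ge0 // mulr_ge0.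
by lra.
Qed.

Lemma rV_norm_coord a i : `|a 0 i| <= `|a|.
Proof.
rewrite [leRHS]/Num.norm /= mx_normE.
have := @le_bigmax _ _ _ (0%:nng : {nonneg C}) (fun i : 'I_1 * 'I_m => `|a i.1 i.2|%:nng) (0, i).
exact.
Qed.

Lemma ent_differentiable f a : ent f -> differentiable f a.
Proof.
move=> hf; have [l [M [M0 hM]]] := ent_taylor1 a hf.
pose d h : C := \sum_i h 0 i * l i.
have ld : linear d.
  move=> c u v; rewrite /d scaler_sumr -big_split; apply: eq_bigr => i _ /=.
  by rewrite !mxE mulrDl /GRing.scale /= mulrA.
pose dM := GRing.isLinear.Build _ _ _ _ _ ld.
pose dL : {linear V -> C} := HB.pack d dM.
have dB u : normc (d u) <= complex.Re `|u| * \sum_i normc (l i).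
  rewrite mulr_sumr; apply: le_trans (normc_sum _ _ _) _; apply: ler_sum => i _.
  rewrite normcM; apply: ler_wpM2r; first exact: normc_ge0.
  by have := rV_norm_coord u i; rewrite lecE => /andP[].
have L0 : 0 <= \sum_i normc (l i) by apply: sumr_ge0 => i _; exact: normc_ge0.
have normE u : `|u| = (complex.Re `|u|)%:C.
  by have : 0 <= `|u| := normr_ge0 u; case: `|u| => x y; rewrite lecE /= => /andP[/eqP->].
have dC : continuous dL.
  move=> x; apply/(@cvgrPdist_le _ _ _ (nbhs x) (nbhs_filter x)) => e /posc_real[r r0 ->].
  have r'0 : 0 < r / (\sum_i normc (l i) + 1) by rewrite divr_gt0 //; lra.
  apply/nbhs_ballP; exists (r / (\sum_i normc (l i) + 1))%:C.
    by rewrite /= ltc_real.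
  move=> y; rewrite -ball_normE /= normE ltc_real ltr_pdivlMr; last by lra.
  have -> : d x - d y = d (x - y) by rewrite -[d]/(dL : V -> C) linearB.
  move=> h; rewrite normCE lec_real; apply: le_trans (dB _) _; apply: le_trans (ltW h).
  apply: ler_wpM2l; last lra.
  by rewrite -lec_real -normE normr_ge0.
apply: (differentiable_eps dC) => e /posc_real[r r0 ->].
  pose s := Num.min 2^-1 (r / (M + 1)).
  have s0 : 0 < s by rewrite lt_min invr_gt0 ltr0n divr_gt0 //; lra.
  exists s%:C; first by rewrite ltc_real.
  move=> h; rewrite normE ltc_real.
  have n0 : 0 <= complex.Re `|h| by rewrite -lec_real -normE normr_ge0.
  move: n0 (normE _ _ h) (rV_norm_coord h); move: (complex.Re _) => n n0 nE hn.
  rewrite lt_min => /andP[ns1]; rewrite ltr_pdivlMr; last by lra.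
  move=> ns2; rewrite -rmorphM /= normCE lec_real.
  have -> : f (h + a) - (f a + dL h) = f (h + a) - (f a + d h) by [].
  have [n00|nn0] := eqVneq n 0.
    have -> : h = 0 by apply/eqP; rewrite -normr_eq0 nE n00.
    have -> : d 0 = 0 by rewrite -[d]/(dL : V -> C) linear0.
    by rewrite add0r addr0 subrr normc0 mulr_ge0 // ltW.
  have np : 0 < n by rewrite lt_neqAle eq_sym nn0.
  have nC : n%:C != 0 :> C by rewrite gt_eqF // ltc_real.
  (* The increment h is |h| times a direction bounded by 1, to which the Taylor estimate applies
     with z = |h|. *)
  have hk : bnd 1 ((n%:C)^-1 *: h).
    move=> i; rewrite mxE normcM normcV normc_real gtr0_norm // mulrC.
    by rewrite ler_pdivrMr // mul1r; have := hn i; rewrite nE normCE lec_real.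
  have hz : normc n%:C <= 2^-1 by rewrite normc_real ger0_norm // ltW.
  have := hM _ _ hk hz; rewrite scalerA divff // scale1r.
  have -> : n%:C * (\sum_i ((n%:C)^-1 *: h) 0 i * l i) = d h.
    rewrite mulr_sumr; apply: eq_bigr => i _; rewrite !mxE; by field.
  rewrite normc_real ger0_norm // [a + h]addrC opprD addrA => /le_trans; apply.
  rewrite expr2 mulrA; apply: ler_wpM2r => //.
  apply: le_trans (ltW ns2); rewrite mulrC; apply: ler_wpM2l => //; lra.
Qed.
End LinePoly.

(** * Power series *)

Section PowerSeries.
Variable R : realType.
Local Notation C := R[i].
Implicit Types (z w t l : C) (F G : C -> C) (f g : nat -> C).

Definition pser (N : nat) f t := \sum_(n < N) f n * t ^+ n.

Definition pconv f t l := forall e : R, 0 < e -> exists N0, forall N, (N0 <= N)%N ->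
  normc (pser N f t - l) <= e.

Definition psum f t : C := xget 0 [set l | pconv f t l].

(** Infinite radius of convergence, stated as Cauchy bounds on every circle; these give explicit
    tails. *)
Definition rapid f := forall r : R, 0 < r ->
  exists M, forall n, normc (f n) * r ^+ n <= M.

Definition dcoef f n : C := n.+1%:R * f n.+1.

Definition cauchy_prod f g n : C := \sum_(k < n.+1) f k * g (n - k)%N.

Lemma normc_small_eq z w (b : R) : 0 <= b ->
  (forall e : R, 0 < e -> normc (z - w) <= b * e) -> z = w.
Proof.
move=> b0 h; apply/eqP; rewrite -subr_eq0; apply/eqP/eq0_normc/le_anti.
rewrite normc_ge0 andbT; apply: le_of_eps b0 _ => e /h.
by rewrite add0r.
Qed.

Lemma pconv_unique f t l k : pconv f t l -> pconv f t k -> l = k.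
Proof.
move=> hl hk; apply: (@normc_small_eq _ _ 2) => // e e0.
have [N1 h1] := hl e e0; have [N2 h2] := hk e e0.
have := h1 _ (leq_maxl N1 N2); have := h2 _ (leq_maxr N1 N2).
have := normc_dist l k (pser (maxn N1 N2) f t).
rewrite [normc (l - pser _ _ _)]normcBC; lra.
Qed.

Lemma psumE f t l : pconv f t l -> psum f t = l.
Proof. by move=> h; apply: pconv_unique (xgetPex 0 (ex_intro _ l h)) h. Qed.

Lemma pow2_small (M e : R) : 0 < e -> exists N0 : nat, forall N, (N0 <= N)%N ->
  M * 2^-1 ^+ N <= e.
Proof.
move=> e0; have M1 : 0 < `|M| + 1 by have := normr_ge0 M; lra.
have [N0] := ltr_add_invr (divr_gt0 e0 M1); rewrite add0r => hN; exists N0 => N NN.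
have h : 2^-1 ^+ N <= N0.+1%:R^-1 :> R.
  rewrite exprVn lef_pV2 ?posrE ?ltr0n ?exprn_gt0 // -natrX ler_nat.
  exact: leq_trans (ltn_expl N0 _) (leq_pexp2l _ NN).
have p0 : 0 <= 2^-1 ^+ N :> R by rewrite exprn_ge0 // invr_ge0.
apply: (@le_trans _ _ ((`|M| + 1) * 2^-1 ^+ N)).
  by apply: ler_wpM2r => //; have := ler_norm M; lra.
apply: (@le_trans _ _ ((`|M| + 1) * (e / (`|M| + 1)))).
  by apply: ler_wpM2l; [have := normr_ge0 M; lra|exact: le_trans h (ltW hN)].
by apply: ler_eq; field; apply/eqP; have := normr_ge0 M; lra.
Qed.

Lemma geom_tail (N K : nat) : (N <= K)%N ->
  \sum_(N <= n < K) 2^-1 ^+ n <= 2 * 2^-1 ^+ N :> R.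
Proof.
move=> NK; rewrite -{1}[N]add0n big_addn big_mkord.
under eq_bigr do rewrite exprD.
rewrite -mulr_suml; apply: ler_wpM2r; first by rewrite exprn_ge0 // invr_ge0.
by apply: geom_half_le; rewrite invr_ge0 ler0n lexx.
Qed.

(** A bound on the circle of radius 2 r makes the terms inside radius r decrease like 2^(-n). *)
Lemma pser_tail f t (r M : R) (N K : nat) : normc t <= r ->
  (forall n, normc (f n) * (2 * r) ^+ n <= M) -> (N <= K)%N ->
  normc (pser K f t - pser N f t) <= 2 * M * 2^-1 ^+ N.
Proof.
move=> tr hM NK; have r0 : 0 <= r := le_trans (normc_ge0 _) tr.
rewrite /pser -!(big_mkord xpredT (fun n => f n * t ^+ n)).
rewrite (big_cat_nat (leq0n N) NK) /= addrAC subrr add0r.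
apply: le_trans (normc_sum _ _ _) _.
apply: (@le_trans _ _ (\sum_(N <= n < K) M * 2^-1 ^+ n)).
  apply: ler_sum => n _; rewrite normcM normcX.
  apply: (@le_trans _ _ (normc (f n) * r ^+ n)).
    by apply: ler_wpM2l; [exact: normc_ge0|apply: lerXn2r; rewrite ?nnegrE ?normc_ge0].
  have -> : normc (f n) * r ^+ n = normc (f n) * (2 * r) ^+ n * 2^-1 ^+ n.
    by rewrite exprMn exprVn; field; rewrite expf_neq0.
  by apply: ler_wpM2r => //; rewrite exprn_ge0 // invr_ge0.
rewrite -mulr_sumr; have -> : 2 * M * 2^-1 ^+ N = M * (2 * 2^-1 ^+ N) by ring.
apply: ler_wpM2l; last exact: geom_tail.
by apply: le_trans (hM 0%N); rewrite expr0 mulr1 normc_ge0.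
Qed.

Lemma rapid_bound f t : rapid f -> exists r M : R, [/\ 0 < r, normc t <= r &
  forall n, normc (f n) * (2 * r) ^+ n <= M].
Proof.
move=> hf; have t0 := normc_ge0 t.
have [|M hM] := hf (2 * (normc t + 1)); first by lra.
by exists (normc t + 1), M; split => //; lra.
Qed.

Lemma psumP f t : rapid f -> pconv f t (psum f t).
Proof.
move=> hf; have [r [M [r0 tr hM]]] := rapid_bound t hf.
have [l hl] := complex_cauchy (fun N K => pser_tail tr hM).
suff hc : pconv f t l by rewrite (psumE hc).
move=> e e0; have [N0 hN] := pow2_small (2 * (2 * M)) e0.
exists N0 => N /hN h; rewrite normcBC; apply: le_trans (hl N) _; lra.
Qed.

Lemma psum_bound f t (r M : R) : 0 < r -> rapid f -> normc t <= r ->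
  (forall n, normc (f n) * (2 * r) ^+ n <= M) -> forall N,
  normc (psum f t - pser N f t) <= 2 * M * 2^-1 ^+ N.
Proof.
move=> r0 hf tr hM N; apply: (@le_of_eps R _ _ 1) => // e e0.
have [K hK] := psumP t hf e0.
have h1 := hK _ (leq_maxl K N); have h2 := pser_tail tr hM (leq_maxr K N).
rewrite normcBC in h1.
have := normc_dist (psum f t) (pser N f t) (pser (maxn K N) f t); lra.
Qed.

Lemma pconvD f g t l k : pconv f t l -> pconv g t k ->
  pconv (fun n => f n + g n) t (l + k).
Proof.
move=> hf hg e e0; have e20 : 0 < e / 2 by rewrite divr_gt0.
have [N1 h1] := hf _ e20; have [N2 h2] := hg _ e20.
exists (maxn N1 N2) => N; rewrite geq_max => /andP[n1 n2].
have -> : pser N (fun n => f n + g n) t - (l + k) = (pser N f t - l) + (pser N g t - k).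
  rewrite opprD addrACA; congr (_ + _); rewrite -big_split; apply: eq_bigr => i _.
  by rewrite mulrDl.
apply: le_trans (normcD _ _) _; rewrite [leRHS]splitr; apply: lerD; [exact: h1|exact: h2].
Qed.

Lemma pconvZ (c : C) f t l : pconv f t l -> pconv (fun n => c * f n) t (c * l).
Proof.
move=> hf e e0; have c0 := normc_ge0 c.
have e20 : 0 < e / (normc c + 1) by rewrite divr_gt0 //; lra.
have [N1 h1] := hf _ e20; exists N1 => N /h1 h.
have -> : pser N (fun n => c * f n) t - c * l = c * (pser N f t - l).
  by rewrite mulrBr; congr (_ - _); rewrite mulr_sumr; apply: eq_bigr => i _; rewrite mulrA.
rewrite normcM; apply: (@le_trans _ _ ((normc c + 1) * (e / (normc c + 1)))).
  by apply: ler_pM; rewrite ?normc_ge0 //; lra.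
by apply: ler_eq; field; apply/eqP; lra.
Qed.

Lemma pconv_sum (I : Type) (r : seq I) (P : pred I) (F : I -> nat -> C) t (L : I -> C) :
  (forall i, P i -> pconv (F i) t (L i)) ->
  pconv (fun n => \sum_(i <- r | P i) F i n) t (\sum_(i <- r | P i) L i).
Proof.
move=> h; elim: r => [|i r IH].
  rewrite big_nil => e e0; exists 0%N => N _; rewrite subr0 /pser big1 ?normc0 ?ltW //.
  by move=> n _; rewrite big_nil mul0r.
rewrite big_cons; case: ifPn => Pi.
  have -> : (fun n => \sum_(j <- i :: r | P j) F j n) =
      (fun n => F i n + \sum_(j <- r | P j) F j n).
    by apply/funext => n; rewrite big_cons Pi.
  exact: pconvD (h i Pi) IH.
have -> // : (fun n => \sum_(j <- i :: r | P j) F j n) =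
    (fun n => \sum_(j <- r | P j) F j n).
by apply/funext => n; rewrite big_cons (negPf Pi).
Qed.

Lemma n_le_2expn n : (n <= 2 ^ n)%N.
Proof. exact: ltnW (ltn_expl _ _). Qed.

(** The remainder for n + 1 is (t + h) times that for n, plus n h^2 t^(n-1). Hence the factor n^2,
    as n^2 + n <= (n + 1)^2; the condition s >= 1 brings all powers of s to the same exponent. *)
Lemma pow_remainder t h (s : R) n : 1 <= s -> normc t <= s -> normc (t + h) <= s ->
  normc ((t + h) ^+ n - t ^+ n - h * (n%:R * t ^+ n.-1)) <=
  (n ^ 2)%:R * normc h ^+ 2 * s ^+ n.
Proof.
move=> s1 ts ths; have s0 : 0 <= s by lra.
elim: n => [|n IH].
  by rewrite !expr0 mul0r mulr0 subrr subr0 normc0 !mul0r.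
have -> : (t + h) ^+ n.+1 - t ^+ n.+1 - h * (n.+1%:R * t ^+ n.+1.-1) =
  (t + h) * ((t + h) ^+ n - t ^+ n - h * (n%:R * t ^+ n.-1)) + n%:R * h ^+ 2 * t ^+ n.-1.
  case: n {IH} => [|n]; first by rewrite /= !expr0 !expr1; ring.
  by rewrite /= -[n.+2%:R]natr1 -[n.+1%:R]natr1 !exprS; ring.
apply: le_trans (normcD _ _) _; rewrite !normcM !normcX normcn.
set X := normc _ in IH *.
have h2 : 0 <= normc h ^+ 2 by rewrite exprn_ge0 // normc_ge0.
have sn : 0 <= s ^+ n by rewrite exprn_ge0.
have A1 : normc (t + h) * X <= s * ((n ^ 2)%:R * normc h ^+ 2 * s ^+ n).
  by apply: ler_pM; rewrite ?normc_ge0.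
have A2 : n%:R * normc h ^+ 2 * normc t ^+ n.-1 <= n%:R * normc h ^+ 2 * (s * s ^+ n).
  apply: ler_wpM2l; first by rewrite mulr_ge0.
  apply: (@le_trans _ _ (s ^+ n.-1)).
    by apply: lerXn2r; rewrite ?nnegrE ?normc_ge0.
  by rewrite -exprS; apply: ler_weXn2l => //; lia.
apply: le_trans (lerD A1 A2) _.
have -> : s * ((n ^ 2)%:R * normc h ^+ 2 * s ^+ n) + n%:R * normc h ^+ 2 * (s * s ^+ n) =
  (n ^ 2 + n)%:R * (normc h ^+ 2 * s ^+ n.+1) by rewrite natrD [s ^+ n.+1]exprS; ring.
rewrite -mulrA; apply: ler_wpM2r; first by rewrite mulr_ge0 // exprn_ge0.
by rewrite ler_nat; nia.
Qed.

(** Halving the radius pays for the factor n + 1 brought by differentiation, since n + 1 <=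
    2^(n+1). *)
Lemma dcoef_bound f (r M : R) : 0 < r ->
  (forall n, normc (f n) * (2 * r) ^+ n <= M) ->
  forall n, normc (dcoef f n) * r ^+ n <= M / r.
Proof.
move=> r0 hM n; rewrite /dcoef normcM normcn ler_pdivlMr //.
apply: le_trans (hM n.+1).
have -> : n.+1%:R * normc (f n.+1) * r ^+ n * r = normc (f n.+1) * r ^+ n.+1 * n.+1%:R.
  by rewrite [r ^+ n.+1]exprS; ring.
rewrite exprMn [2 ^+ _ * _]mulrC mulrA; apply: ler_wpM2l.
  by rewrite mulr_ge0 ?normc_ge0 // exprn_ge0 // ltW.
by rewrite -natrX ler_nat n_le_2expn.
Qed.

Lemma rapid_dcoef f : rapid f -> rapid (dcoef f).
Proof.
move=> hf r r0; have [|M hM] := hf (2 * r); first by lra.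
by exists (M / r); exact: dcoef_bound.
Qed.

Lemma cder_psum f t : rapid f -> cder (psum f) t (psum (dcoef f) t).
Proof.
move=> hf; have hd := rapid_dcoef hf; pose s : R := normc t + 1.
have t0 := normc_ge0 t; have s1 : 1 <= s by rewrite /s; lra.
have ts : normc t <= s by rewrite /s; lra.
have s0 : 0 <= s by lra.
(* 8 = 4 * 2: a factor 4^n dominates the n^2 of [pow_remainder], and a further 2^n leaves a
   geometric series. *)
have [|M hM] := hf (8 * s); first by lra.
have M0 : 0 <= M by apply: le_trans (hM 0%N); rewrite expr0 mulr1 normc_ge0.
have key h : normc h <= 1 ->
    normc (psum f (t + h) - psum f t - h * psum (dcoef f) t) <= 2 * M * normc h ^+ 2.
  move=> hh; have h0 := normc_ge0 h.
  have ths : normc (t + h) <= s by apply: le_trans (normcD _ _) _; rewrite /s lerD2l.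
  apply: (@le_of_eps R _ _ (2 + normc h)); first by lra.
  move=> e e0.
  have [N1 h1] := psumP (t + h) hf e0; have [N2 h2] := psumP t hf e0.
  have [N3 h3] := psumP t hd e0.
  pose N := maxn N1 (maxn N2 N3).
  have n1 : (N1 <= N.+1)%N by rewrite leqW // leq_maxl.
  have n2 : (N2 <= N.+1)%N by rewrite leqW // leq_max leq_maxl orbT.
  have n3 : (N3 <= N)%N by rewrite leq_max leq_maxr orbT.
  have {}h1 := h1 _ n1; have {}h2 := h2 _ n2; have {}h3 := h3 _ n3.
  have B : normc (pser N.+1 f (t + h) - pser N.+1 f t - h * pser N (dcoef f) t) <=
      2 * M * normc h ^+ 2.
    have -> : pser N (dcoef f) t = \sum_(n < N.+1) f n * (n%:R * t ^+ n.-1).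
      rewrite big_ord_recl mul0r mulr0 add0r; apply: eq_bigr => n _.
      by rewrite /dcoef lift0 /=; ring.
    rewrite mulr_sumr -!sumrB.
    apply: le_trans (normc_sum _ _ _) _.
    apply: (@le_trans _ _ (\sum_(n < N.+1) M * normc h ^+ 2 * 2^-1 ^+ n)).
      apply: ler_sum => n _.
      have -> : f n * (t + h) ^+ n - f n * t ^+ n - h * (f n * (n%:R * t ^+ n.-1)) =
        f n * ((t + h) ^+ n - t ^+ n - h * (n%:R * t ^+ n.-1)) by ring.
      rewrite normcM.
      apply: le_trans (ler_wpM2l (normc_ge0 _) (pow_remainder n s1 ts ths)) _.
      have sn : 0 <= s ^+ n by rewrite exprn_ge0.
      have f0 := normc_ge0 (f n).
      have hh2 : 0 <= normc h ^+ 2 by rewrite exprn_ge0.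
      apply: (@le_trans _ _ ((normc (f n) * (8 * s) ^+ n) * (normc h ^+ 2 * 2^-1 ^+ n))).
        have -> : normc (f n) * (8 * s) ^+ n * (normc h ^+ 2 * 2^-1 ^+ n) =
            normc (f n) * ((4 ^ n)%:R * normc h ^+ 2 * s ^+ n).
          have -> : (4 ^ n)%:R = 8 ^+ n * 2^-1 ^+ n :> R.
            by rewrite -exprMn natrX; congr (_ ^+ _); field.
          by rewrite exprMn; ring.
        apply: ler_wpM2l => //; apply: ler_wpM2r => //; apply: ler_wpM2r => //.
        by rewrite ler_nat -[4%N]/(2 ^ 2)%N -expnM mulnC expnM leq_exp2r ?n_le_2expn.
      rewrite -[leRHS]mulrA; apply: ler_wpM2r; last exact: hM.
      by rewrite mulr_ge0 // exprn_ge0 // invr_ge0.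
    rewrite -mulr_sumr mulrC -[leRHS]mulrA; apply: ler_wpM2r.
      by rewrite mulr_ge0 // exprn_ge0.
    by apply: geom_half_le; rewrite invr_ge0 ler0n lexx.
  move: B h1 h2 h3; move: (psum f (t + h)) (psum f t) (psum (dcoef f) t) (pser N.+1 f (t + h)) (pser N.+1 f t) (pser N (dcoef f) t).
  move=> x y z x' y' z' B h1 h2 h3.
  have -> : x - y - h * z = (x' - y' - h * z') - (x' - x) + (y' - y) + h * (z' - z).
    by clear; ring.
  apply: le_trans (normcD _ _) _; apply: le_trans (lerD (normcD _ _) (lexx _)) _.
  apply: le_trans (lerD (lerD (normcB _ _) (lexx _)) (lexx _)) _.
  rewrite [normc (h * _)]normcM.
  apply: le_trans (lerD (lerD (lerD B h1) h2) (ler_wpM2l h0 h3)) _.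
  by apply: ler_eq; clear; ring.
apply/cderP => e e0; exists (Num.min 1 (e / (2 * M + 1))); split.
  by rewrite lt_min ltr01 divr_gt0 //; lra.
move=> h; rewrite lt_min ltr_pdivlMr; last by lra.
move=> /andP[h1 h2]; apply: le_trans (key h (ltW h1)) _.
rewrite expr2 mulrA; apply: ler_wpM2r; first exact: normc_ge0.
have := normc_ge0 h; lra.
Qed.

Lemma psum0 f : psum f 0 = f 0%N.
Proof.
apply: psumE => e e0; exists 1%N => -[//|N] _.
rewrite /pser big_ord_recl expr0 mulr1 big1 ?addr0 ?subrr ?normc0 ?ltW //.
by move=> i _; rewrite lift0 exprS mul0r mulr0.
Qed.

Lemma cder0_const F t0 d :
  (forall s : R, 0 <= s <= 1 -> cder F (t0 + s%:C * d) 0) -> F (t0 + d) = F t0.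
Proof.
move=> h.
have h0 : t0 + (0 : R)%:C * d = t0 by rewrite mul0r addr0.
have h1 : t0 + (1 : R)%:C * d = t0 + d by rewrite mul1r.
have key (p : C -> R) : (forall s : R, 0 <= s <= 1 ->
    is_derive s (1 : R) (fun u => p (F (t0 + u%:C * d))) 0) -> p (F (t0 + d)) = p (F t0).
  move=> hp; apply/le_anti/andP; split.
    have := @nonincr_of_derive R (fun u => p (F (t0 + u%:C * d))) (fun=> 0) 1 ler01 hp.
    by rewrite h0 h1; apply.
  rewrite -lerN2.
  have := @nonincr_of_derive R (fun u => - p (F (t0 + u%:C * d))) (fun=> 0) 1 ler01.
  rewrite h0 h1; apply => // s /hp hs.
  have H : is_derive s (1 : R) (fun u => - p (F (t0 + u%:C * d))) _ := is_deriveN hs.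
  by apply: is_derive_eq H _; rewrite oppr0.
have hRe : complex.Re (F (t0 + d)) = complex.Re (F t0).
  apply: key => s /h /cder_line[hs _]; apply: is_derive_eq hs _.
  by rewrite mulr0.
have hIm : complex.Im (F (t0 + d)) = complex.Im (F t0).
  apply: key => s /h /cder_line[_ hs]; apply: is_derive_eq hs _.
  by rewrite mulr0.
by case: (F (t0 + d)) hRe hIm => a b /= -> ->; case: (F t0).
Qed.

Definition ecoef n : C := (n`!%:R)^-1.

Lemma bounded_rec (g : nat -> R) (n0 : nat) (M : R) :
  (forall i, (i < n0)%N -> g i <= M) ->
  (forall n, (n0 <= n)%N -> (forall i, (i < n)%N -> g i <= M) -> g n <= M) ->
  forall n, g n <= M.
Proof.
move=> h0 h; elim/ltn_ind => n IH.
by have [/h0//|/h] := ltnP n n0; apply.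
Qed.

Lemma nat_ge (x : R) : exists n : nat, x <= n%:R.
Proof.
exists (Num.truncn x).+1; exact/ltW/truncnS_gt.
Qed.

Lemma rapid_ecoef : rapid ecoef.
Proof.
move=> r r0; have [n0 hn0] := nat_ge r.
pose g n : R := normc (ecoef n) * r ^+ n.
have g0 n : 0 <= g n by rewrite mulr_ge0 ?normc_ge0 // exprn_ge0 // ltW.
exists (\sum_(i < n0.+1) g i); apply: (@bounded_rec g n0.+1).
  move=> i hi; rewrite (bigD1 (Ordinal hi)) //= lerDl.
  by apply: sumr_ge0 => j _.
move=> [//|n] hn IH; apply: le_trans (IH n (ltnSn n)).
have -> : g n.+1 = g n * (r / n.+1%:R).
  by rewrite /g /ecoef !normcV !normcn factS natrM exprS invfM; ring.
rewrite -[leRHS]mulr1; apply: ler_wpM2l => //.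
rewrite ler_pdivrMr ?ltr0n // mul1r; apply: le_trans hn0 _.
by rewrite ler_nat; lia.
Qed.

Lemma dcoef_ecoef : dcoef ecoef = ecoef.
Proof.
apply/funext => n; rewrite /dcoef /ecoef factS natrM invfM mulrA divff ?mul1r //.
Qed.

(** The exponential series times e^(-w) has derivative 0 and value 1 at 0. This links the real
    definition of [cexp] to its Taylor series. *)
Lemma psum_ecoef t : psum ecoef t = cexp t.
Proof.
pose F w := psum ecoef w * cexp (- 1 * w).
have hF w : cder F w 0.
  have h1 := cder_psum w rapid_ecoef; rewrite dcoef_ecoef in h1.
  by apply: cder_eq (cderM h1 (cder_cexpM (-1) w)) _; ring.
have := @cder0_const F 0 t (fun s _ => hF _).
rewrite add0r /F psum0 mulr0 cexp0 mulr1 mulN1r => h.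
have e0 : ecoef 0 = 1 by rewrite /ecoef fact0 invr1.
by rewrite -[LHS]mulr1 -(cexpV t) [cexp t * _]mulrC mulrA h e0 mul1r.
Qed.

Lemma pconv_exp (c : C) t : pconv (fun k => c ^+ k * ecoef k) t (cexp (c * t)).
Proof.
move=> e e0; rewrite -psum_ecoef; have [N0 h] := psumP (c * t) rapid_ecoef e0.
exists N0 => N /h; congr (normc (_ - _) <= _); apply: eq_bigr => i _.
by rewrite exprMn; ring.
Qed.

Lemma pconvM f g t : rapid f -> rapid g ->
  pconv (cauchy_prod f g) t (psum f t * psum g t).
Proof.
move=> hf hg; have t0 := normc_ge0 t.
pose r := normc t + 1; have r0 : 0 < r by rewrite ltr_wpDl.
have tr : normc t <= r by rewrite lerDl.
(* 4 = 2 * 2: one factor 2^n beats the n + 1 terms of the Cauchy product, the other is the one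
   [pser_tail] asks for. *)
have r40 : 0 < 4 * r by rewrite mulr_gt0.
have [Mf hMf] := hf _ r40; have [Mg hMg] := hg _ r40.
have Mf0 : 0 <= Mf by apply: le_trans (hMf 0%N); rewrite expr0 mulr1 normc_ge0.
have Mg0 : 0 <= Mg by apply: le_trans (hMg 0%N); rewrite expr0 mulr1 normc_ge0.
(* The product of the two truncations and the truncated Cauchy product differ by the terms of degree
   at least N of the polynomial [P * Q]. *)
have key N : normc (pser N f t * pser N g t - pser N (cauchy_prod f g) t) <=
    2 * (Mf * Mg) * 2^-1 ^+ N.
  pose P : {poly C} := \poly_(i < N) f i; pose Q : {poly C} := \poly_(i < N) g i.
  have -> : pser N f t * pser N g t = pser (N + N) (fun n => (P * Q)`_n) t.
    have -> : pser N f t = P.[t] by rewrite horner_poly.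
    have -> : pser N g t = Q.[t] by rewrite horner_poly.
    rewrite -hornerM; apply: horner_coef_wide.
    apply: leq_trans (size_polyMleq _ _) _; apply: leq_trans (leq_pred _) _.
    by rewrite leq_add // size_poly.
  have -> : pser N (cauchy_prod f g) t = pser N (fun n => (P * Q)`_n) t.
    apply: eq_bigr => n _; congr (_ * _); rewrite coefM; apply: eq_bigr => k _.
    rewrite !coef_poly (leq_ltn_trans _ (ltn_ord n)) ?(leq_ltn_trans _ (ltn_ord n)) //.
      by rewrite leq_subr.
    by rewrite -ltnS.
  apply: (pser_tail tr) (leq_addr _ _) => n.
  have r20 : 0 <= 2 * r by rewrite mulr_ge0 // ltW.
  apply: (@le_trans _ _ (\sum_(k < n.+1) Mf * Mg * 2^-1 ^+ n)); last first.
    rewrite sumr_const card_ord -[leLHS]mulr_natr -[leLHS]mulrA -[leRHS]mulr1.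
    apply: ler_wpM2l; first exact: mulr_ge0.
    rewrite exprVn mulrC ler_pdivrMr ?exprn_gt0 // mul1r -natrX ler_nat.
    exact: ltn_expl.
  rewrite coefM -[_ ^+ n]ger0_norm ?exprn_ge0 //.
  apply: le_trans (ler_wpM2r (normr_ge0 _) (normc_sum _ _ _)) _.
  rewrite mulr_suml; apply: ler_sum => k _; rewrite ger0_norm ?exprn_ge0 //.
  have kn : (k <= n)%N by rewrite -ltnS.
  rewrite normcM.
  have -> : (2 * r) ^+ n = (4 * r) ^+ k * (4 * r) ^+ (n - k) * 2^-1 ^+ n.
    rewrite -exprD subnKC // -exprMn; congr (_ ^+ _); by field.
  have B (c : nat -> C) (M : R) j : 0 <= M -> (forall i, normc (c i) * (4 * r) ^+ i <= M) ->
      normc (\poly_(i < N) c i)`_j * (4 * r) ^+ j <= M.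
    move=> M0 h; rewrite coef_poly; case: ifP => _; first exact: h.
    by rewrite normc0 mul0r.
  have -> : normc P`_k * normc Q`_(n - k) * ((4 * r) ^+ k * (4 * r) ^+ (n - k) * 2^-1 ^+ n)
    = (normc P`_k * (4 * r) ^+ k) * (normc Q`_(n - k) * (4 * r) ^+ (n - k)) * 2^-1 ^+ n.
    by ring.
  apply: ler_wpM2r; first by rewrite exprn_ge0 // invr_ge0.
  have p4 j : 0 <= (4 * r) ^+ j by rewrite exprn_ge0 // ltW.
  apply: ler_pM; [by rewrite mulr_ge0 ?normc_ge0|by rewrite mulr_ge0 ?normc_ge0|exact: B|exact: B].
move=> e e0; have fg0 : 0 <= normc (psum f t) + normc (psum g t) + 3.
  by rewrite !addr_ge0 ?normc_ge0.
pose d := Num.min 1 (e / (normc (psum f t) + normc (psum g t) + 3)).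
have S0 : 0 < normc (psum f t) + normc (psum g t) + 3.
  by rewrite ltr_wpDl // addr_ge0 // normc_ge0.
have d0 : 0 < d by rewrite lt_min ltr01 divr_gt0.
have d1 : d <= 1 by rewrite ge_min lexx.
have d2 : (normc (psum f t) + normc (psum g t) + 3) * d <= e.
  by rewrite mulrC -ler_pdivlMr // ge_min lexx orbT.
have [N1 h1] := psumP t hf d0; have [N2 h2] := psumP t hg d0.
have [N3 h3] := pow2_small (2 * (Mf * Mg)) d0.
exists (maxn N1 (maxn N2 N3)) => N; rewrite !geq_max => /andP[n1 /andP[n2 n3]].
have {}h1 := h1 _ n1; have {}h2 := h2 _ n2; have {}h3 := le_trans (key N) (h3 _ n3).
move: h1 h2 h3 d2 {key fg0 S0}; move: (pser N f t) (pser N g t) (pser N (cauchy_prod f g) t).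
move: (psum f t) (psum g t) => x y p q s h1 h2 h3 d2.
have -> : s - x * y = (p - x) * (q - y) + (p - x) * y + x * (q - y) - (p * q - s).
  by clear; ring.
apply: le_trans (normcB _ _) _; apply: le_trans (lerD (normcD _ _) (lexx _)) _.
apply: le_trans (lerD (lerD (normcD _ _) (lexx _)) (lexx _)) _.
rewrite !normcM.
have b1 : normc (p - x) * normc (q - y) <= d * 1.
  by apply: ler_pM; rewrite ?normc_ge0 // (le_trans h2).
have b2 := ler_wpM2r (normc_ge0 y) h1; have b3 := ler_wpM2l (normc_ge0 x) h2.
apply: le_trans (lerD (lerD (lerD b1 b2) b3) h3) _; apply: le_trans d2.
rewrite -subr_ge0; set X := (X in 0 <= X); have -> : X = d by rewrite /X; ring.
exact: ltW.
Qed.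
End PowerSeries.

(** * Existence for the linear equation *)

Section EntireODE.
Variables (R : realType) (m : nat).
Local Notation C := R[i].
Local Notation V := 'rV[C]_m.

Lemma ent_cexp (g : V -> C) : ent g -> ent (fun a => cexp (g a)).
Proof.
move=> hg; apply: ent_lim => A e e0.
have [M0 hM0] := ent_bounded hg A; pose r := `|M0| + 1.
have r0 : 0 < r by rewrite ltr_wpDl.
have [|M hM] := @rapid_ecoef R (2 * r); first by rewrite mulr_gt0.
have [N hN] := pow2_small (2 * M) e0.
exists (fun a => pser N (@ecoef R) (g a)).
  by apply: ent_sum => n _; apply: entZ; apply: entX.
move=> a ha; rewrite normcBC -psum_ecoef; apply: le_trans (hN N (leqnn N)).
apply: (psum_bound r0 _ _ hM); first exact: rapid_ecoef.
by apply: le_trans (hM0 a ha) _; rewrite /r (le_trans (ler_norm _)) // lerDl.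
Qed.

(** The list carries all earlier coefficients, since the recursion is of course-of-values type. *)
Fixpoint odeseq (p : nat -> C) (al be : C) n : seq C :=
  if n is k.+1 then
    let s := odeseq p al be k in
    rcons s (if k is j.+1 then
      (n%:R * k%:R)^-1 * (k%:R * s`_k + \sum_(i < k) p i * s`_(j - i)) else be)
  else [:: al].

(* Taylor coefficients of the solution of F'' = F' + (sum_n p n t^n) F. *)
Definition odecoef p al be n : C := (odeseq p al be n)`_n.

Lemma size_odeseq p al be n : size (odeseq p al be n) = n.+1.
Proof. by elim: n => // n IH; rewrite size_rcons IH. Qed.

Lemma nth_odeseq p al be n i : (i <= n)%N -> (odeseq p al be n)`_i = odecoef p al be i.
Proof.
elim: n => [|n IHn]; first by rewrite leqn0 => /eqP->.
rewrite leq_eqVlt => /predU1P[->//|lein].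
by rewrite [odeseq _ _ _ _]/= nth_rcons size_odeseq lein IHn.
Qed.

Lemma odecoefS p al be n : odecoef p al be n.+2 = (n.+2%:R * n.+1%:R)^-1 *
  (n.+1%:R * odecoef p al be n.+1 + \sum_(i < n.+1) p i * odecoef p al be (n - i)).
Proof.
have E : odeseq p al be n.+2 = rcons (odeseq p al be n.+1)
    ((n.+2%:R * n.+1%:R)^-1 * (n.+1%:R * (odeseq p al be n.+1)`_n.+1 +
      \sum_(i < n.+1) p i * (odeseq p al be n.+1)`_(n - i))) by [].
rewrite {1}/odecoef E nth_rcons size_odeseq ltnn eqxx nth_odeseq //.
congr (_ * (_ + _)); apply: eq_bigr => i _; rewrite nth_odeseq //.
by rewrite leqW // leq_subr.
Qed.

(** Taylor coefficients at t = 0 of P_m(e^(T + t), a), each power e^(j (T + t)) being expanded as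
    e^(j T) times the series of e^(j t). *)
Definition pcoef (T : C) (a : V) k : C :=
  cexp (m%:R * T) * (m%:R ^+ k * ecoef R k) +
  \sum_(i < m) a 0 i * cexp ((m - i.+1)%:R * T) * ((m - i.+1)%:R ^+ k * ecoef R k).

Lemma pconv_pcoef T a t : pconv (pcoef T a) t (Pm (cexp (T + t)) a).
Proof.
have E n : cexp (T + t) ^+ n = cexp (n%:R * T) * cexp (n%:R * t).
  by rewrite -cexpMn mulrDr cexpD.
rewrite /Pm E; under eq_bigr do rewrite E mulrA.
apply: pconvD; first by apply: pconvZ; exact: pconv_exp.
by apply: pconv_sum => i _; apply: pconvZ; exact: pconv_exp.
Qed.

Lemma pcoef_bound T A r : 0 < r -> exists M, 0 <= M /\
  forall a, bnd A a -> forall k, normc (pcoef T a k) * r ^+ k <= M.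
Proof.
move=> r0; have [|M hM] := @rapid_ecoef R (m.+1%:R * r); first by rewrite mulr_gt0.
have M0 : 0 <= M by apply: le_trans (hM 0%N); rewrite expr0 mulr1 normc_ge0.
have B j k : (j <= m)%N -> normc (j%:R ^+ k * ecoef R k) * r ^+ k <= M.
  move=> jm; apply: le_trans (hM k); rewrite normcM normcX normcn exprMn.
  have -> : j%:R ^+ k * normc (ecoef R k) * r ^+ k = normc (ecoef R k) * (j%:R ^+ k * r ^+ k).
    by ring.
  apply: ler_wpM2l; first exact: normc_ge0.
  apply: ler_wpM2r; first by rewrite exprn_ge0 // ltW.
  by apply: lerXn2r; rewrite ?nnegrE ?ler0n // ler_nat leqW.
exists (normc (cexp (m%:R * T)) * M + \sum_(i < m) `|A| * normc (cexp ((m - i.+1)%:R * T)) * M).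
split.
  rewrite addr_ge0 ?mulr_ge0 ?normc_ge0 //; apply: sumr_ge0 => i _.
  by rewrite !mulr_ge0 ?normc_ge0.
move=> a ha k; have rk : 0 <= r ^+ k by rewrite exprn_ge0 // ltW.
apply: le_trans (ler_wpM2r rk (normcD _ _)) _; rewrite mulrDl; apply: lerD.
  by rewrite normcM -mulrA; apply: ler_wpM2l; [exact: normc_ge0|exact: B].
apply: le_trans (ler_wpM2r rk (normc_sum _ _ _)) _; rewrite mulr_suml.
apply: ler_sum => i _; rewrite normcM -[leLHS]mulrA.
apply: ler_pM; rewrite ?normc_ge0 ?mulr_ge0 ?normc_ge0 //.
  rewrite normcM; apply: ler_wpM2r; first exact: normc_ge0.
  exact: le_trans (ha i) (ler_norm _).
by apply: B; rewrite leq_subr.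
Qed.

Lemma ent_pcoef T k : ent (fun a => pcoef T a k).
Proof.
apply: entD; first exact: ent_cst.
apply: ent_sum => i _.
apply: entM; last exact: ent_cst.
by apply: entM; [exact: ent_coord|exact: ent_cst].
Qed.

Lemma ent_odecoef T (al be : V -> C) n : ent al -> ent be ->
  ent (fun a => odecoef (pcoef T a) (al a) (be a) n).
Proof.
move=> hal hbe; elim/ltn_ind: n => -[_|[_|n IH]].
- by apply: ent_ext hal => a.
- by apply: ent_ext hbe => a.
apply: ent_ext (fun a => esym (odecoefS _ _ _ _)) _.
apply: entZ; apply: entD; first by apply: entZ; apply: IH.
apply: ent_sum => i _; apply: entM; first exact: ent_pcoef.
by apply: IH; rewrite ltnS leqW // leq_subr.
Qed.

(** Induction with a majorant M: multiplied by r^(n+2), the recursion bounds the next term by M r /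
    (n + 2) + 2 B M r^2 / ((n + 2) (n + 1)). The coefficients of the equation are taken at radius 2
    r so that their convolution sums to at most twice B. M depends on a only through the
    polydisc. *)
Lemma odecoef_bound T (al be : V -> C) A r : 0 < r -> ent al -> ent be ->
  exists M, forall a, bnd A a -> forall n,
    normc (odecoef (pcoef T a) (al a) (be a) n) * r ^+ n <= M.
Proof.
move=> r0 hal hbe; have r2 : 0 < 2 * r by rewrite mulr_gt0.
have [B [B0 hB]] := pcoef_bound T A r2.
(* Beyond these two indices each of the two terms of the recursion is at most M / 2. *)
have [n1 hn1] := nat_ge (2 * r); have [n2 hn2] := nat_ge (4 * r ^+ 2 * B).
pose n0 := (maxn n1 n2).+2.
have /choice[Mi hMi] : forall i, exists M, forall a, bnd A a ->
    normc (odecoef (pcoef T a) (al a) (be a) i) <= M.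
  by move=> i; exact: ent_bounded (ent_odecoef T i hal hbe) A.
pose M := \sum_(i < n0) `|Mi i| * r ^+ i.
have M0 : 0 <= M by apply: sumr_ge0 => i _; rewrite mulr_ge0 // exprn_ge0 // ltW.
exists M => a ha; apply: (@bounded_rec _ _ n0).
  move=> i hi; apply: (@le_trans _ _ (`|Mi i| * r ^+ i)).
    apply: ler_wpM2r; first by rewrite exprn_ge0 // ltW.
    exact: le_trans (hMi i a ha) (ler_norm _).
  rewrite /M (bigD1 (Ordinal hi)) //= lerDl.
  by apply: sumr_ge0 => j _; rewrite mulr_ge0 // exprn_ge0 // ltW.
move=> [//|[//|n]]; rewrite /n0 !ltnS geq_max => /andP[n1n n2n] IH.
pose u j := normc (odecoef (pcoef T a) (al a) (be a) j).
rewrite odecoefS normcM normcV normcM !normcn.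
have nn : 0 < n.+2%:R * n.+1%:R :> R by rewrite mulr_gt0 // ltr0n.
have S1 : normc (n.+1%:R * odecoef (pcoef T a) (al a) (be a) n.+1) * r ^+ n.+2
    <= n.+1%:R * (M * r).
  rewrite normcM normcn [r ^+ n.+2]exprSr -!mulrA; apply: ler_wpM2l => //.
  rewrite mulrA; apply: ler_wpM2r; [exact: ltW|exact: IH].
have S2 : normc (\sum_(i < n.+1) pcoef T a i * odecoef (pcoef T a) (al a) (be a) (n - i))
    * r ^+ n.+2 <= 2 * B * M * r ^+ 2.
  have rk : 0 <= r ^+ n.+2 by rewrite exprn_ge0 // ltW.
  apply: le_trans (ler_wpM2r rk (normc_sum _ _ _)) _; rewrite mulr_suml.
  apply: (@le_trans _ _ (\sum_(i < n.+1) B * M * r ^+ 2 * 2^-1 ^+ i)).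
    apply: ler_sum => i _; rewrite normcM.
    have ni : (i <= n)%N by rewrite -ltnS.
    have -> : r ^+ n.+2 = (2 * r) ^+ i * 2^-1 ^+ i * r ^+ (n - i) * r ^+ 2.
      rewrite -exprMn; have -> : 2 * r * 2^-1 = r by field.
      by rewrite -!exprD subnKC // addn2.
    have -> : normc (pcoef T a i) * normc (odecoef (pcoef T a) (al a) (be a) (n - i)) *
      ((2 * r) ^+ i * 2^-1 ^+ i * r ^+ (n - i) * r ^+ 2) =
      (normc (pcoef T a i) * (2 * r) ^+ i) *
      (normc (odecoef (pcoef T a) (al a) (be a) (n - i)) * r ^+ (n - i)) *
      r ^+ 2 * 2^-1 ^+ i by ring.
    apply: ler_wpM2r; first by rewrite exprn_ge0 // invr_ge0.
    apply: ler_wpM2r; first by rewrite exprn_ge0 // ltW.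
    apply: ler_pM.
    - by rewrite mulr_ge0 ?normc_ge0 // exprn_ge0 // ltW.
    - by rewrite mulr_ge0 ?normc_ge0 // exprn_ge0 // ltW.
    - exact: hB.
    - by apply: IH; rewrite ltnS leqW // leq_subr.
  rewrite -mulr_sumr; have -> : 2 * B * M * r ^+ 2 = B * M * r ^+ 2 * 2 by ring.
  apply: ler_wpM2l; first by rewrite !mulr_ge0 // ltW.
  by apply: geom_half_le; rewrite invr_ge0 ler0n lexx.
rewrite -mulrA mulrC ler_pdivrMr //.
apply: le_trans (ler_wpM2r (_ : 0 <= r ^+ n.+2) (normcD _ _)) _.
  by rewrite exprn_ge0 // ltW.
rewrite mulrDl; apply: le_trans (lerD S1 S2) _.
have m1 : M * r * 2 <= M * n.+2%:R.
  rewrite -mulrA; apply: ler_wpM2l => //; rewrite mulrC; apply: le_trans hn1 _.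
  by rewrite ler_nat; apply: leq_trans n1n _; rewrite leqW.
have m2 : 4 * r ^+ 2 * B * M <= n.+2%:R * M.
  apply: ler_wpM2r => //; apply: le_trans hn2 _.
  by rewrite ler_nat; apply: leq_trans n2n _; rewrite leqW.
have m3 : n.+2%:R * M <= n.+1%:R * (n.+2%:R * M).
  by rewrite -[leLHS]mul1r; apply: ler_wpM2r; rewrite ?mulr_ge0 // ler1n.
have m4 : n.+1%:R * (M * r * 2) <= n.+1%:R * (M * n.+2%:R) by exact: ler_wpM2l.
move: m2 m3 m4; clear; lra.
Qed.

(** The Cauchy data at T are themselves entire in a. The Taylor series converges for all t, so the
    solution lives on the whole universal covering, and it converges uniformly on polydiscs in a,
    hence stays in [ent]. *)
Lemma ode_solution (T : C) (al be : V -> C) : ent al -> ent be ->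
  exists F G : C -> V -> C,
    [/\ forall t a, cder (F ^~ a) t (G t a),
        forall t a, cder (G ^~ a) t (G t a + Pm (cexp t) a * F t a),
        forall a, F T a = al a, forall a, G T a = be a
      & forall t, ent (F t) /\ ent (G t)].
Proof.
move=> hal hbe; pose f a := odecoef (pcoef T a) (al a) (be a).
have rf a : rapid (f a).
  move=> r r0; have [A hA] := bnd_exists a.
  by have [M hM] := odecoef_bound T A r0 hal hbe; exists M; exact: hM.
have rp a : rapid (pcoef T a).
  move=> r r0; have [A hA] := bnd_exists a.
  by have [M [_ hM]] := pcoef_bound T A r0; exists M; exact: hM.
have sh (H : C -> C) t l : cder H (t - T) l -> cder (fun z => H (z - T)) t l.
  move=> hH; have h0 : cder (fun z => z - T) t 1.
    by apply: cder_eq (cderB (cder_id t) (cder_cst T t)) _; rewrite subr0.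
  by apply: cder_eq (cder_comp h0 hH) _; rewrite mul1r.
exists (fun t a => psum (f a) (t - T)), (fun t a => psum (dcoef (f a)) (t - T)).
split.
- by move=> t a; apply: sh; exact: cder_psum.
- move=> t a; apply: sh; apply: cder_eq (cder_psum _ (rapid_dcoef (rf a))) _.
  apply: psumE.
  have -> : dcoef (dcoef (f a)) =
      (fun n => dcoef (f a) n + cauchy_prod (pcoef T a) (f a) n).
    apply/funext => n; rewrite /dcoef /cauchy_prod /f odecoefS mulrA mulrA.
    rewrite [n.+1%:R * _]mulrC divff ?mul1r // mulf_neq0 // pnatr_eq0.
  apply: pconvD; first by apply: psumP; exact: rapid_dcoef.
  have := pconvM (t - T) (rp a) (rf a).
  rewrite (psumE (pconv_pcoef T a (t - T))).
  by have -> : T + (t - T) = t by rewrite addrC subrK.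
- by move=> a; rewrite subrr psum0.
- by move=> a; rewrite subrr psum0 /dcoef mul1r.
move=> t; pose r := normc (t - T) + 1.
have r0 : 0 < r by rewrite ltr_wpDl // normc_ge0.
have tr : normc (t - T) <= r by rewrite lerDl.
have r20 : 0 < 2 * r by rewrite mulr_gt0.
have hn n : ent (fun a => f a n) by exact: ent_odecoef.
split; apply: ent_lim => A e e0.
  have [M hM] := odecoef_bound T A r20 hal hbe.
  have [N hN] := pow2_small (2 * M) e0.
  exists (fun a => pser N (f a) (t - T)).
    by apply: ent_sum => n _; apply: entM; [exact: hn|exact: ent_cst].
  move=> a ha; rewrite normcBC; apply: le_trans (hN N (leqnn N)).
  exact: (psum_bound r0 (rf a) tr (hM a ha)).
have [M hM] := odecoef_bound T A (mulr_gt0 (ltr0n R 2) r20) hal hbe.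
have [N hN] := pow2_small (2 * (M / (2 * r))) e0.
exists (fun a => pser N (dcoef (f a)) (t - T)).
  apply: ent_sum => n _; apply: entM; last exact: ent_cst.
  exact: entZ.
move=> a ha; rewrite normcBC; apply: le_trans (hN N (leqnn N)).
apply: (psum_bound r0 (rapid_dcoef (rf a)) tr).
exact: dcoef_bound r20 (hM a ha).
Qed.
End EntireODE.

(** * The formal solution *)

Section FormalSolution.
Variables (K : numFieldType) (A : comNzRingType) (iota : {rmorphism K -> A}).
Variables (m : nat) (b Pc : nat -> A) (r : A).
Implicit Types (p q v : {poly A}).

Definition scal (c : K) : {poly A} := (iota c)%:P.

(* Throughout, 'X stands for y = x^(-1/2), and [theta] for x d/dx. *)
Definition theta p : {poly A} := scal (- 2^-1) * ('X * p^`()).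

(** x^(1 - m/2) dS/dx as a polynomial in y. *)
Definition qser : {poly A} := \sum_(0 <= k < m | (k.*2 < m)%N) (b k)%:P * 'X^(k.*2).

(** x^(-m) P_m as a polynomial in y. *)
Definition Ppoly : {poly A} := \sum_(0 <= k < m.+1) (Pc k)%:P * 'X^(k.*2).

Definition bd n : A := if ~~ odd n && (n < m)%N then b n./2 else 0.

Definition rpoly : {poly A} := r%:P.

Definition Dpoly : {poly A} := scal 2 * qser + (1 - scal 2 * rpoly) * 'X^m.

(** With F = x^r e^(-S) v, this is x^(-m) times the sum of the coefficients of v in F'' - F' - P_m
    F, after division by x^r e^(-S); the last bracket comes from the derivative of x^(m/2) q, q
    being [qser]. *)
Definition Bpoly : {poly A} :=
  (rpoly * 'X^m - qser) ^+ 2 - 'X^m * (rpoly * 'X^m - qser) - Ppoly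
  - 'X^m * (scal (m%:R / 2) * qser + theta qser).

(** An exact division by y^m, by [Bpoly_low]. *)
Definition gpoly : {poly A} := drop_poly m Bpoly.

(* x^(-m/2) times the operator v |-> v'' - D v' + B v, where ' = x d/dx. *)
Definition Lop v : {poly A} := 'X^m * theta (theta v) - Dpoly * theta v + gpoly * v.

(** Since theta y^N = -(N/2) y^N and D has constant term 2, [Lop] sends c y^N to N c y^N + higher
    terms. Each step thus cancels one more coefficient of [Lop], and only divides by the integer N,
    so the coefficients stay in the ring A. *)
Fixpoint Vpoly (N : nat) : {poly A} :=
  if N is n.+1 then
    Vpoly n + (iota (- (N%:R)^-1) * (Lop (Vpoly n))`_N)%:P * 'X^N
  else 1.

Definition phi0 (j : nat) : A := (Vpoly j)`_j.

Lemma thetaD p q : theta (p + q) = theta p + theta q.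
Proof. by rewrite /theta derivD !mulrDr. Qed.

Lemma thetaCX (c : A) k : theta (c%:P * 'X^k) = scal (- (k%:R / 2)) * (c%:P * 'X^k).
Proof.
rewrite /theta derivM derivC mul0r add0r derivXn.
case: k => [|k]; first by rewrite mulr0n !mulr0 mul0r oppr0 /scal rmorph0 mul0r.
have E : scal (- (k.+1%:R / 2)) = scal (- 2^-1) * k.+1%:R.
  rewrite /scal; have -> : - (k.+1%:R / 2) = - 2^-1 * k.+1%:R :> K by ring.
  by rewrite rmorphM polyCM rmorph_nat rmorph_nat.
by rewrite E -['X^_ *+ _]mulr_natr -pred_Sn exprS; ring.
Qed.

Lemma coef_theta p n : (theta p)`_n = iota (- (n%:R / 2)) * p`_n.
Proof.
rewrite /theta /scal coefCM coefXM; case: n => [|n].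
  by rewrite eqxx mul0r oppr0 rmorph0 mul0r mulr0.
rewrite eqn0Ngt ltn0Sn -pred_Sn coef_deriv -[p`_n.+1 *+ _]mulr_natr.
have -> : - (n.+1%:R / 2) = - 2^-1 * n.+1%:R :> K by ring.
rewrite rmorphM rmorph_nat -mulrA [n.+1%:R * _]mulrC. by [].
Qed.

Lemma LopD p q : Lop (p + q) = Lop p + Lop q.
Proof. by rewrite /Lop !thetaD; ring. Qed.

Lemma LopCX (c : A) k : Lop (c%:P * 'X^k) =
  c%:P * (scal (k%:R / 2) ^+ 2 * 'X^m + scal (k%:R / 2) * Dpoly + gpoly) * 'X^k.
Proof.
have E : theta (theta (c%:P * 'X^k)) = scal (k%:R / 2) ^+ 2 * (c%:P * 'X^k).
  rewrite thetaCX {1}/scal mulrA -polyCM thetaCX polyCM /scal rmorphN polyCN.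
  by ring.
rewrite /Lop E thetaCX.
have -> : scal (- (k%:R / 2)) = - scal (k%:R / 2) by rewrite /scal rmorphN polyCN.
by ring.
Qed.

Lemma coef_qser n : qser`_n = bd n.
Proof.
rewrite /qser coef_sum /bd.
under eq_bigr do rewrite coefCM coefXn.
case: ifPn => [/andP[en nm]|h].
  have n2 : n = n./2.*2 by rewrite -[LHS]odd_double_half (negPf en).
  have nlt : (n./2 < m)%N by lia.
  rewrite big_mkord (bigD1 (Ordinal nlt)) /=; last by rewrite -n2.
  rewrite -n2 eqxx mulr1 big1 ?addr0 // => i /andP[_ ni].
  case: eqP => [E|_]; last by rewrite mulr0.
  by case/eqP: ni; apply: val_inj; rewrite /= E doubleK.
rewrite big1_seq // => i /andP[im _].
case: eqP => [E|_]; last by rewrite mulr0.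
by move: h; rewrite E odd_double /= im.
Qed.

Hypothesis Pc_gt : forall k, (m < k)%N -> Pc k = 0.
Lemma coef_Ppoly n : Ppoly`_n = if odd n then 0 else Pc n./2.
Proof.
rewrite /Ppoly coef_sum big_mkord.
under eq_bigr do rewrite coefCM coefXn.
case: ifPn => [on|en].
  rewrite big1 // => i _; case: eqP => [E|_]; last by rewrite mulr0.
  by move: on; rewrite E odd_double.
have n2 : n = n./2.*2 by rewrite -[LHS]odd_double_half (negPf en).
have [nm|mn] := leqP n./2 m; last first.
  rewrite Pc_gt // big1 // => i _; case: eqP => [E|_]; last by rewrite mulr0.
  by move: mn; rewrite E doubleK ltnNge -ltnS ltn_ord.
rewrite (bigD1 (Ordinal (nm : (n./2 < m.+1)%N))) //= -n2 eqxx mulr1.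
rewrite big1 ?addr0 // => i ni; case: eqP => [E|_]; last by rewrite mulr0.
by case/eqP: ni; apply: val_inj; rewrite /= E doubleK.
Qed.

Hypothesis b0 : b 0 = 1.
Hypothesis b_sqr : forall n, \sum_(i < n.+1) b i * b (n - i) = Pc n.
Hypothesis hm : (0 < m)%N.

Lemma bd0 : bd 0 = 1.
Proof. by rewrite /bd /= hm. Qed.

(** q = [qser] is the square-root series cut off below degree m, so q^2 agrees with P up to degree
    m, except that for even m the two terms b_0 b_(m/2) are missing in degree m. *)
Lemma coef_qser_sq n : (n <= m)%N -> (qser ^+ 2)`_n =
  if odd n then 0 else Pc n./2 - (if n == m then 2 * b n./2 else 0).
Proof.
move=> nm; rewrite expr2 coefM.
under eq_bigr do rewrite !coef_qser.
have [on|en] := boolP (odd n).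
  rewrite big1 // => i _; have [|oi] := boolP (odd i).
    by rewrite /bd => ->; rewrite mul0r.
  suff oni : odd (n - i) by rewrite [X in _ * X]/bd oni mulr0.
  by rewrite oddB ?on ?(negPf oi) // -ltnS.
have n2 : n = n./2.*2 by rewrite -[LHS]odd_double_half (negPf en).
set k := n./2.
pose g (i : nat) : A := bd i * bd (n - i).
have E1 : \sum_(i < n.+1) g i = \sum_(j < k.+1) g j.*2.
  have aux l : \sum_(i < l.*2.+1) g i = \sum_(j < l.+1) g j.*2 + \sum_(j < l) g j.*2.+1.
    elim: l => [|l IH]; first by rewrite !big_ord1 big_ord0 addr0.
    rewrite doubleS (big_ord_recr l.*2.+2) (big_ord_recr l.*2.+1) IH.
    by rewrite (big_ord_recr l.+1) [X in _ = _ + X](big_ord_recr l) /= doubleS; ring.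
  have := aux n./2; rewrite -n2 -/k => ->; rewrite [X in _ + X]big1 ?addr0 // => j _.
  by rewrite /g {1}/bd /= odd_double mul0r.
rewrite -/(g) E1 -b_sqr -/k.
(* For n = m the terms j = 0 and j = k are excluded: one of their factors has degree m, where [bd]
   is cut off. *)
have gE (j : nat) : (j <= k)%N -> (n == m) && ((j == 0%N) || (j == k)) = false ->
    g j.*2 = b j * b (k - j).
  move=> jk h; rewrite /g /bd odd_double oddB; last by lia.
  rewrite (negPf en) odd_double /= doubleK.
  have -> : (n - j.*2)./2 = (k - j)%N by rewrite n2 -doubleB doubleK.
  have nk : n = k.*2 := n2.
  have {}h : n <> m \/ (j <> 0 /\ j <> k)%N.
    case: (n =P m) h => [_ /= /negbT /norP[/eqP j0 /eqP jk']|]; last by left.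
    by right.
  have -> : (j.*2 < m)%N by lia.
  by have -> : (n - j.*2 < m)%N by lia.
have [nm'|nm'] := eqVneq n m; last first.
  by rewrite subr0; apply: eq_bigr => j _; apply: gE; rewrite ?(negPf nm') // -ltnS.
have k0 : (0 < k)%N by lia.
have gz j : (j == 0%N) || (j == k) -> g j.*2 = 0.
  rewrite /g /bd => /orP[/eqP->|/eqP->].
    by rewrite subn0 nm' ltnn andbF mulr0.
  by rewrite -n2 nm' ltnn andbF mul0r.
clear E1; clearbody k; case: k k0 gE gz => // k _ gE gz.
have split_ends (F : nat -> A) : \sum_(i < k.+2) F i = F 0%N + \sum_(i < k) F i.+1 + F k.+1.
  by rewrite big_ord_recl big_ord_recr addrA.
rewrite (split_ends (fun i => g i.*2)) (split_ends (fun i => b i * b (k.+1 - i))).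
rewrite gz // gz ?eqxx ?orbT // subn0 subnn b0 add0r addr0.
have -> : \sum_(i < k) g i.+1.*2 = \sum_(i < k) b i.+1 * b (k.+1 - i.+1).
  apply: eq_bigr => i _; have ik := ltn_ord i; apply: gE; first lia.
  by apply/negP => /andP[_ /orP[/eqP|/eqP]]; lia.
by ring.
Qed.

Hypothesis rE : r = iota (2^-1 - m%:R / 4) - (if odd m then 0 else b m./2).

(** Below degree m this is q^2 = P. In degree m the coefficient is 1 - 2 r - m/2, minus 2 b_(m/2)
    when m is even; its vanishing is the equation that determines r. *)
Lemma Bpoly_low n : (n <= m)%N -> Bpoly`_n = 0.
Proof.
move=> nm.
pose W : {poly A} := (1 - scal 2 * rpoly - scal (m%:R / 2)) * qser - theta qser
  + (rpoly ^+ 2 - rpoly) * 'X^m.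
have -> : Bpoly = (qser ^+ 2 - Ppoly) + W * 'X^m.
  have c2 : scal 2 = 2 by rewrite /scal !rmorph_nat.
  by rewrite /Bpoly /W c2; ring.
rewrite coefD coefB coef_qser_sq // coef_Ppoly coefMXn.
have [nm'|nm'] := eqVneq n m; last first.
  have -> : (n < m)%N by rewrite ltn_neqAle nm'.
  by rewrite addr0; case: ifP => _; rewrite ?subr0 ?subrr.
rewrite nm' ltnn subnn /W coefD coefB coef_theta coefMXn hm addr0 mul0r oppr0.
rewrite rmorph0 mul0r subr0 /scal /rpoly -polyC1 -!polyCM -!polyCB coefCM coef_qser bd0 mulr1.
rewrite rE.
have E c : iota 2 * (iota (2^-1 - m%:R / 4) - c) = 1 - iota (m%:R / 2) - 2 * c :> A.
  rewrite mulrBr -rmorphM mulrBr.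
  have -> : 2 * 2^-1 = 1 :> K by field.
  have -> : 2 * (m%:R / 4) = m%:R / 2 :> K by field.
  by rewrite rmorphB rmorph1 rmorph_nat.
rewrite E; case: ifP => _; ring.
Qed.

Lemma BpolyE : Bpoly = gpoly * 'X^m.
Proof.
rewrite -[LHS](poly_take_drop m) [take_poly _ _](_ : _ = 0) ?add0r //.
apply/polyP => n; rewrite coef_take_poly coef0; case: ifP => // /ltnW.
exact: Bpoly_low.
Qed.

Lemma gpoly0 : gpoly`_0 = 0.
Proof. by rewrite coef_drop_poly add0n Bpoly_low. Qed.

Lemma Dpoly0 : Dpoly`_0 = iota 2.
Proof. by rewrite coefD coefCM coefMXn hm addr0 coef_qser bd0 mulr1. Qed.

Lemma Lop_Vpoly N n : (n <= N)%N -> (Lop (Vpoly N))`_n = 0.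
Proof.
elim: N n => [|N IH] n.
  rewrite leqn0 => /eqP ->.
  have -> : Vpoly 0 = 1%:P * 'X^0 by rewrite expr0 mulr1.
  rewrite LopCX mul0r /scal rmorph0 mul0r expr0n /= !mul0r !add0r.
  by rewrite mul1r expr0 mulr1 gpoly0.
move=> nN; rewrite -/(Vpoly N) [Vpoly _]/= LopD coefD LopCX coefMXn.
have [lt|ge] := ltnP n N.+1; first by rewrite addr0 IH.
have -> : n = N.+1 by apply/eqP; rewrite eqn_leq nN.
rewrite subnn coefCM !coefD gpoly0 addr0 coefMXn hm add0r /scal coefCM Dpoly0.
rewrite mulrAC -!rmorphM.
have -> : - (N.+1%:R)^-1 * (N.+1%:R / 2 * 2) = -1 :> K.
  by rewrite divfK ?pnatr_eq0 // mulNr mulVf ?pnatr_eq0.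
by rewrite rmorphN rmorph1 mulN1r subrr.
Qed.

Lemma size_Vpoly N : (size (Vpoly N) <= N.+1)%N.
Proof.
elim: N => [|N IH] /=; first by rewrite size_poly1.
apply: leq_trans (size_polyD _ _) _; rewrite geq_max (leq_trans IH) //=.
by rewrite (leq_trans (size_polyMleq _ _)) // size_polyXn size_polyC; case: (_ != 0).
Qed.

Lemma coef_Vpoly N j : (j <= N)%N -> (Vpoly N)`_j = phi0 j.
Proof.
elim: N => [|N IH]; first by rewrite leqn0 => /eqP ->.
rewrite leq_eqVlt => /predU1P[->//|jN].
rewrite [Vpoly _]/= coefD coefCM coefXn.
by rewrite (ltn_eqF jN) mulr0 addr0 IH.
Qed.

Lemma phi0_0 : phi0 0 = 1. Proof. by rewrite /phi0 /= coefC. Qed.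

(** A polynomial in y^2 = 1/x. For even m the operator [Lop] preserves this property, so phi_0
    involves integral powers of x only. *)
Definition evenp p := forall j, odd j -> p`_j = 0.

Lemma evenpD p q : evenp p -> evenp q -> evenp (p + q).
Proof. by move=> hp hq j oj; rewrite coefD hp ?hq ?addr0. Qed.
Lemma evenpN p : evenp p -> evenp (- p).
Proof. by move=> hp j oj; rewrite coefN hp ?oppr0. Qed.
Lemma evenpM p q : evenp p -> evenp q -> evenp (p * q).
Proof.
move=> hp hq j oj; rewrite coefM big1 // => i _.
have [oi|ei] := boolP (odd i); first by rewrite hp // mul0r.
by rewrite hq ?mulr0 // oddB ?oj ?(negPf ei) // -ltnS.
Qed.
Lemma evenpC (c : A) : evenp c%:P.
Proof. by move=> [|j] // _; rewrite coefC. Qed.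
Lemma evenpXn k : ~~ odd k -> evenp 'X^k.
Proof. by move=> ek j oj; rewrite coefXn; case: eqP oj ek => // -> ->. Qed.
Lemma evenp_theta p : evenp p -> evenp (theta p).
Proof. by move=> hp j oj; rewrite coef_theta hp ?mulr0. Qed.
Lemma evenp_qser : evenp qser.
Proof. by move=> j oj; rewrite coef_qser /bd oj. Qed.
Lemma evenp_Ppoly : evenp Ppoly.
Proof. by move=> j oj; rewrite coef_Ppoly oj. Qed.

Lemma evenp_Lop p : ~~ odd m -> evenp p -> evenp (Lop p).
Proof.
move=> em hp.
have hX := evenpXn em; have hq := evenp_qser; have hr := evenpC r.
have hD : evenp Dpoly.
  apply: evenpD; first by apply: evenpM hq; exact: evenpC.
  apply: evenpM hX; apply: evenpD; first by rewrite -polyC1; exact: evenpC.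
  by apply: evenpN; apply: evenpM hr; exact: evenpC.
have hrq : evenp (rpoly * 'X^m - qser).
  by apply: evenpD; [exact: evenpM|exact: evenpN].
have hB : evenp Bpoly.
  apply: evenpD; last first.
    apply: evenpN; apply: evenpM => //; apply: evenpD; last exact: evenp_theta.
    by apply: evenpM => //; exact: evenpC.
  apply: evenpD; last by apply: evenpN; exact: evenp_Ppoly.
  apply: evenpD; first by rewrite expr2; exact: evenpM.
  by apply: evenpN; exact: evenpM.
have hg : evenp gpoly.
  by move=> j oj; rewrite coef_drop_poly hB // oddD oj (negPf em).
apply: evenpD; last exact: evenpM.
apply: evenpD; first by apply: evenpM => //; do 2!apply: evenp_theta.
by apply: evenpN; apply: evenpM => //; exact: evenp_theta.
Qed.

Lemma evenp_Vpoly N : ~~ odd m -> evenp (Vpoly N).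
Proof.
move=> em; elim: N => [|N IH] /=; first by rewrite -polyC1; exact: evenpC.
apply: evenpD => // j oj; rewrite coefCM coefXn.
case: eqP => [E|_]; last by rewrite mulr0.
by rewrite -E evenp_Lop // mulr0 mul0r.
Qed.

Lemma phi0_odd : ~~ odd m -> forall j, odd j -> phi0 j = 0.
Proof. by move=> em j oj; exact: evenp_Vpoly. Qed.

Lemma coef_ddx N n : (n <= N)%N ->
  ('X^m * theta (Vpoly N) + (rpoly * 'X^m - qser) * Vpoly N)`_n =
  (if (m <= n)%N then (r - iota ((n - m)%:R / 2)) * phi0 (n - m)%N else 0)
  - \sum_(i < n.+1) bd i * phi0 (n - i)%N.
Proof.
move=> nN; rewrite mulrBl addrA -mulrA ['X^m * Vpoly N]mulrC.
have -> : 'X^m * theta (Vpoly N) + rpoly * (Vpoly N * 'X^m) =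
  (theta (Vpoly N) + rpoly * Vpoly N) * 'X^m by ring.
rewrite coefB coefMXn coefM ltnNge; congr (_ - _); last first.
  apply: eq_bigr => i _; rewrite coef_qser coef_Vpoly //.
  exact: leq_trans (leq_subr _ _) nN.
case: leqP => //= mn; rewrite coefD coef_theta coefCM coef_Vpoly.
  by rewrite rmorphN; ring.
exact: leq_trans (leq_subr _ _) nN.
Qed.

Section Evaluation.
Variables (h : {rmorphism A -> K}) (y : K).
Hypothesis h_iota : forall c, h (iota c) = c.

Definition pv p : K := (map_poly h p).[y].

Lemma pvD p q : pv (p + q) = pv p + pv q.
Proof. by rewrite /pv rmorphD hornerD. Qed.
Lemma pvB p q : pv (p - q) = pv p - pv q.
Proof. by rewrite /pv rmorphB /= hornerD hornerN. Qed.
Lemma pvM p q : pv (p * q) = pv p * pv q.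
Proof. by rewrite /pv rmorphM hornerM. Qed.
Lemma pvXn n : pv 'X^n = y ^+ n.
Proof. by rewrite /pv map_polyXn hornerXn. Qed.
Lemma pvC (c : A) : pv c%:P = h c.
Proof. by rewrite /pv map_polyC hornerC. Qed.
Lemma pv_scal c : pv (scal c) = c.
Proof. by rewrite pvC h_iota. Qed.
Lemma pv1 : pv 1 = 1.
Proof. by rewrite -polyC1 pvC rmorph1. Qed.
Lemma pv_sum (I : Type) (s : seq I) (P : pred I) (F : I -> {poly A}) :
  pv (\sum_(i <- s | P i) F i) = \sum_(i <- s | P i) pv (F i).
Proof. by elim/big_rec2: _ => [|i x p _ <-]; rewrite ?pvD // -polyC0 pvC rmorph0. Qed.

Lemma pv_theta p : pv (theta p) = - 2^-1 * (y * (map_poly h p)^`().[y]).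
Proof. by rewrite /theta pvM pv_scal pvM -['X]expr1 pvXn expr1 /pv deriv_map. Qed.

Lemma pv_qser : pv qser = \sum_(0 <= k < m | (k.*2 < m)%N) h (b k) * y ^+ k.*2.
Proof. by rewrite /qser pv_sum; apply: eq_bigr => k _; rewrite pvM pvC pvXn. Qed.

Lemma pv_Ppoly : pv Ppoly = \sum_(0 <= k < m.+1) h (Pc k) * y ^+ k.*2.
Proof. by rewrite /Ppoly pv_sum; apply: eq_bigr => k _; rewrite pvM pvC pvXn. Qed.

Lemma pv_Dpoly : pv Dpoly = 2 * pv qser + (1 - 2 * h r) * y ^+ m.
Proof. by rewrite /Dpoly pvD !pvM pvB pv1 pvM !pv_scal pvC pvXn. Qed.

Lemma pv_gpoly : pv gpoly * y ^+ m = (h r * y ^+ m - pv qser) ^+ 2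
  - y ^+ m * (h r * y ^+ m - pv qser) - pv Ppoly
  - y ^+ m * (m%:R / 2 * pv qser + pv (theta qser)).
Proof.
rewrite -pvXn -pvM -BpolyE /Bpoly !pvB [in LHS]expr2 !pvM !pvB !pvD !pvM pvC pvXn pv_scal.
by rewrite expr2.
Qed.

Lemma pv_Lop v : pv (Lop v) =
  y ^+ m * pv (theta (theta v)) - pv Dpoly * pv (theta v) + pv gpoly * pv v.
Proof. by rewrite /Lop pvD pvB !pvM pvXn. Qed.

Lemma pv_Vpoly N : pv (Vpoly N) = \sum_(j < N.+1) h (phi0 j) * y ^+ j.
Proof.
have sz : (size (map_poly h (Vpoly N)) <= N.+1)%N.
  by apply: leq_trans (size_poly _ _) _; exact: size_Vpoly.
rewrite /pv (horner_coef_wide _ sz); apply: eq_bigr => j _.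
by rewrite coef_map coef_Vpoly // -ltnS.
Qed.

Definition Fpoly N := 'X^m * theta (Vpoly N) + (rpoly * 'X^m - qser) * Vpoly N.

Lemma pv_Fpoly N : pv (Fpoly N) =
  y ^+ m * pv (theta (Vpoly N)) + (h r * y ^+ m - pv qser) * pv (Vpoly N).
Proof.
rewrite /Fpoly pvD (pvM 'X^m) (pvM (_ - _)) (pvB (_ * _)) (pvM rpoly) pvXn.
by rewrite /rpoly pvC.
Qed.
End Evaluation.
End FormalSolution.

(** * The equation satisfied by the corrected exponential *)

(* [wA], with its constants [wi] and its evaluations [wh a], stands for C[a]. It is
   kept abstract so that multivariate polynomials are never unfolded. *)
Record wkb_data (R : realType) (m : nat) := WkbData {
  wA : comNzRingType;
  wi : {rmorphism R[i] -> wA};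
  wb : nat -> wA;
  wP : nat -> wA;
  wr : wA;
  wh : 'rV[R[i]]_m -> {rmorphism wA -> R[i]};
  w_gt0 : (0 < m)%N;
  w_Pgt : forall k, (m < k)%N -> wP k = 0;
  w_b0 : wb 0 = 1;
  w_bsqr : forall n, \sum_(i < n.+1) wb i * wb (n - i) = wP n;
  w_rE : wr = wi (2^-1 - m%:R / 4) - (if odd m then 0 else wb m./2);
  w_hi : forall a c, wh a (wi c) = c;
  w_ent : forall c, ent (fun a => wh a c);
  w_Pm : forall x a, Pm x a = \sum_(0 <= k < m.+1) wh a (wP k) * x ^+ (m - k)
}.

Section Transform.
Variables (R : realType) (m : nat) (X : wkb_data R m).
Local Notation C := R[i].
Local Notation V := 'rV[C]_m.
Implicit Types (t : C) (a : V) (F G : C -> C).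

Lemma cder_horner (p : {poly C}) (z : C) : cder (horner p) z p^`().[z].
Proof.
elim/poly_ind: p => [|p c IH].
  apply: cder_ext (cder_eq (cder_cst 0 z) _) => [w|]; first by rewrite horner0.
  by rewrite deriv0 horner0.
have h := cderD (cderM IH (cder_id z)) (cder_cst c z).
apply: cder_ext (cder_eq h _) => [w|]; first by rewrite hornerMXaddC.
by rewrite derivD derivM derivX derivC !hornerE; ring.
Qed.

(* x^(-1/2) and x^(m/2). *)
Definition yv t : C := cexp (- 2^-1 * t).
Definition LL t : C := cexp (m%:R / 2 * t).

Lemma LLy t : LL t * yv t ^+ m = 1.
Proof.
rewrite /LL /yv -cexpMn -cexpD.
have -> : m%:R / 2 * t + m%:R * (- 2^-1 * t) = 0 by field.
exact: cexp0.
Qed.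

Lemma LL_neq0 t : LL t != 0. Proof. exact: cexp_neq0. Qed.

Lemma yvX t n : yv t ^+ n = cexp (- (n%:R / 2) * t).
Proof. by rewrite /yv -cexpMn; congr cexp; field. Qed.

Local Notation pva a p t := (pv (wh X a) (yv t) p).
Definition qx := qser m (wb X).
Definition Dx := Dpoly (wi X) m (wb X) (wr X).
Definition gx := gpoly (wi X) m (wb X) (wP X) (wr X).
Definition Lx := Lop (wi X) m (wb X) (wP X) (wr X).
Definition Vx N := Vpoly (wi X) m (wb X) (wP X) (wr X) N.
Definition Fx N := Fpoly (wi X) m (wb X) (wP X) (wr X) N.
Definition tx := theta (wi X).
Definition px := phi0 (wi X) m (wb X) (wP X) (wr X).

Lemma cder_yv t : cder yv t (- 2^-1 * yv t).
Proof. exact: cder_cexpM. Qed.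

Lemma cder_LL t : cder LL t (m%:R / 2 * LL t).
Proof. exact: cder_cexpM. Qed.

Lemma cder_pv a p t : cder (fun t => pva a p t) t (pva a (tx p) t).
Proof.
apply: cder_eq (cder_comp (cder_yv t) (cder_horner _ (yv t))) _.
by rewrite (pv_theta _ (w_hi X a)) mulrA.
Qed.

(** [Sfun] read through the abstract data; for [mpoly_data] the two are convertible. *)
Definition Sx t a : C := 2 / m%:R * powx (m%:R / 2) t
  + \sum_(1 <= k < m | (k.*2 < m)%N)
      wh X a (wb X k) / (m%:R / 2 - k%:R) * powx (m%:R / 2 - k%:R) t.

Lemma cder_Sx t a : cder (Sx ^~ a) t (LL t * pva a qx t).
Proof.
have m0 := w_gt0 X.
have mR : m%:R != 0 :> C by rewrite pnatr_eq0 -lt0n.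
pose l k := wh X a (wb X k) * powx (m%:R / 2 - k%:R) t.
have H : cder (Sx ^~ a) t (powx (m%:R / 2) t + \sum_(1 <= k < m | (k.*2 < m)%N) l k).
  apply: cderD.
    apply: cder_eq (cderZ _ (cder_cexpM _ t)) _; rewrite /powx; field.
    by rewrite mR.
  apply: cder_sum => k km; apply: cder_eq (cderZ _ (cder_cexpM _ t)) _.
  (* The exponent m/2 - k does not vanish, because 2 k < m. *)
  rewrite /l /powx mulrA divfK // subr_eq0 -(inj_eq (mulIf (_ : 2 != 0))) ?pnatr_eq0 //.
  rewrite divfK ?pnatr_eq0 // -natrM eqr_nat muln2.
  by rewrite gtn_eqF.
apply: cder_eq H _.
rewrite /qx pv_qser mulr_sumr [RHS]big_ltn_cond //= m0 /=.
have E k : LL t * yv t ^+ k.*2 = powx (m%:R / 2 - k%:R) t.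
  rewrite yvX /LL /powx -cexpD; congr cexp.
  by rewrite -muln2 natrM; field.
congr (_ + _).
  by rewrite (w_b0 X) rmorph1 mul1r double0 expr0 mulr1.
by apply: eq_bigr => k _; rewrite /l -E; ring.
Qed.

(* x^(-r) e^S. *)
Definition Ei t a : C := cexp (- wh X a (wr X) * t) * cexp (Sx t a).

Lemma Ei_neq0 t a : Ei t a != 0.
Proof. by rewrite mulf_neq0 // cexp_neq0. Qed.

Lemma cder_Ei t a : cder (Ei ^~ a) t (Ei t a * (LL t * pva a qx t - wh X a (wr X))).
Proof.
have h1 := cder_cexpM (- wh X a (wr X)) t.
have h2 := cder_comp (cder_Sx t a) (cder_cexp (Sx t a)).
by apply: cder_eq (cderM h1 h2) _; rewrite /Ei; ring.
Qed.

(* v = x^(-r) e^S F and its t-derivative, when G = F'. *)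
Definition nv F a t := Ei t a * F t.
Definition ng F G a t := Ei t a * (G t + (LL t * pva a qx t - wh X a (wr X)) * F t).

Lemma cder_nv F G a t : cder F t (G t) -> cder (nv F a) t (ng F G a t).
Proof.
by move=> h; apply: cder_eq (cderM (cder_Ei t a) h) _; rewrite /ng; ring.
Qed.

Lemma pv_Ppoly_Pm a t : LL t ^+ 2 * pva a (Ppoly m (wP X)) t = Pm (cexp t) a.
Proof.
rewrite pv_Ppoly (w_Pm X) mulr_sumr big_nat [RHS]big_nat.
apply: eq_bigr => k /andP[_ km]; rewrite mulrCA; congr (_ * _).
have -> : LL t ^+ 2 = cexp (2 * (m%:R / 2 * t)) by rewrite -cexpMn.
have -> : cexp t ^+ (m - k) = cexp ((m - k)%:R * t) by rewrite cexpMn.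
rewrite yvX -cexpD; congr cexp.
have -> : (m - k)%:R = m%:R - k%:R :> C by apply: natrB; rewrite -ltnS.
have -> : (k.*2)%:R = k%:R * 2 :> C by rewrite -muln2 natrM.
by move: (m%:R) (k%:R) => u v; field.
Qed.

Lemma cder_ng F G a t : cder F t (G t) -> cder G t (G t + Pm (cexp t) a * F t) ->
  cder (ng F G a) t
    (LL t * pva a Dx t * ng F G a t - LL t * pva a gx t * nv F a t).
Proof.
move=> hF hG.
have hq := cderM (cder_LL t) (cder_pv a qx t).
have hqr := cderB hq (cder_cst (wh X a (wr X)) t).
have h := cderM (cder_Ei t a) (cderD hG (cderM hqr hF)).
apply: cder_eq h _; rewrite /ng /nv.
have hg := pv_gpoly (w_Pgt X) (w_b0 X) (w_bsqr X) (w_gt0 X) (w_rE X) (yv t) (w_hi X a).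
have hD := pv_Dpoly m (wb X) (wr X) (yv t) (w_hi X a).
rewrite -/gx -/qx -/tx in hg; rewrite -/Dx -/qx in hD.
rewrite -(pv_Ppoly_Pm a t) hD; move: hg.
have hL := LLy t; have L0 := LL_neq0 t.
have -> : yv t ^+ m = (LL t)^-1 by rewrite -[LHS]mul1r -(mulVf L0) -mulrA hL mulr1.
move: (LL t) (pva a gx t) (pva a qx t) (pva a (Ppoly m (wP X)) t) (pva a (tx qx) t) (wh X a (wr X)) (Ei t a) L0.
move=> l g q P q' r E l0 hg.
(* [pv_gpoly] gives g only after multiplication by y^m = 1/l; it is solved for g before the identity
   is checked. *)
have -> : g = ((r / l - q) ^+ 2 - l^-1 * (r / l - q) - P
  - l^-1 * (m%:R / 2 * q + q')) * l by rewrite -hg mulfVK.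
by field.
Qed.

(* The errors left by the truncation [Vx N] of phi_0 in v and v'. *)
Definition eN N F a t := nv F a t - pva a (Vx N) t.
Definition fN N F G a t := ng F G a t - pva a (tx (Vx N)) t.

Lemma cder_eN N F G a t : cder F t (G t) -> cder (eN N F a) t (fN N F G a t).
Proof. by move=> h; apply: cderB (cder_nv a h) (cder_pv a _ t). Qed.

(** The truncation V_N solves the transformed equation up to a residual, namely [Lx (Vx N)] with the
    factor x^(m/2) that [Lop] had divided out restored. *)
Lemma cder_fN N F G a t : cder F t (G t) -> cder G t (G t + Pm (cexp t) a * F t) ->
  cder (fN N F G a) t (LL t * pva a Dx t * fN N F G a t - LL t * pva a gx t * eN N F a t
    - LL t * pva a (Lx (Vx N)) t).
Proof.
move=> hF hG; apply: cder_eq (cderB (cder_ng hF hG) (cder_pv a _ t)) _.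
rewrite /fN /eN /Lx pv_Lop -/gx -/Dx -/tx.
have hL := LLy t; have L0 := LL_neq0 t.
have -> : yv t ^+ m = (LL t)^-1 by rewrite -[LHS]mul1r -(mulVf L0) -mulrA hL mulr1.
by field.
Qed.
End Transform.

(** * Energy estimates *)

Section Energy.
Variables (R : realType) (m : nat).
Local Notation C := R[i].
Local Notation V := 'rV[C]_m.
Implicit Types (t d : C) (a : V) (e f F G : C -> C).

Definition rho t : R := expR (complex.Re t / 2).

Lemma rho_gt0 t : 0 < rho t. Proof. exact: expR_gt0. Qed.

Lemma ReZ (x : R) t : complex.Re (x%:C * t) = x * complex.Re t.
Proof. by case: t => u v /=; rewrite mul0r subr0. Qed.

Lemma normc_yv t : normc (yv t) = (rho t)^-1.
Proof.
rewrite /yv normc_cexp /rho -expRN; congr expR.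
have -> : - 2^-1 * t = (- 2^-1 : R)%:C * t.
  by rewrite rmorphN fmorphV rmorph_nat.
by rewrite ReZ; lra.
Qed.

Lemma normc_LL t : normc (LL m t) = rho t ^+ m.
Proof.
have h : normc (LL m t) * (rho t)^-1 ^+ m = 1.
  by rewrite -normc_yv -normcX -normcM LLy normc1.
by rewrite -[LHS]mulr1 -(mulVf (expf_neq0 m (lt0r_neq0 (rho_gt0 t)))) -exprVn mulrA h mul1r.
Qed.

Lemma amgm (k x z p : R) : 0 < p -> 2 * k * x * z <= p * z ^+ 2 + k ^+ 2 * x ^+ 2 / p.
Proof.
move=> p0; rewrite -subr_ge0.
have -> : p * z ^+ 2 + k ^+ 2 * x ^+ 2 / p - 2 * k * x * z = (p * z - k * x) ^+ 2 / p.
  by field; rewrite gt_eqF.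
by rewrite divr_ge0 ?sqr_ge0 // ltW.
Qed.

(** Here p, L, w stand for rho, rho^m and the weight; x, z, s for |e|, |f| and the size of the
    residual; u, v for the real parts of the pairings, and w' for the derivative of the weight. As c
    K = 2 and w L = K p, the damping contributes -4 p z^2. One p z^2 is spent on w', one on each of
    the two arithmetic-geometric inequalities for x z and s z. *)
Lemma energy_ineq (c Cc K L p w x z s u v w' : R) :
  0 < p -> 0 <= x -> 0 <= z -> 0 <= s -> 0 <= Cc -> 0 <= K -> 0 <= w ->
  c * K = 2 -> w * L = K * p -> w <= K -> m%:R * K <= p ->
  w' <= m%:R / 2 * w -> u <= x * z ->
  v <= - c * L * z ^+ 2 + z * L * (Cc / p) * (x + s) ->
  2 * u + (w' * z ^+ 2 + w * (2 * v)) <= (1 + K * Cc) ^+ 2 / p * (x ^+ 2 + s ^+ 2).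
Proof.
move=> p0 x0 z0 s0 C0 K0 w0 cK wL wK mK hw' hu hv.
have z2 : 0 <= z ^+ 2 by rewrite exprn_ge0.
have h1 : w * (2 * v) <= - 4 * p * z ^+ 2 + 2 * (K * Cc) * x * z + 2 * (K * Cc) * s * z.
  apply: (@le_trans _ _ (w * (2 * (- c * L * z ^+ 2 + z * L * (Cc / p) * (x + s))))).
    by apply: ler_wpM2l => //; lra.
  have -> : w * (2 * (- c * L * z ^+ 2 + z * L * (Cc / p) * (x + s))) =
    (w * L) * 2 * (- c * z ^+ 2 + z * (Cc / p) * (x + s)) by ring.
  rewrite wL; apply: ler_eq.
  have -> : K * p * 2 * (- c * z ^+ 2 + z * (Cc / p) * (x + s)) =
    - 2 * (c * K) * p * z ^+ 2 + 2 * (K * Cc) * x * z + 2 * (K * Cc) * s * z.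
    by field; rewrite gt_eqF.
  by rewrite cK; ring.
have h2 : w' * z ^+ 2 <= p * z ^+ 2.
  apply: ler_wpM2r => //; apply: le_trans hw' _; apply: le_trans mK.
  have mw : m%:R * w <= m%:R * K by exact: ler_wpM2l.
  have : 0 <= m%:R * w by rewrite mulr_ge0.
  by lra.
have h3 := amgm (1 + K * Cc) x z p0; have h4 := amgm (1 + K * Cc) s z p0.
have h5 : 0 <= s * z by rewrite mulr_ge0.
have h6 : 2 * u <= 2 * (x * z) by lra.
have -> : (1 + K * Cc) ^+ 2 / p * (x ^+ 2 + s ^+ 2) =
  (1 + K * Cc) ^+ 2 * x ^+ 2 / p + (1 + K * Cc) ^+ 2 * s ^+ 2 / p by field; rewrite gt_eqF.
have h7 : 0 <= p * z ^+ 2 by rewrite mulr_ge0 // ltW.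
lra.
Qed.

(* K rho^(1-m). *)
Definition weight (K : R) t : R := K * expR ((1 - m%:R) / 2 * complex.Re t).

Definition energy (K : R) e f t : R := normc (e t) ^+ 2 + weight K t * normc (f t) ^+ 2.

Lemma weight_rho K t : weight K t * rho t ^+ m = K * rho t.
Proof.
rewrite /weight /rho -expRM_natl -mulrA -expRD; congr (_ * expR _); ring.
Qed.

Lemma weight_ge0 K t : 0 <= K -> 0 <= weight K t.
Proof. by move=> K0; rewrite mulr_ge0 // expR_ge0. Qed.

Lemma weight_le K t : (0 < m)%N -> 0 <= K -> 1 <= rho t -> weight K t <= K.
Proof.
move=> m0 K0 h1; have h : 0 <= complex.Re t / 2 by rewrite -ler_expR expR0.
have m1 : 1 <= m%:R :> R by rewrite ler1n.
rewrite -[leRHS]mulr1; apply: ler_wpM2l => //.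
have h2 : (1 - m%:R) / 2 * complex.Re t <= 0 by apply: mulr_le0_ge0; lra.
by move: h2; rewrite -ler_expR expR0.
Qed.

Lemma is_derive_weight K t d s : is_derive s (1 : R) (fun u : R => weight K (t + u%:C * d))
  (weight K (t + s%:C * d) * ((1 - m%:R) / 2 * complex.Re d)).
Proof.
have [h _] := @cder_line _ (fun z => z) t d 1 s (cder_id _).
rewrite mulr1 in h.
have h1 : is_derive s (1 : R) (fun u : R => (1 - m%:R) / 2 * complex.Re (t + u%:C * d)) _ :=
  is_deriveZ ((1 - m%:R) / 2) h.
have h2 : is_derive s (1 : R) (fun u : R => expR ((1 - m%:R) / 2 * complex.Re (t + u%:C * d))) _ :=
  @is_derive1_comp R expR _ s _ _ (is_derive_expR _) h1.
have h3 : is_derive s (1 : R) (fun u : R => weight K (t + u%:C * d)) _ := is_deriveZ K h2.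
by apply: is_derive_eq h3 _; rewrite /GRing.scale /= /weight; ring.
Qed.

(** Adding the constant eps^2, the squared size of the residual, to the energy makes the
    differential inequality homogeneous, so that Gronwall's lemma applies with the rate (1 + K Cc)^2
    / rho, K = 2 / c. The bound m K <= rho keeps the derivative of the weight below the damping. *)
Lemma energy_growth (m0 : (0 < m)%N) (e f f' : C -> C) t0 d (Lg c Cc eps : R) (kap kap' : R -> R) :
  0 <= Lg -> 0 < c -> 0 <= Cc -> 0 <= eps -> normc d <= 1 ->
  (forall s : R, 0 <= s <= Lg -> let t := t0 + s%:C * d in
    [/\ cder e t (f t), cder f t (f' t), m%:R * (2 / c) <= rho t /\ 1 <= rho t &
     complex.Re ((f t)^* * (d * f' t)) <= - c * rho t ^+ m * normc (f t) ^+ 2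
       + normc (f t) * rho t ^+ m * (Cc / rho t) * (normc (e t) + eps)]) ->
  (forall s : R, 0 <= s <= Lg -> is_derive s (1 : R) kap (kap' s)) ->
  (forall s : R, 0 <= s <= Lg -> (rho (t0 + s%:C * d))^-1 <= kap' s) ->
  energy (2 / c) e f (t0 + Lg%:C * d) + eps ^+ 2 <=
  expR ((1 + 2 / c * Cc) ^+ 2 * (kap Lg - kap 0)) * (energy (2 / c) e f t0 + eps ^+ 2).
Proof.
move=> L0 c0 C0 e0 d1 H hk hk'.
set K := 2 / c; have K0 : 0 <= K by rewrite divr_ge0 // ltW.
set M := (1 + K * Cc) ^+ 2; have M0 : 0 <= M by rewrite sqr_ge0.
pose pt (s : R) := t0 + s%:C * d.
pose U (s : R) := energy K e f (pt s) + eps ^+ 2.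
pose U' (s : R) := 2 * complex.Re ((e (pt s))^* * (d * f (pt s))) +
  ((weight K (pt s) * ((1 - m%:R) / 2 * complex.Re d)) * normc (f (pt s)) ^+ 2 +
  weight K (pt s) * (2 * complex.Re ((f (pt s))^* * (d * f' (pt s))))).
have dU (s : R) : 0 <= s <= Lg -> is_derive s (1 : R) U (U' s).
  move=> /H [he hf _ _].
  have h1 := cder_line_sq he; have h2 := cder_line_sq hf.
  have h3 := is_derive_weight K t0 d s.
  have h4 : is_derive s (1 : R)
     (fun u => weight K (t0 + u%:C * d) * normc (f (t0 + u%:C * d)) ^+ 2) _ := is_deriveM h3 h2.
  have h5 : is_derive s (1 : R) (fun u => normc (e (t0 + u%:C * d)) ^+ 2 +
     weight K (t0 + u%:C * d) * normc (f (t0 + u%:C * d)) ^+ 2) _ := is_deriveD h1 h4.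
  have h6 : is_derive s (1 : R) U _ := is_deriveD h5 (is_derive_cst (eps ^+ 2) s 1).
  apply: is_derive_eq h6 _; rewrite /U' /pt /GRing.scale /= addr0.
  by congr (_ + _); rewrite addrC; congr (_ + _); rewrite mulrC.
have bU (s : R) : 0 <= s <= Lg -> U' s <= M * kap' s * U s.
  move=> hs; have [_ _ [r1 r2] hv] := H s hs; have hks := hk' s hs.
  have p0 := rho_gt0 (pt s).
  have w0 := weight_ge0 (pt s) K0.
  apply: le_trans (energy_ineq (c := c) (Cc := Cc) (K := K) (L := rho (pt s) ^+ m) p0
    (normc_ge0 (e (pt s))) (normc_ge0 (f (pt s))) e0 C0 K0 w0 _ (weight_rho K (pt s))
    (weight_le m0 K0 r2) r1 _ _ hv) _.
  - by rewrite /K; field; rewrite gt_eqF.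
  - rewrite [leRHS]mulrC; apply: ler_wpM2l => //.
    have := normc_Re d; rewrite ler_norml => /andP[dr _].
    have mr : 1 <= m%:R :> R by rewrite ler1n.
    have h1 : (m%:R - 1) * - complex.Re d <= (m%:R - 1) * 1.
      by apply: ler_wpM2l; lra.
    by lra.
  - apply: le_trans (Re_conjM_le _ _) _; rewrite normcM.
    apply: ler_wpM2l; first exact: normc_ge0.
    by rewrite -[leRHS]mul1r; apply: ler_wpM2r => //; exact: normc_ge0.
  rewrite -/M -[leLHS]mulrA -[leRHS]mulrA; apply: ler_wpM2l => //.
  apply: ler_pM; [by rewrite invr_ge0 ltW| |exact: hks|].
    by rewrite addr_ge0 // sqr_ge0.
  rewrite /U /energy lerD2r lerDl mulr_ge0 //; exact: sqr_ge0.
have dK (s : R) : 0 <= s <= Lg -> is_derive s (1 : R) (fun u => M * kap u) (M * kap' s).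
  by move=> /hk h; exact: is_deriveZ.
have := gronwall L0 dU dK bU; rewrite /U /pt /= mul0r addr0 => h.
by apply: le_trans h _; rewrite mulrBr.
Qed.

Definition sol a F G t := cder F t (G t) /\ cder G t (G t + Pm (cexp t) a * F t).

Lemma Pm_bound (A B : R) : exists M, 0 <= M /\
  forall a t, bnd A a -> complex.Re t <= B -> normc (Pm (cexp t) a) <= M.
Proof.
exists (expR B ^+ m + \sum_(i < m) `|A| * expR B ^+ (m - i.+1)); split.
  rewrite addr_ge0 ?exprn_ge0 ?expR_ge0 //; apply: sumr_ge0 => i _.
  by rewrite mulr_ge0 // exprn_ge0 // expR_ge0.
move=> a t ha tB.
have h n : normc (cexp t) ^+ n <= expR B ^+ n.
  by apply: lerXn2r; rewrite ?nnegrE ?normc_ge0 ?expR_ge0 // normc_cexp ler_expR.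
apply: le_trans (normcD _ _) _; apply: lerD; first by rewrite normcX.
apply: le_trans (normc_sum _ _ _) _; apply: ler_sum => i _; rewrite normcM normcX.
apply: ler_pM; rewrite ?exprn_ge0 ?normc_ge0 //.
exact: le_trans (ha i) (ler_norm _).
Qed.

(** A crude bound on a fixed segment, uniform on polydiscs in a: it moves information between the
    base point t = 0 and the region of large |x|, where the energy estimates hold. *)
Lemma ode_growth A t0 d : exists Kc, 0 <= Kc /\ forall a F G, bnd A a ->
  (forall s : R, 0 <= s <= 1 -> sol a F G (t0 + s%:C * d)) ->
  normc (F (t0 + d)) ^+ 2 + normc (G (t0 + d)) ^+ 2 <=
  Kc * (normc (F t0) ^+ 2 + normc (G t0) ^+ 2).
Proof.
have [B [B0 hB]] := Pm_bound A (normc t0 + normc d).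
exists (expR (normc d * (3 + B))); split; first exact: expR_ge0.
move=> a F G ha hs; have d0 := normc_ge0 d.
pose pt (s : R) := t0 + s%:C * d.
pose U (s : R) := normc (F (pt s)) ^+ 2 + normc (G (pt s)) ^+ 2.
pose U' (s : R) := 2 * complex.Re ((F (pt s))^* * (d * G (pt s))) +
  2 * complex.Re ((G (pt s))^* * (d * (G (pt s) + Pm (cexp (pt s)) a * F (pt s)))).
have dU (s : R) : 0 <= s <= 1 -> is_derive s (1 : R) U (U' s).
  by move=> /hs[h1 h2]; exact: is_deriveD (cder_line_sq h1) (cder_line_sq h2).
have dK (s : R) : 0 <= s <= 1 -> is_derive s (1 : R) (fun u : R => normc d * (3 + B) * u) (normc d * (3 + B)).
  move=> _; have h : is_derive s (1 : R) (fun u : R => normc d * (3 + B) * u) _ :=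
    is_deriveZ (normc d * (3 + B)) (is_derive_id s (1 : R)).
  by apply: is_derive_eq h _; rewrite /GRing.scale /= mulr1.
have bU (s : R) : 0 <= s <= 1 -> U' s <= normc d * (3 + B) * U s.
  move=> /andP[s0 s1]; rewrite /U' /U.
  have hP : normc (Pm (cexp (pt s)) a) <= B.
    apply: hB => //; rewrite /pt ReD ReZ; apply: lerD.
      exact: le_trans (ler_norm _) (normc_Re _).
    rewrite -[leRHS]mul1r; apply: le_trans (ler_wpM2l s0 (le_trans (ler_norm _) (normc_Re d))) _.
    exact: ler_wpM2r.
  have h1 := Re_conjM_le (F (pt s)) (d * G (pt s)).
  have h2 := Re_conjM_le (G (pt s)) (d * (G (pt s) + Pm (cexp (pt s)) a * F (pt s))).
  have h3 : normc (G (pt s) + Pm (cexp (pt s)) a * F (pt s)) <= normc (G (pt s)) + B * normc (F (pt s)).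
    apply: le_trans (normcD _ _) _; rewrite lerD2l normcM.
    by apply: ler_wpM2r => //; exact: normc_ge0.
  move: h1 h2; rewrite !normcM => h1 h2.
  have x0 := normc_ge0 (F (pt s)); have y0 := normc_ge0 (G (pt s)).
  move: h1 h2 h3 x0 y0; move: (complex.Re _) (complex.Re _) (normc (_ + _)) (normc (F (pt s))) (normc (G (pt s))).
  move=> u v w x y h1 h2 h3 x0 y0.
  have h4 : y * (normc d * w) <= y * (normc d * (y + B * x)).
    by do 2!apply: ler_wpM2l => //.
  have h5 : 0 <= normc d * (x - y) ^+ 2 by rewrite mulr_ge0 // sqr_ge0.
  have h6 : 0 <= normc d * B * (x - y) ^+ 2 by apply: mulr_ge0; [exact: mulr_ge0|exact: sqr_ge0].
  have h7 : 0 <= normc d * x ^+ 2 by rewrite mulr_ge0 // sqr_ge0.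
  have -> : normc d * (3 + B) * (x ^+ 2 + y ^+ 2) = 2 * (x * (normc d * y)) +
    2 * (y * (normc d * (y + B * x))) + normc d * (x - y) ^+ 2 + normc d * B * (x - y) ^+ 2
    + 2 * (normc d * x ^+ 2) by ring.
  lra.
have := gronwall ler01 dU dK bU.
by rewrite /U /pt /= mul0r addr0 mul1r mulr1 mulr0 subr0.
Qed.
End Energy.

(** * Estimates along rays *)

Section Estimates.
Variables (R : realType) (m : nat) (X : wkb_data R m).
Local Notation C := R[i].
Local Notation V := 'rV[C]_m.
Implicit Types (t d : C) (a : V) (F G : C -> C).
Local Notation pva a p t := (pv (wh X a) (yv t) p).

Lemma pv_horner a (y : C) (p : {poly wA X}) :
  pv (wh X a) y p = \sum_(i < size p) wh X a p`_i * y ^+ i.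
Proof.
rewrite /pv (@horner_coef_wide _ (size p)) ?size_poly //.
by apply: eq_bigr => i _; rewrite coef_map.
Qed.

Lemma ent_pv (y : C) (p : {poly wA X}) : ent (fun a => pv (wh X a) y p).
Proof.
apply: ent_ext (fun a => esym (pv_horner a y p)) _.
by apply: ent_sum => i _; apply: entM; [exact: w_ent|exact: ent_cst].
Qed.

Lemma pv_bound (p : {poly wA X}) N A : (forall n, (n < N)%N -> p`_n = 0) ->
  exists M, 0 <= M /\ forall a (y : C), bnd A a -> normc y <= 1 ->
    normc (pv (wh X a) y p) <= M * normc y ^+ N.
Proof.
move=> pN; pose q := drop_poly N p.
have pE : p = q * 'X^N.
  rewrite -[LHS](poly_take_drop N) [take_poly _ _](_ : _ = 0) ?add0r //.
  by apply/polyP => n; rewrite coef_take_poly coef0; case: ifP => // /pN.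
have /choice[M hM] : forall i : nat, exists M : R, forall a, bnd A a -> normc (wh X a q`_i) <= M.
  by move=> i; have := ent_bounded (w_ent q`_i) A; apply.
exists (\sum_(i < size q) `|M i|); split; first exact: sumr_ge0.
move=> a y ha hy; rewrite pE pvM pvXn normcM normcX.
apply: ler_wpM2r; first by rewrite exprn_ge0 ?normc_ge0.
rewrite pv_horner; apply: le_trans (normc_sum _ _ _) _; apply: ler_sum => i _.
rewrite normcM -[leRHS]mulr1; apply: ler_pM; rewrite ?normc_ge0 //.
  exact: le_trans (hM i a ha) (ler_norm _).
by rewrite normcX exprn_ile1 // normc_ge0.
Qed.

Lemma pvt_bound (p : {poly wA X}) N A : (forall n, (n < N)%N -> p`_n = 0) ->
  exists M, 0 <= M /\ forall a t, bnd A a -> 1 <= rho t ->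
    normc (pva a p t) <= M * (rho t)^-1 ^+ N.
Proof.
move=> /(pv_bound A)[M [M0 hM]]; exists M; split=> // a t ha ht.
rewrite -normc_yv; apply: hM => //.
by rewrite normc_yv invf_le1 // rho_gt0.
Qed.

(** All three gain a factor 1 / rho from vanishing low coefficients: those of g and D - 2 in degree
    0, and those of the residual up to degree N. *)
Lemma coeff_bounds A N : exists Cc, 0 <= Cc /\ forall a t, bnd A a -> 1 <= rho t ->
  [/\ normc (pva a (gx X) t) <= Cc / rho t,
      normc (pva a (Dx X) t - 2) <= Cc / rho t &
      normc (pva a (Lx (Vx X N)) t) <= Cc / rho t * (rho t)^-1 ^+ N].
Proof.
have [M1 [M10 h1]] : exists M, 0 <= M /\ forall a t, bnd A a -> 1 <= rho t ->
    normc (pva a (gx X) t) <= M * (rho t)^-1 ^+ 1.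
  apply: pvt_bound => -[|//] _.
  exact: gpoly0 (w_Pgt X) (w_b0 X) (w_bsqr X) (w_gt0 X) (w_rE X).
have [M2 [M20 h2]] : exists M, 0 <= M /\ forall a t, bnd A a -> 1 <= rho t ->
    normc (pva a (Dx X - scal (wi X) 2) t) <= M * (rho t)^-1 ^+ 1.
  apply: pvt_bound => -[|//] _; rewrite coefB coefC.
  by rewrite (Dpoly0 _ _ (w_b0 X) (w_gt0 X)) subrr.
have [M3 [M30 h3]] : exists M, 0 <= M /\ forall a t, bnd A a -> 1 <= rho t ->
    normc (pva a (Lx (Vx X N)) t) <= M * (rho t)^-1 ^+ N.+1.
  apply: pvt_bound => n nN.
  have H := Lop_Vpoly (w_Pgt X) (w_b0 X) (w_bsqr X) (w_gt0 X) (w_rE X); exact: H.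
exists (M1 + M2 + M3); split; first by rewrite !addr_ge0.
move=> a t ha ht; have r0 : 0 <= (rho t)^-1 by rewrite invr_ge0 ltW // rho_gt0.
have hle M : M <= M1 + M2 + M3 -> M * (rho t)^-1 <= (M1 + M2 + M3) / rho t.
  by move=> h; exact: ler_wpM2r.
split.
- by apply: le_trans (h1 a t ha ht) _; apply: hle; lra.
- have := h2 a t ha ht; rewrite pvB (pv_scal _ (w_hi X a)) => h.
  by apply: le_trans h _; apply: hle; lra.
- apply: le_trans (h3 a t ha ht) _; rewrite exprS mulrA.
  by apply: ler_wpM2r; [rewrite exprn_ge0|apply: hle; lra].
Qed.

Lemma Re_conjMr (z w : C) : complex.Re (z^* * (w * z)) = complex.Re w * normc z ^+ 2.
Proof.
by rewrite normc_sq; case: z => u v; case: w => x y /=; ring.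
Qed.

(** Split D = 2 + (D - 2). The constant part yields -2 c rho^m |f|^2, and D - 2, at most Cc / rho <=
    c, takes back no more than half of it. *)
Lemma wkb_damping (c Cc eps : R) a t d (e f Rs : C) : normc d <= 1 -> 0 <= Cc ->
  complex.Re (LL m t * d) <= - c * rho t ^+ m -> Cc / rho t <= c ->
  normc (pva a (gx X) t) <= Cc / rho t -> normc (pva a (Dx X) t - 2) <= Cc / rho t ->
  normc Rs <= Cc / rho t * eps ->
  complex.Re (f^* * (d * (LL m t * pva a (Dx X) t * f - LL m t * pva a (gx X) t * e - LL m t * Rs)))
  <= - c * rho t ^+ m * normc f ^+ 2
       + normc f * rho t ^+ m * (Cc / rho t) * (normc e + eps).
Proof.
move=> d1 C0 hRe hc hg hD hR.
set D := pva a (Dx X) t in hD *; set g := pva a (gx X) t in hg *.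
set Lam := rho t ^+ m in hRe *; have L0 : 0 <= Lam by rewrite exprn_ge0 // ltW // rho_gt0.
set k := Cc / rho t in hc hg hD hR *.
have k0 : 0 <= k by rewrite divr_ge0 // ltW // rho_gt0.
have nLd : normc (LL m t * d) <= Lam.
  by rewrite normcM normc_LL -[leRHS]mulr1; apply: ler_wpM2l.
clearbody D g Lam k.
have -> : d * (LL m t * D * f - LL m t * g * e - LL m t * Rs) =
  (2 * (LL m t * d)) * f + ((LL m t * d) * (D - 2)) * f - (LL m t * d) * (g * e + Rs) by ring.
rewrite mulrBr mulrDr -[_ - _]/(_ + _) !ReD !Re_conjMr.
have f0 := normc_ge0 f; have f2 : 0 <= normc f ^+ 2 by rewrite exprn_ge0.
have h1 : complex.Re (2 * (LL m t * d)) * normc f ^+ 2 <= 2 * (- c * Lam) * normc f ^+ 2.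
  apply: ler_wpM2r => //.
  have -> : (2 : C) * (LL m t * d) = (2 : R)%:C * (LL m t * d) by rewrite rmorph_nat.
  by rewrite ReZ; apply: ler_wpM2l.
have h2 : complex.Re ((LL m t * d) * (D - 2)) * normc f ^+ 2 <= (Lam * c) * normc f ^+ 2.
  apply: ler_wpM2r => //; apply: le_trans (ler_norm _) _; apply: le_trans (normc_Re _) _.
  rewrite normcM; apply: ler_pM; rewrite ?normc_ge0 //; exact: le_trans hD hc.
have h3 : complex.Re (- (f^* * ((LL m t * d) * (g * e + Rs)))) <=
    normc f * Lam * k * (normc e + eps).
  rewrite -mulrN; apply: le_trans (Re_conjM_le _ _) _; rewrite normcN normcM -!mulrA.
  apply: ler_wpM2l => //; apply: ler_pM; rewrite ?normc_ge0 //.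
  apply: le_trans (normcD _ _) _; rewrite mulrDr; apply: lerD => //.
  by rewrite normcM; apply: ler_wpM2r => //; exact: normc_ge0.
apply: le_trans (lerD (lerD h1 h2) h3) _.
by rewrite -subr_ge0; set x := (x in 0 <= x); have -> : x = 0 by rewrite /x; ring.
Qed.

(** One rate serves two purposes: the error of the truncation, driven by the residual, and the
    difference of two solutions, where the residuals cancel and [eps] is 0. *)
Lemma wkb_growth (c : R) A N : 0 < c -> exists r0 M : R, [/\ 0 <= M, 1 <= r0 &
  forall a t0 d (Lg : R) (kap kap' : R -> R), bnd A a -> 0 <= Lg -> normc d <= 1 ->
  (forall s : R, 0 <= s <= Lg -> let t := t0 + s%:C * d in
    [/\ r0 <= rho t, complex.Re (LL m t * d) <= - c * rho t ^+ m,
      is_derive s (1 : R) kap (kap' s) & (rho t)^-1 <= kap' s]) ->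
  (forall F G (eps : R), 0 <= eps ->
    (forall s : R, 0 <= s <= Lg -> sol a F G (t0 + s%:C * d) /\
       (rho (t0 + s%:C * d))^-1 ^+ N <= eps) ->
    energy m (2 / c) (eN X N F a) (fN X N F G a) (t0 + Lg%:C * d) + eps ^+ 2 <=
    expR (M * (kap Lg - kap 0)) *
      (energy m (2 / c) (eN X N F a) (fN X N F G a) t0 + eps ^+ 2)) /\
  (forall F G F' G',
    (forall s : R, 0 <= s <= Lg ->
       sol a F G (t0 + s%:C * d) /\ sol a F' G' (t0 + s%:C * d)) ->
    energy m (2 / c) (fun t => nv X F a t - nv X F' a t)
      (fun t => ng X F G a t - ng X F' G' a t) (t0 + Lg%:C * d) <=
    expR (M * (kap Lg - kap 0)) *
      energy m (2 / c) (fun t => nv X F a t - nv X F' a t)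
        (fun t => ng X F G a t - ng X F' G' a t) t0)].
Proof.
move=> c0; have [Cc [C0 hC]] := coeff_bounds A N.
(* The three summands ensure 1 <= rho, m (2 / c) <= rho and Cc / rho <= c. *)
pose r0 := 1 + m%:R * (2 / c) + Cc / c.
have k0 : 0 <= m%:R * (2 / c) by rewrite mulr_ge0 // divr_ge0 // ltW.
have k1 : 0 <= Cc / c by rewrite divr_ge0 // ltW.
exists r0, ((1 + 2 / c * Cc) ^+ 2); split; first exact: sqr_ge0.
  by rewrite /r0; lra.
move=> a t0 d Lg kap kap' ha L0 d1 H.
have Hr (s : R) : 0 <= s <= Lg -> [/\ m%:R * (2 / c) <= rho (t0 + s%:C * d),
    1 <= rho (t0 + s%:C * d) & Cc / rho (t0 + s%:C * d) <= c].
  move=> /H[r _ _ _]; have {}r : r0 <= rho (t0 + s%:C * d) := r.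
  have h1 : Cc / c <= rho (t0 + s%:C * d) by move: r; rewrite /r0; lra.
  split; [by move: r; rewrite /r0; lra|by move: r; rewrite /r0; lra|].
  by rewrite ler_pdivrMr ?rho_gt0 // mulrC -ler_pdivrMr.
have m0 := w_gt0 X.
split=> [F G eps e0 hs|F G F' G' hs].
  apply: (energy_growth m0 L0 c0 C0 e0 d1 (kap' := kap')
    (f' := fun t => LL m t * pva a (Dx X) t * fN X N F G a t
      - LL m t * pva a (gx X) t * eN X N F a t - LL m t * pva a (Lx (Vx X N)) t)); first last.
  - by move=> s /H[].
  - by move=> s /H[].
  move=> s hsL; have [[hF hG] he] := hs s hsL; have [r1 r2 r3] := Hr s hsL.
  have [_ hRe _ _] := H s hsL; have [hg hD hR] := hC a _ ha r2.
  split=> //; [exact: cder_eN|exact: cder_fN|].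
  apply: wkb_damping => //; apply: le_trans hR _; apply: ler_wpM2l => //.
  by rewrite divr_ge0 // ltW // rho_gt0.
have := energy_growth m0 L0 c0 C0 (lexx 0) d1 (kap := kap) (kap' := kap')
  (e := fun t => nv X F a t - nv X F' a t)
  (f := fun t => ng X F G a t - ng X F' G' a t)
  (f' := fun t => LL m t * pva a (Dx X) t * (ng X F G a t - ng X F' G' a t)
    - LL m t * pva a (gx X) t * (nv X F a t - nv X F' a t) - LL m t * 0) (t0 := t0).
rewrite expr0n /= !addr0; apply.
- move=> s hsL; have [[hF hG] [hF' hG']] := hs s hsL; have [r1 r2 r3] := Hr s hsL.
  have [_ hRe _ _] := H s hsL; have [hg hD hR] := hC a _ ha r2.
  split=> //.
  + exact: cderB (cder_nv X a hF) (cder_nv X a hF').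
  + apply: cder_eq (cderB (cder_ng X hF hG) (cder_ng X hF' hG')) _; ring.
  + by apply: wkb_damping => //; rewrite normc0 mulr0.
- by move=> s /H[].
- by move=> s /H[].
Qed.

Lemma rho_real (x : R) : rho (x%:C : C) = expR (x / 2). Proof. by []. Qed.

Lemma LL_polar t : LL m t =
  (rho t ^+ m)%:C * (cos (m%:R / 2 * complex.Im t) +i* sin (m%:R / 2 * complex.Im t)).
Proof.
have E : m%:R / 2 * t = (m%:R / 2 : R)%:C * t by rewrite rmorphM fmorphV !rmorph_nat.
have ImZ (x : R) (z : C) : complex.Im (x%:C * z) = x * complex.Im z.
  by case: z => u v /=; rewrite mul0r addr0.
rewrite /LL /cexp E ReZ ImZ.
have -> : expR (m%:R / 2 * complex.Re t) = rho t ^+ m.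
  by rewrite /rho -expRM_natl; congr expR; ring.
by apply/eqP; rewrite eq_complex /= !mul0r subr0 addr0 !eqxx.
Qed.

Lemma LL_real (x : R) : LL m (x%:C : C) = (rho (x%:C : C) ^+ m)%:C.
Proof.
rewrite LL_polar; have -> : complex.Im (x%:C : C) = 0 by [].
by rewrite mulr0 cos0 sin0; exact: mulr1.
Qed.

(* Backward along the real axis, from T to x. *)
Lemma real_axis_growth A N : exists r0 M : R, [/\ 0 <= M, 1 <= r0 &
  forall a (x T : R), bnd A a -> x <= T -> r0 <= rho (x%:C : C) ->
  (forall F G, (forall t, sol a F G t) ->
    energy m 2 (eN X N F a) (fN X N F G a) x%:C <=
    M * (energy m 2 (eN X N F a) (fN X N F G a) T%:C + (expR (x / 2))^-1 ^+ N ^+ 2)) /\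
  (forall F G F' G', (forall t, sol a F G t) -> (forall t, sol a F' G' t) ->
    energy m 2 (fun t => nv X F a t - nv X F' a t)
      (fun t => ng X F G a t - ng X F' G' a t) x%:C <=
    M * energy m 2 (fun t => nv X F a t - nv X F' a t)
        (fun t => ng X F G a t - ng X F' G' a t) T%:C)].
Proof.
have [r0 [M [M0 r1 H]]] := wkb_growth A N (ltr01 : 0 < 1 :> R).
exists r0, (expR (M * 2)); split=> //.
move=> a x T ha xT hx.
(* 1 / rho at T - s is e^((s - T)/2) and increases along the path up to e^(-x/2) <= 1, so its
   integral is at most 2 whatever T is. This makes the constant independent of T. *)
pose kap (s : R) := 2 * expR ((s - T) / 2); pose kap' (s : R) := expR ((s - T) / 2).
have tE (s : R) : (T%:C : C) + s%:C * -1 = (T - s)%:C by rewrite rmorphB mulrN1.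
have nd : normc (-1 : C) <= 1 by rewrite normcN normc1.
have T0 : 0 <= T - x by rewrite subr_ge0.
have rhox (s : R) : s <= T - x -> rho (x%:C : C) <= rho ((T - s)%:C : C).
  by move=> h; rewrite !rho_real ler_expR; lra.
have key (s : R) : 0 <= s <= T - x -> let t := (T%:C : C) + s%:C * -1 in
    [/\ r0 <= rho t, complex.Re (LL m t * -1) <= - 1 * rho t ^+ m,
      is_derive s (1 : R) kap (kap' s) & (rho t)^-1 <= kap' s].
  move=> /andP[s0 s1] t; rewrite /t tE {t}; split.
  - exact: le_trans hx (rhox s s1).
  - by rewrite LL_real ReZ mulN1r [complex.Re _]/= mulrN1.
  - have h0 : is_derive s (1 : R) (fun u : R => 2^-1 * (u - T)) _ :=
      is_deriveZ (2^-1) (is_deriveB (is_derive_id s (1 : R)) (is_derive_cst T s (1 : R))).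
    have h1 : is_derive s (1 : R) (fun u : R => expR (2^-1 * (u - T))) _ :=
      @is_derive1_comp R expR _ s _ _ (is_derive_expR _) h0.
    have h2 : is_derive s (1 : R) (fun u : R => 2 * expR (2^-1 * (u - T))) _ := is_deriveZ 2 h1.
    have -> : kap = (fun u : R => 2 * expR (2^-1 * (u - T))).
      by apply/funext => u; rewrite /kap; congr (_ * expR _); rewrite mulrC.
    apply: is_derive_eq h2 _; rewrite /GRing.scale /= subr0 mulr1 /kap'.
    have -> : (s - T) / 2 = 2^-1 * (s - T) by rewrite mulrC.
    by move: (expR _) => E; field.
  - by rewrite rho_real -expRN /kap' ler_expR; lra.
have [H1 H2] := H a _ _ _ kap kap' ha T0 nd key.
have kle : expR (M * (kap (T - x) - kap 0)) <= expR (M * 2).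
  rewrite ler_expR; apply: ler_wpM2l => //.
  have k0 : 0 <= kap 0 by rewrite /kap mulr_ge0 // expR_ge0.
  have k1 : kap (T - x) <= 2.
    have h : 0 <= x / 2.
      by rewrite -ler_expR expR0 -rho_real; exact: le_trans r1 hx.
    have : expR ((T - x - T) / 2) <= 1 by rewrite -[leRHS]expR0 ler_expR; lra.
    by rewrite /kap; lra.
  by lra.
have xE : (T%:C : C) + (T - x)%:C * -1 = x%:C by rewrite tE; congr (_ %:C); ring.
have e1 : (2 / 1 : R) = 2 by rewrite divr1.
rewrite xE e1 in H1 H2.
have w0 (e f : C -> C) t : 0 <= energy m 2 e f t.
  rewrite addr_ge0 ?sqr_ge0 // mulr_ge0 ?sqr_ge0 //; exact: weight_ge0.
split=> [F G hs|F G F' G' hs hs'].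
  have := H1 F G ((expR (x / 2))^-1 ^+ N) _ _.
  rewrite exprn_ge0 ?invr_ge0 ?expR_ge0 // => /(_ isT) h.
  have {}h : energy m 2 (eN X N F a) (fN X N F G a) x%:C + (expR (x / 2))^-1 ^+ N ^+ 2 <=
   expR (M * (kap (T - x) - kap 0)) * (energy m 2 (eN X N F a) (fN X N F G a) T%:C
   + (expR (x / 2))^-1 ^+ N ^+ 2).
    apply: h => s /andP[s0 s1]; split; first exact: hs.
    apply: lerXn2r; rewrite ?nnegrE ?invr_ge0 ?expR_ge0 //.
    by rewrite tE lef_pV2 ?posrE ?expR_gt0 // -rho_real rhox.
  have h2 : 0 <= (expR (x / 2))^-1 ^+ N ^+ 2 by rewrite sqr_ge0.
  apply: le_trans (le_trans _ h) _; first by rewrite lerDl.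
  by apply: ler_wpM2r => //; rewrite addr_ge0.
apply: le_trans (H2 F G F' G' _) _; first by move=> s _; split.
exact: ler_wpM2r.
Qed.
End Estimates.

(** * Approximate solutions *)

Section Construction.
Variables (R : realType) (m : nat) (X : wkb_data R m).
Local Notation C := R[i].
Local Notation V := 'rV[C]_m.
Implicit Types (t d : C) (a : V) (F G : C -> C).
Local Notation pva a p t := (pv (wh X a) (yv t) p).

Lemma ent_Sx t : ent (Sx X t).
Proof.
apply: entD; first exact: ent_cst.
apply: ent_sum => k _; apply: entM; last exact: ent_cst.
by apply: entM; [exact: w_ent|exact: ent_cst].
Qed.

(** x^r e^(-S). *)
Definition iEi t a : C := cexp (wh X a (wr X) * t) * cexp (- Sx X t a).

Lemma iEiE t a : iEi t a * Ei X t a = 1.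
Proof.
by rewrite /iEi /Ei mulrACA mulNr cexpV [X in _ * X]mulrC cexpV mulr1.
Qed.

Lemma ent_iEi t : ent (iEi t).
Proof.
apply: entM; apply: ent_cexp; first by apply: entM; [exact: w_ent|exact: ent_cst].
by apply: ent_ext (entZ (-1) (ent_Sx t)) => a; rewrite mulN1r.
Qed.

(** Minus the logarithmic t-derivative of x^r e^(-S). *)
Definition lq t a : C := LL m t * pva a (qx X) t - wh X a (wr X).

Lemma ent_lq t : ent (lq t).
Proof.
apply: entD; first by apply: entZ; exact: ent_pv.
by apply: ent_ext (entZ (-1) (w_ent (wr X))) => a; rewrite mulN1r.
Qed.

Definition qn (n : nat) : R := (expR (n%:R / 2))^-1.

Lemma qn_gt0 n : 0 < qn n. Proof. by rewrite invr_gt0 expR_gt0. Qed.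

Lemma qn_le n k : (n <= k)%N -> qn k <= qn n.
Proof.
move=> nk; rewrite lef_pV2 ?posrE ?expR_gt0 // ler_expR.
by rewrite ler_pM2r // ler_nat.
Qed.

Lemma expR_nat_ge (x : R) : exists n0 : nat, x <= expR (n0%:R / 2).
Proof.
have [n hn] := nat_ge (2 * x); exists n.
by have := expR_ge1Dx (n%:R / 2 : R); lra.
Qed.

Lemma qn_small (B e : R) : 0 < e -> exists n0 : nat, forall n, (n0 <= n)%N -> B * qn n <= e.
Proof.
move=> e0; have [n0 hn0] := expR_nat_ge ((`|B| + 1) / e); exists n0 => n nn.
have B1 : 0 < `|B| + 1 by rewrite ltr_wpDl.
have h : qn n <= e / (`|B| + 1).
  apply: le_trans (qn_le nn) _; rewrite /qn -[leRHS]invrK lef_pV2 ?posrE ?expR_gt0 //.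
    by rewrite invf_div.
  by rewrite invr_gt0 divr_gt0.
apply: (@le_trans _ _ ((`|B| + 1) * qn n)).
  apply: ler_wpM2r; first exact: ltW (qn_gt0 n).
  by rewrite (le_trans (ler_norm B)) // lerDl.
apply: le_trans (ler_wpM2l (ltW B1) h) _.
by apply: ler_eq; rewrite mulrC divfK // gt_eqF.
Qed.

Lemma unif_cauchy_lim (u : nat -> V -> C) : (forall n, ent (u n)) ->
  (forall A, exists (n0 : nat) (B : R), forall a, bnd A a -> forall n k, (n0 <= n)%N -> (n <= k)%N ->
     normc (u k a - u n a) <= B * qn n) ->
  exists l, ent l /\ forall a (e : R), 0 < e -> exists n1, forall n, (n1 <= n)%N ->
    normc (u n a - l a) <= e.
Proof.
move=> hu hc.
have /choice[l hl] : forall a, exists l : C, forall e : R, 0 < e ->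
    exists n1, forall n, (n1 <= n)%N -> normc (u n a - l) <= e.
  move=> a; have [A hA] := bnd_exists a; have [n0 [B hB]] := hc A.
  have [l hl] : exists l, forall n, normc (l - u (n0 + n)%N a) <= 2 * (B * qn (n0 + n)).
    apply: complex_cauchy => n k nk; apply: hB => //; first exact: leq_addr.
    by rewrite leq_add2l.
  exists l => e e0; have [n1 hn1] := qn_small (2 * B) e0.
  exists (maxn n0 n1) => n; rewrite geq_max => /andP[h0 h1].
  have := hl (n - n0)%N; rewrite subnKC // normcBC => h; apply: le_trans h _.
  by rewrite mulrA; exact: hn1.
exists l; split=> //; apply: ent_lim => A e e0.
have [n0 [B hB]] := hc A; have [n1 hn1] := qn_small B e0.
exists (u (maxn n0 n1)) => // a ha.
apply: (@le_of_eps R _ _ 1) => // e' e'0; rewrite mul1r.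
have [n2 hn2] := hl a e' e'0.
have h1 := hn2 _ (leq_maxr (maxn n0 n1) n2).
have h2 := hB a ha _ _ (leq_maxl n0 n1) (leq_maxl (maxn n0 n1) n2).
apply: le_trans (normc_dist _ _ (u (maxn (maxn n0 n1) n2) a)) _.
apply: lerD => //; rewrite normcBC; apply: le_trans h2 _.
exact: hn1 (leq_maxr _ _).
Qed.

(** rho^((1-m)/2), the square root of the weight with K = 1. *)
Definition wgt t : R := expR ((1 - m%:R) / 4 * complex.Re t).

Lemma wgt_gt0 t : 0 < wgt t. Proof. exact: expR_gt0. Qed.

Lemma weightE (K : R) t : weight m K t = K * wgt t ^+ 2.
Proof.
rewrite /weight /wgt -expRM_natl; congr (_ * expR _).
by move: (complex.Re t) (m%:R : R) => x n; field.
Qed.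

(** The factor 1 + 1/K stands for K^(-1/2), which it dominates; this avoids square roots. *)
Lemma energy_good (K B : R) (e f : C -> C) t : 0 < K -> 0 <= B ->
  energy m K e f t <= B ^+ 2 -> normc (e t) <= B /\ wgt t * normc (f t) <= B * (1 + K^-1).
Proof.
move=> K0 B0; rewrite /energy weightE => h.
have w0 := ltW (wgt_gt0 t); have f0 := normc_ge0 (f t).
have K'0 : 0 <= K^-1 by rewrite invr_ge0 ltW.
have h1 : 0 <= K * wgt t ^+ 2 * normc (f t) ^+ 2.
  by rewrite mulr_ge0 ?sqr_ge0 // mulr_ge0 ?sqr_ge0 // ltW.
split.
  rewrite -(@ler_sqr R) ?nnegrE ?normc_ge0 //; apply: le_trans h; by rewrite lerDl.
rewrite -(@ler_sqr R) ?nnegrE ?mulr_ge0 //; last by rewrite addr_ge0.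
rewrite -(ler_pM2r K0).
have -> : (B * (1 + K^-1)) ^+ 2 * K = B ^+ 2 * (K + 2 + K^-1) by field; rewrite gt_eqF.
have -> : (wgt t * normc (f t)) ^+ 2 * K = K * wgt t ^+ 2 * normc (f t) ^+ 2 by ring.
apply: (@le_trans _ _ (B ^+ 2)); first by apply: le_trans h; rewrite lerDr sqr_ge0.
rewrite -[leLHS]mulr1; apply: ler_wpM2l; first exact: sqr_ge0.
by lra.
Qed.

Lemma good_energy (K B : R) (e f : C -> C) t : 0 <= K -> 0 <= B ->
  normc (e t) <= B -> wgt t * normc (f t) <= B -> energy m K e f t <= (1 + K) * B ^+ 2.
Proof.
move=> K0 B0 he hf; rewrite /energy weightE mulrDl mul1r; apply: lerD.
  by apply: lerXn2r; rewrite ?nnegrE ?normc_ge0.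
rewrite -mulrA -exprMn; apply: ler_wpM2l => //.
apply: lerXn2r; rewrite ?nnegrE // mulr_ge0 ?normc_ge0 // ltW //; exact: wgt_gt0.
Qed.

Lemma energy_le (K : R) (e f e' f' : C -> C) t : 0 <= K ->
  energy m K (fun t => e t - e' t) (fun t => f t - f' t) t <=
  2 * energy m K e f t + 2 * energy m K e' f' t.
Proof.
move=> K0; have key (x y : C) : normc (x - y) ^+ 2 <= 2 * normc x ^+ 2 + 2 * normc y ^+ 2.
  apply: (@le_trans _ _ ((normc x + normc y) ^+ 2)).
    by apply: lerXn2r; rewrite ?nnegrE ?addr_ge0 ?normc_ge0 // normcB.
  by have := sqr_ge0 (normc x - normc y); lra.
have w0 := @weight_ge0 R m K t K0.
have h1 := key (e t) (e' t); have h2 := ler_wpM2l w0 (key (f t) (f' t)).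
by rewrite /energy; lra.
Qed.

Lemma sol_sub a F G F' G' t : sol a F G t -> sol a F' G' t ->
  sol a (fun t => F t - F' t) (fun t => G t - G' t) t.
Proof.
move=> [h1 h2] [h3 h4]; split; first exact: cderB.
by apply: cder_eq (cderB h2 h4) _; ring.
Qed.

(** V_N has constant term 1 and theta V_N constant term 0, so the data v = 1, v' = 0 miss the
    truncation by O(1/rho). A better order is not asked for, since the starting point goes to
    infinity. *)
Lemma initial_energy N A : exists C0, 0 <= C0 /\ forall a t F G, bnd A a -> 1 <= rho t ->
  nv X F a t = 1 -> ng X F G a t = 0 ->
  energy m 2 (eN X N F a) (fN X N F G a) t <= C0 * (rho t)^-1 ^+ 2.
Proof.
have [M1 [M10 h1]] : exists M, 0 <= M /\ forall a t, bnd A a -> 1 <= rho t ->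
    normc (pva a (1 - Vx X N) t) <= M * (rho t)^-1 ^+ 1.
  apply: pvt_bound => -[|//] _; rewrite coefB coefC /=.
  by rewrite /Vx (coef_Vpoly _ _ _ _ _ (leq0n N)) phi0_0 subrr.
have [M2 [M20 h2]] : exists M, 0 <= M /\ forall a t, bnd A a -> 1 <= rho t ->
    normc (pva a (tx (Vx X N)) t) <= M * (rho t)^-1 ^+ 1.
  apply: pvt_bound => -[|//] _.
  by rewrite /tx coef_theta mul0r oppr0 rmorph0 mul0r.
exists (M1 ^+ 2 + 2 * M2 ^+ 2); split.
  by rewrite addr_ge0 ?sqr_ge0 // mulr_ge0 ?sqr_ge0.
move=> a t F G ha ht hv hg; rewrite /energy /eN /fN hv hg.
have {}h1 := h1 a t ha ht; have {}h2 := h2 a t ha ht.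
rewrite pvB pv1 in h1.
have r0 : 0 <= (rho t)^-1 by rewrite invr_ge0 ltW // rho_gt0.
rewrite mulrDl -exprMn -mulrA -[M2 ^+ 2 * _]exprMn; rewrite expr1 in h1 h2; apply: lerD.
  by apply: lerXn2r; rewrite ?nnegrE ?normc_ge0 ?mulr_ge0.
apply: ler_pM.
- by apply: weight_ge0.
- exact: sqr_ge0.
- exact: weight_le (w_gt0 X) _ ht.
by rewrite sub0r normcN; apply: lerXn2r; rewrite ?nnegrE ?normc_ge0 ?mulr_ge0.
Qed.

Definition good (M : R) N F G a t :=
  normc (eN X N F a t) <= M * (rho t)^-1 ^+ N /\
  wgt t * normc (fN X N F G a t) <= M * (rho t)^-1 ^+ N.

(* F_n is the solution which agrees with x^r e^(-S) to first order at t = n. *)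
Definition approx_sol (Fn Gn : nat -> C -> V -> C) := forall n : nat,
  [/\ forall t a, sol a (Fn n ^~ a) (Gn n ^~ a) t,
      forall t, ent (Fn n t) /\ ent (Gn n t),
      forall a, nv X (Fn n ^~ a) a (n%:R : R)%:C = 1 &
      forall a, ng X (Fn n ^~ a) (Gn n ^~ a) a (n%:R : R)%:C = 0].

Lemma approx_sol_exists : exists Fn Gn, approx_sol Fn Gn.
Proof.
have H (n : nat) : exists FG : (C -> V -> C) * (C -> V -> C),
  [/\ forall t a, sol a (FG.1 ^~ a) (FG.2 ^~ a) t,
      forall t, ent (FG.1 t) /\ ent (FG.2 t),
      forall a, nv X (FG.1 ^~ a) a (n%:R : R)%:C = 1 &
      forall a, ng X (FG.1 ^~ a) (FG.2 ^~ a) a (n%:R : R)%:C = 0].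
  set T : C := (n%:R : R)%:C.
  (* The data F = x^r e^(-S) and F' = - [lq] F at T are those for which v = 1 and v' = 0. *)
  have hbe : ent (fun a => - lq T a * iEi T a).
    apply: entM (ent_iEi T); apply: ent_ext (entZ (-1) (ent_lq T)) => a.
    by rewrite mulN1r.
  have [F [G [h1 h2 h3 h4 h5]]] := ode_solution T (ent_iEi T) hbe.
  exists (F, G); split => //=.
  - by move=> a; rewrite /nv /= h3 mulrC iEiE.
  - move=> a; rewrite /ng /= h3 h4 -/(lq T a) -[RHS](mulr0 (Ei X T a)).
    by congr (_ * _); ring.
have [FG hFG] := choice H.
by exists (fun n => (FG n).1), (fun n => (FG n).2).
Qed.

Lemma rho_nat (n : nat) : (rho ((n%:R : R)%:C : C))^-1 = qn n.
Proof. by []. Qed.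

(** F_k and F_n, n <= k, are compared at t = n, where both miss the truncation of order 1 by
    O(e^(-n/2)): F_n by its initial data, F_k by transport back from k. The difference is then
    carried back to a fixed n0 along the real axis, and to 0 by [ode_growth]. *)
Lemma approx_cauchy Fn Gn A : approx_sol Fn Gn ->
  exists (n0 : nat) (B : R), forall a, bnd A a -> forall n k, (n0 <= n)%N -> (n <= k)%N ->
    normc (Fn k 0 a - Fn n 0 a) <= B * qn n /\ normc (Gn k 0 a - Gn n 0 a) <= B * qn n.
Proof.
move=> hF; have [r0 [M [M0 r01 H]]] := real_axis_growth X A 1.
have [C0 [C00 hC0]] := initial_energy 1 A.
have [n0 hn0] := expR_nat_ge r0.
pose T : C := (n0%:R : R)%:C.
have [B1 hB1] := ent_bounded (ent_iEi T) A; have [B2 hB2] := ent_bounded (ent_lq T) A.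
have [Kc [Kc0 hKc]] := ode_growth m A T (- T).
pose w := wgt T ^+ 2; have w0 : 0 < w by rewrite exprn_gt0 // wgt_gt0.
pose C1 := M * (2 * (M * (C0 + 1)) + 2 * C0).
have C10 : 0 <= C1 by rewrite !(mulr_ge0, addr_ge0).
pose C2 := Kc * (B1 ^+ 2 * C1 + (2 * (B1 ^+ 2 * (C1 / w)) + 2 * (B2 ^+ 2 * (B1 ^+ 2 * C1)))).
have C20 : 0 <= C2.
  have u1 : 0 <= C1 / w by rewrite divr_ge0 // ltW.
  have u2 := sqr_ge0 B1; have u3 := sqr_ge0 B2.
  apply: mulr_ge0 => //; apply: addr_ge0; first exact: mulr_ge0.
  by apply: addr_ge0; apply: mulr_ge0 => //; apply: mulr_ge0 => //; apply: mulr_ge0.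
exists n0, (C2 + 1) => a ha n k n0n nk.
have [s1 _ v1 g1] := hF n; have [s2 _ v2 g2] := hF k.
have rn j : (n0 <= j)%N -> r0 <= rho ((j%:R : R)%:C : C).
  by move=> h; apply: le_trans hn0 _; rewrite ler_expR ler_pM2r // ler_nat.
have E1 j : (n0 <= j)%N -> energy m 2 (eN X 1 (Fn j ^~ a) a) (fN X 1 (Fn j ^~ a) (Gn j ^~ a) a)
    (j%:R : R)%:C <= C0 * qn j ^+ 2.
  move=> h; have [s _ v g] := hF j; apply: hC0 => //.
  exact: le_trans r01 (rn j h).
have E2 : energy m 2 (eN X 1 (Fn k ^~ a) a) (fN X 1 (Fn k ^~ a) (Gn k ^~ a) a)
    (n%:R : R)%:C <= M * (C0 + 1) * qn n ^+ 2.
  have nk' : (n%:R : R) <= k%:R by rewrite ler_nat.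
  have [/(_ _ _ (s2 ^~ a)) h _] := H a _ _ ha nk' (rn n n0n).
  apply: le_trans h _; rewrite -mulrA; apply: ler_wpM2l => //.
  rewrite mulrDl mul1r expr1; apply: lerD; last by [].
  apply: le_trans (E1 k (leq_trans n0n nk)) _; apply: ler_wpM2l => //.
  by apply: lerXn2r; rewrite ?nnegrE ?qn_le // ltW // qn_gt0.
pose e t := nv X (Fn k ^~ a) a t - nv X (Fn n ^~ a) a t.
pose f t := ng X (Fn k ^~ a) (Gn k ^~ a) a t - ng X (Fn n ^~ a) (Gn n ^~ a) a t.
have E3 : energy m 2 e f (n%:R : R)%:C <= (2 * (M * (C0 + 1)) + 2 * C0) * qn n ^+ 2.
  have -> : e = (fun t => eN X 1 (Fn k ^~ a) a t - eN X 1 (Fn n ^~ a) a t).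
    by apply/funext => t; rewrite /e /eN; ring.
  have -> : f = (fun t => fN X 1 (Fn k ^~ a) (Gn k ^~ a) a t - fN X 1 (Fn n ^~ a) (Gn n ^~ a) a t).
    by apply/funext => t; rewrite /f /fN; ring.
  apply: le_trans (energy_le _ _ _ _ _ (ler0n R 2)) _.
  have := E1 n n0n; move: E2; clear; lra.
have E4 : energy m 2 e f T <= C1 * qn n ^+ 2.
  have n0n' : (n0%:R : R) <= n%:R by rewrite ler_nat.
  have [_ /(_ _ _ _ _ (s2 ^~ a) (s1 ^~ a)) h] := H a _ _ ha n0n' (rn n0 (leqnn _)).
  apply: le_trans h _; rewrite /C1 -mulrA; exact: ler_wpM2l.
pose q2 := qn n ^+ 2; have q20 : 0 <= q2 by exact: sqr_ge0.
rewrite -/q2 in E4.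
have he : normc (e T) ^+ 2 <= C1 * q2.
  apply: le_trans E4; rewrite /energy lerDl mulr_ge0 ?sqr_ge0 //.
  exact: weight_ge0.
have hf : normc (f T) ^+ 2 <= C1 / w * q2.
  rewrite mulrAC ler_pdivlMr //; apply: le_trans E4; rewrite /energy weightE -/w.
  apply: (@le_trans _ _ (2 * w * normc (f T) ^+ 2)).
    rewrite mulrC; apply: ler_wpM2r; first exact: sqr_ge0.
    by move: w0; clear; lra.
  by rewrite lerDr sqr_ge0.
pose dF t := Fn k t a - Fn n t a; pose dG t := Gn k t a - Gn n t a.
(* The passage from (F, F') to (v, v') is inverted at the fixed point T, at a cost bounded on
   polydiscs. *)
have EF : dF T = iEi T a * e T.
  by rewrite /e /nv -mulrBr mulrA iEiE mul1r.
have EG : dG T = iEi T a * f T - lq T a * dF T.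
  have -> : f T = Ei X T a * (dG T + lq T a * dF T).
    by rewrite /f /ng /dF /dG -!/(lq T a); ring.
  by rewrite mulrA iEiE mul1r addrK.
have sq x y : 0 <= x -> x <= y -> x ^+ 2 <= y ^+ 2 :> R.
  by move=> x0 xy; apply: lerXn2r; rewrite ?nnegrE // (le_trans x0 xy).
have nF : normc (dF T) ^+ 2 <= B1 ^+ 2 * C1 * q2.
  rewrite EF normcM exprMn -mulrA; apply: ler_pM; rewrite ?sqr_ge0 //.
  by apply: sq; rewrite ?normc_ge0 ?hB1.
have nG : normc (dG T) ^+ 2 <= (2 * (B1 ^+ 2 * (C1 / w)) + 2 * (B2 ^+ 2 * (B1 ^+ 2 * C1))) * q2.
  have h1 : normc (iEi T a * f T) ^+ 2 <= B1 ^+ 2 * (C1 / w) * q2.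
    rewrite normcM exprMn -mulrA; apply: ler_pM; rewrite ?sqr_ge0 //.
    by apply: sq; rewrite ?normc_ge0 ?hB1.
  have h2 : normc (lq T a * dF T) ^+ 2 <= B2 ^+ 2 * (B1 ^+ 2 * C1) * q2.
    rewrite normcM exprMn -mulrA; apply: ler_pM; rewrite ?sqr_ge0 //.
    by apply: sq; rewrite ?normc_ge0 ?hB2.
  have h3 : normc (dG T) ^+ 2 <= (normc (iEi T a * f T) + normc (lq T a * dF T)) ^+ 2.
    by apply: sq; rewrite ?normc_ge0 // EG normcB.
  apply: le_trans h3 _; move: h1 h2; clear.
  move: (normc _) (normc _) => x y; have := sqr_ge0 (x - y); lra.
have s3 : forall t, sol a dF dG t by move=> t; exact: sol_sub (s2 t a) (s1 t a).
have := hKc a dF dG ha (fun s _ => s3 _); rewrite subrr => h.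
have {h}h : normc (dF 0) ^+ 2 + normc (dG 0) ^+ 2 <= (C2 + 1) ^+ 2 * q2.
  apply: le_trans h _; apply: (@le_trans _ _ (C2 * q2)).
    by rewrite /C2 -mulrA; apply: ler_wpM2l => //; rewrite mulrDl; exact: lerD.
  apply: ler_wpM2r => //; move: C20; clear; move: C2 => x x0.
  have := sqr_ge0 x; lra.
have qB : 0 <= (C2 + 1) * qn n by rewrite mulr_ge0 ?addr_ge0 // ltW // qn_gt0.
rewrite -exprMn in h.
split; rewrite -(@ler_sqr R) ?nnegrE ?normc_ge0 //; apply: le_trans h.
  by rewrite lerDl sqr_ge0.
by rewrite lerDr sqr_ge0.
Qed.
End Construction.

(** * Bounds in the sector *)

Section MainSolution.
Variables (R : realType) (m : nat) (X : wkb_data R m).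
Local Notation C := R[i].
Local Notation V := 'rV[C]_m.
Implicit Types (t d : C) (a : V).
Local Notation pva a p t := (pv (wh X a) (yv t) p).

Lemma real_axis_solution : exists F G : C -> V -> C,
  [/\ forall t a, sol a (F ^~ a) (G ^~ a) t, forall t, ent (F t) &
   forall A N, exists x0 M : R, 0 <= M /\ forall a (x : R), bnd A a -> x0 <= x ->
     good X M N (F ^~ a) (G ^~ a) a x%:C].
Proof.
have [Fn [Gn hF]] := @approx_sol_exists R m X.
have [al [hal limF]] : exists l : V -> C, ent l /\ forall a (e : R), 0 < e ->
    exists n1, forall n, (n1 <= n)%N -> normc (Fn n 0 a - l a) <= e.
  apply: unif_cauchy_lim => [n|A]; first by have [_ /(_ 0)[]] := hF n.
  have [n0 [B hB]] := approx_cauchy A hF; exists n0, B => a ha n k h1 h2.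
  by have [] := hB a ha n k h1 h2.
have [be [hbe limG]] : exists l : V -> C, ent l /\ forall a (e : R), 0 < e ->
    exists n1, forall n, (n1 <= n)%N -> normc (Gn n 0 a - l a) <= e.
  apply: unif_cauchy_lim => [n|A]; first by have [_ /(_ 0)[]] := hF n.
  have [n0 [B hB]] := approx_cauchy A hF; exists n0, B => a ha n k h1 h2.
  by have [] := hB a ha n k h1 h2.
have [F [G [hFd hGd hF0 hG0 hent]]] := ode_solution 0 hal hbe.
have hs t a : sol a (F ^~ a) (G ^~ a) t by split; [exact: hFd|exact: hGd].
exists F, G; split=> //; first by move=> t; have [] := hent t.
(* Convergence of the Cauchy data at 0 propagates to every t by [ode_growth]. *)
have lim t a (e : R) : 0 < e -> exists n1, forall n, (n1 <= n)%N ->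
    normc (Fn n t a - F t a) <= e /\ normc (Gn n t a - G t a) <= e.
  move=> e0; have [A hA] := bnd_exists a.
  have [Kc [Kc0 hKc]] := ode_growth m A 0 t.
  have d0 : 0 < e / (2 * Kc + 1) by rewrite divr_gt0 // ltr_wpDl // mulr_ge0.
  have [n1 h1] := limF a _ d0; have [n2 h2] := limG a _ d0.
  exists (maxn n1 n2) => n; rewrite geq_max => /andP[/h1 {}h1 /h2 {}h2].
  have [sn _ _ _] := hF n.
  have := hKc a _ _ hA (fun s _ => sol_sub (sn _ a) (hs _ a)).
  rewrite add0r hF0 hG0 => h.
  have q0 : 0 <= e / (2 * Kc + 1) by exact: ltW.
  have sq (x : R) : 0 <= x -> x <= e / (2 * Kc + 1) -> x ^+ 2 <= (e / (2 * Kc + 1)) ^+ 2.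
    by move=> x0 xe; apply: lerXn2r; rewrite ?nnegrE.
  have {}h : normc (Fn n t a - F t a) ^+ 2 + normc (Gn n t a - G t a) ^+ 2 <= e ^+ 2.
    apply: le_trans h _.
    apply: (@le_trans _ _ (Kc * (2 * (e / (2 * Kc + 1)) ^+ 2))).
      apply: ler_wpM2l => //; have := sq _ (normc_ge0 _) h1.
      by have := sq _ (normc_ge0 _) h2; clear; lra.
    have -> : Kc * (2 * (e / (2 * Kc + 1)) ^+ 2) = e ^+ 2 * (2 * Kc / (2 * Kc + 1) ^+ 2).
      by field; apply/eqP; move: Kc0; clear; lra.
    rewrite -[leRHS]mulr1; apply: ler_wpM2l; first exact: sqr_ge0.
    rewrite ler_pdivrMr ?mul1r; last by rewrite exprn_gt0 // ltr_wpDl // mulr_ge0.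
    by have := sqr_ge0 Kc; move: Kc0; clear; lra.
  split; rewrite -(@ler_sqr R) ?nnegrE ?normc_ge0 ?(ltW e0) //; apply: le_trans h.
    by rewrite lerDl sqr_ge0.
  by rewrite lerDr sqr_ge0.
move=> A N; have [r0 [M [M0 r01 H]]] := real_axis_growth X A N.
have [C0 [C00 hC0]] := initial_energy X N A.
have [k hk] := expR_nat_ge r0.
pose B := (2 * M + 1) * (1 + 2^-1).
exists k%:R, B; split; first by rewrite mulr_ge0 ?addr_ge0 ?mulr_ge0 // invr_ge0.
move=> a x ha hx; set t := x%:C; set q := (rho t)^-1 ^+ N.
have q0 : 0 < q by rewrite exprn_gt0 // invr_gt0 rho_gt0.
have rx : r0 <= rho t by apply: le_trans hk _; rewrite ler_expR ler_pM2r.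
(* At the given x, n is taken so large that the initial error of F_n falls below rho^(-2N). The
   index depends on x and N, but the limit F does not. *)
have [n1 hn1] := qn_small C0 (exprn_gt0 2 q0).
have [n2 hn2] := nat_ge x.
have approx n : (maxn n1 n2 <= n)%N ->
    normc (eN X N (Fn n ^~ a) a t) <= (2 * M + 1) * q /\
    wgt m t * normc (fN X N (Fn n ^~ a) (Gn n ^~ a) a t) <= B * q.
  rewrite geq_max => /andP[nn1 nn2]; have [sn _ v1 g1] := hF n.
  have xn : x <= n%:R by apply: le_trans hn2 _; rewrite ler_nat.
  have rn : 1 <= rho ((n%:R : R)%:C : C).
    by apply: le_trans r01 (le_trans rx _); rewrite ler_expR ler_pM2r.
  have [/(_ _ _ (sn ^~ a)) h _] := H a _ _ ha xn rx.
  have h2 : energy m 2 (eN X N (Fn n ^~ a) a) (fN X N (Fn n ^~ a) (Gn n ^~ a) a) t <=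
     ((2 * M + 1) * q) ^+ 2.
    apply: le_trans h _; rewrite -[(expR (x / 2))^-1 ^+ N]/q.
    apply: (@le_trans _ _ (M * (2 * q ^+ 2))).
      apply: ler_wpM2l => //; rewrite mulr_natl mulr2n lerD2r.
      apply: le_trans (hC0 a _ _ _ ha rn (v1 a) (g1 a)) _; rewrite rho_nat.
      apply: le_trans (hn1 n nn1); apply: ler_wpM2l => //.
      rewrite expr2 -[leRHS]mulr1; apply: ler_wpM2l; first exact: ltW (qn_gt0 _ _).
      by rewrite -rho_nat invf_le1 // rho_gt0.
    rewrite mulrA [leRHS]exprMn; apply: ler_wpM2r; first exact: sqr_ge0.
    by have := sqr_ge0 M; move: M0; clear; lra.
  have [||h3 h4] := energy_good _ _ h2; [by []|by rewrite mulr_ge0 ?addr_ge0 ?mulr_ge0 // ltW|].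
  by split=> //; apply: le_trans h4 _; rewrite /B; apply: ler_eq; ring.
have Ei0 := normc_ge0 (Ei X t a); have lq0 := normc_ge0 (lq X t a).
have w0 := ltW (wgt_gt0 m t).
split.
  apply: (@le_of_eps R _ _ (normc (Ei X t a))) => // e e0.
  have [n3 hn3] := lim t a e e0.
  pose n := maxn (maxn n1 n2) n3.
  have [h1 _] := approx n (leq_maxl _ _); have [h2 _] := hn3 n (leq_maxr _ _).
  have -> : eN X N (F ^~ a) a t = eN X N (Fn n ^~ a) a t - Ei X t a * (Fn n t a - F t a).
    by rewrite /eN /nv; ring.
  apply: le_trans (normcB _ _) _; apply: lerD; last by rewrite normcM; exact: ler_wpM2l.
  apply: le_trans h1 _; apply: ler_wpM2r; first exact: ltW.
  by rewrite /B; move: M0; clear; lra.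
apply: (@le_of_eps R _ _ (wgt m t * (normc (Ei X t a) * (1 + normc (lq X t a))))) => [|e e0].
  by rewrite !mulr_ge0 // addr_ge0.
have [n3 hn3] := lim t a e e0.
pose n := maxn (maxn n1 n2) n3.
have [_ h1] := approx n (leq_maxl _ _); have [h2 h3] := hn3 n (leq_maxr _ _).
have -> : fN X N (F ^~ a) (G ^~ a) a t = fN X N (Fn n ^~ a) (Gn n ^~ a) a t
  - Ei X t a * ((Gn n t a - G t a) + lq X t a * (Fn n t a - F t a)).
  by rewrite /fN /ng -/(lq X t a); ring.
apply: le_trans (ler_wpM2l w0 (normcB _ _)) _; rewrite mulrDr; apply: lerD => //.
rewrite -mulrA; apply: ler_wpM2l => //; rewrite normcM -mulrA; apply: ler_wpM2l => //.
apply: le_trans (normcD _ _) _; rewrite normcM mulrDl mul1r; apply: lerD => //.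
exact: ler_wpM2l.
Qed.

Lemma cos_le_opp (z b : R) : 0 <= b <= pi -> `|z - pi| <= b -> cos z <= - cos b.
Proof.
move=> /andP[b0 bpi] zb.
have -> : z = (z - pi) + pi by rewrite subrK.
rewrite cosDpi lerN2 -[cos (z - pi)]cos_norm.
rewrite leNgt; apply/negP; rewrite ltr_cos ?in_itv /=; last 2 first.
- by rewrite b0.
- by rewrite normr_ge0 (le_trans zb).
by rewrite ltNge zb.
Qed.

Definition goodN M N (F G : C -> V -> C) a t := good X M N (F ^~ a) (G ^~ a) a t.

(* Transport along the logarithmic spirals t0 + s exp(i sgn eta): the condition on
   phi + eta says that |exp(-S)| increases along them, phi being |arg x^(m/2)|. *)
Lemma spiral F G (sgn ph0 ph1 eta b A : R) N :
  (forall t a, sol a (F ^~ a) (G ^~ a) t) ->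
  sgn = 1 \/ sgn = -1 -> ph0 <= ph1 -> 0 < sin eta -> 0 <= b -> b < pi / 2 ->
  (forall ph : R, ph0 <= ph <= ph1 -> `|ph + eta - pi| <= b) ->
  (exists x0 M : R, 0 <= M /\ forall a (x : R), bnd A a -> x0 <= x ->
    goodN M N F G a (x +i* (sgn * (2 * ph0 / m%:R)))) ->
  exists x0 M : R, 0 <= M /\ forall a (x ph : R), bnd A a -> x0 <= x -> ph0 <= ph <= ph1 ->
    goodN M N F G a (x +i* (sgn * (2 * ph / m%:R))).
Proof.
move=> hs hsgn ph01 sineta b0 bpi hph [x0 [M [M0 hM]]].
have m0 : 0 < m%:R :> R by rewrite ltr0n (w_gt0 X).
have pi0 := pi_gt0 R.
have c0 : 0 < cos b by apply: cos_gt0_pihalf; apply/andP; split=> //; lra.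
have [r0 [M' [M'0 r01 H]]] := wkb_growth X A N c0.
pose Lm := 2 * (ph1 - ph0) / m%:R / sin eta.
have Lm0 : 0 <= Lm.
  by rewrite divr_ge0 ?(ltW sineta) // divr_ge0 ?(ltW m0) // mulr_ge0 // subr_ge0.
(* Along the spiral Re t is at least x - Lm, so 1 / rho exceeds its final value by a factor of at
   most e^(Lm/2). *)
pose kap := expR (Lm / 2) ^+ N; have kap0 : 0 < kap by rewrite exprn_gt0 // expR_gt0.
pose K := 2 / cos b; have K0 : 0 < K by rewrite divr_gt0.
pose Q := expR (M' * Lm) * ((1 + K) * M ^+ 2 + 1) * kap ^+ 2.
have Q0 : 0 <= Q.
  apply: mulr_ge0; last exact: sqr_ge0.
  apply: mulr_ge0; first exact: expR_ge0.
  by apply: addr_ge0 => //; apply: mulr_ge0; [lra|exact: sqr_ge0].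
(* The shift by Lm keeps the whole spiral in the region where the hypothesis and the growth estimate
   hold; Re t >= 2 r0 gives rho >= r0. *)
exists (Num.max x0 (2 * r0) + Lm), ((Q + 1) * (1 + K^-1)); split.
  by rewrite mulr_ge0 ?addr_ge0 // invr_ge0 ltW.
move=> a x ph ha hx /andP[hp0 hp1].
pose Lg := 2 * (ph - ph0) / m%:R / sin eta.
have Lg0 : 0 <= Lg.
  by rewrite divr_ge0 ?(ltW sineta) // divr_ge0 ?(ltW m0) // mulr_ge0 // subr_ge0.
have LgLm : Lg <= Lm.
  by rewrite /Lg /Lm !ler_pM2r ?invr_gt0 // ler_pM2l // lerD2r.
pose d : C := cos eta +i* (sgn * sin eta).
pose t0 : C := (x - Lg * cos eta) +i* (sgn * (2 * ph0 / m%:R)).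
have sgn2 : sgn ^+ 2 = 1 by case: hsgn => ->; rewrite ?sqrrN expr1n.
have d1 : normc d <= 1.
  rewrite -(@ler_sqr R) ?nnegrE ?normc_ge0 ?ler01 // normc_sq expr1n.
  by rewrite [complex.Re d]/= [complex.Im d]/= exprMn sgn2 mul1r cos2Dsin2.
have coseta : `|cos eta| <= 1 by rewrite ler_norml cos_geN1 cos_le1.
pose php (s : R) := ph0 + m%:R / 2 * (s * sin eta).
have ptE (s : R) : t0 + s%:C * d =
    (x - (Lg - s) * cos eta) +i* (sgn * (2 * php s / m%:R)).
  apply/eqP; rewrite eq_complex ReD ImD ReZ.
  have -> : complex.Im (s%:C * d) = s * (sgn * sin eta) by rewrite /= mul0r addr0.
  apply/andP; split; apply/eqP; rewrite /=; first by ring.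
  by rewrite /php; field; rewrite gt_eqF.
have phL : php Lg = ph.
  by rewrite /php /Lg; field; rewrite !gt_eqF.
have phs (s : R) : 0 <= s <= Lg -> ph0 <= php s <= ph1.
  move=> /andP[s0 s1]; apply/andP; split.
    by rewrite lerDl !mulr_ge0 // ?invr_ge0 ?ltW.
  apply: le_trans hp1; rewrite -phL lerD2l; apply: ler_wpM2l.
    by rewrite divr_ge0 // ltW.
  by rewrite ler_pM2r.
have Reb (s : R) : 0 <= s <= Lg -> x - Lm <= complex.Re (t0 + s%:C * d).
  move=> /andP[s0 s1]; rewrite ptE [complex.Re _]/=.
  have : (Lg - s) * cos eta <= (Lg - s) * 1.
    by apply: ler_wpM2l; [lra|rewrite (le_trans (ler_norm _))].
  by move: LgLm s0; clear; lra.
have hx' : x0 <= x - Lm /\ 2 * r0 <= x - Lm.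
  have hm1 : x0 <= Num.max x0 (2 * r0) by rewrite le_max lexx.
  have hm2 : 2 * r0 <= Num.max x0 (2 * r0) by rewrite le_max lexx orbT.
  by move: hx hm1 hm2; clear; lra.
have rhob (s : R) : 0 <= s <= Lg -> r0 <= rho (t0 + s%:C * d).
  move=> /Reb h; rewrite /rho.
  have := expR_ge1Dx (complex.Re (t0 + s%:C * d) / 2).
  by case: hx' => _; move: h; clear; lra.
have key (s : R) : 0 <= s <= Lg -> let t := t0 + s%:C * d in
    [/\ r0 <= rho t, complex.Re (LL m t * d) <= - cos b * rho t ^+ m,
      is_derive s (1 : R) (fun u : R => u) 1 & (rho t)^-1 <= 1].
  move=> hsL t; split.
  - exact: rhob.
  - rewrite LL_polar -mulrA ReZ mulrC; apply: ler_wpM2r.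
      by rewrite exprn_ge0 // ltW // rho_gt0.
    have -> : m%:R / 2 * complex.Im t = sgn * php s.
      by rewrite /t ptE /=; field; rewrite gt_eqF.
    have -> : complex.Re ((cos (sgn * php s) +i* sin (sgn * php s)) * d) = cos (php s + eta).
      rewrite /= cosD; case: hsgn => ->; rewrite ?mul1r // ?mulN1r cosN sinN.
      by ring.
    apply: cos_le_opp; first by rewrite b0 /=; lra.
    exact: hph (phs s hsL).
  - exact: is_derive_id.
  - by rewrite invf_le1 ?rho_gt0 // (le_trans r01) // rhob.
(* The length of the path is bounded by Lm, so 1 / rho <= 1 suffices as a rate. *)
have [H1 _] := H a t0 d Lg (fun u => u) (fun=> 1) ha Lg0 d1 key.
pose q := (rho (x +i* (sgn * (2 * ph / m%:R)) : C))^-1 ^+ N.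
have q0 : 0 < q by rewrite exprn_gt0 // invr_gt0 rho_gt0.
have hq (s : R) : 0 <= s <= Lg -> (rho (t0 + s%:C * d))^-1 ^+ N <= kap * q.
  move=> /Reb h; rewrite /kap /q -exprMn; apply: lerXn2r.
  - by rewrite nnegrE invr_ge0 ltW // rho_gt0.
  - by rewrite nnegrE mulr_ge0 ?expR_ge0 // invr_ge0 ltW // rho_gt0.
  rewrite /rho -!expRN -expRD ler_expR [complex.Re (x +i* _)]/=.
  by move: h; clear; lra.
have h2 := H1 (F ^~ a) (G ^~ a) (kap * q) (ltW (mulr_gt0 kap0 q0))
  (fun s hsL => conj (hs _ a) (hq s hsL)).
have tL : t0 + Lg%:C * d = x +i* (sgn * (2 * ph / m%:R)).
  by rewrite ptE phL subrr mul0r subr0.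
rewrite tL in h2.
have t0E : t0 + (0 : R)%:C * d = t0 by rewrite mul0r addr0.
have zin : (0 : R) <= 0 <= Lg by rewrite lexx Lg0.
have [g1 g2] : goodN M N F G a t0.
  apply: hM => //; have := Reb 0 zin; rewrite t0E /= => h.
  by apply: le_trans h; case: hx'.
have hq0 := hq 0 zin; rewrite t0E in hq0.
have Mq : M * (rho t0)^-1 ^+ N <= M * (kap * q) by exact: ler_wpM2l.
have Mk0 : 0 <= M * (kap * q) by rewrite !mulr_ge0 // ltW.
have e0 := good_energy (ltW K0) Mk0 (le_trans g1 Mq) (le_trans g2 Mq).
have h3 : energy m K (eN X N (F ^~ a) a) (fN X N (F ^~ a) (G ^~ a) a)
    (x +i* (sgn * (2 * ph / m%:R))) <= ((Q + 1) * q) ^+ 2.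
  apply: (@le_trans _ _ (Q * q ^+ 2)); last first.
    rewrite exprMn; apply: ler_wpM2r; first exact: sqr_ge0.
    by have := sqr_ge0 Q; move: Q0; clear; lra.
  apply: (@le_trans _ _ (expR (M' * (Lg - 0)) *
    (energy m K (eN X N (F ^~ a) a) (fN X N (F ^~ a) (G ^~ a) a) t0 + (kap * q) ^+ 2))).
    by apply: le_trans h2; rewrite lerDl sqr_ge0.
  have -> : Q * q ^+ 2 = expR (M' * Lm) * ((1 + K) * (M * (kap * q)) ^+ 2 + (kap * q) ^+ 2).
    by rewrite /Q; ring.
  apply: ler_pM; first exact: expR_ge0.
  - apply: addr_ge0; last exact: sqr_ge0.
    apply: addr_ge0; first exact: sqr_ge0.
    by apply: mulr_ge0; [apply: weight_ge0; exact: ltW|exact: sqr_ge0].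
  - by rewrite ler_expR subr0; apply: ler_wpM2l.
  - by rewrite lerD2r.
have Qq : 0 <= (Q + 1) * q by rewrite mulr_ge0 ?addr_ge0 // ltW.
have [e1 e2] := energy_good K0 Qq h3.
have K'0 : 0 < K^-1 by rewrite invr_gt0.
split; last by apply: le_trans e2 _; rewrite mulrAC.
apply: le_trans e1 _; rewrite -/q mulrAC -[leLHS]mulr1; apply: ler_wpM2l => //.
by rewrite lerDl ltW.
Qed.

(** No single angle eta covers 0 <= phi < 3 pi / 2, as phi + eta must stay within b < pi/2 of pi.
    The angle 3 pi / 4 serves for phi <= pi/2; from there on, half the distance from the largest phi
    to 3 pi / 2 is taken as eta, with b = pi/2 - eta. It degenerates exactly as phi tends to 3 pi /
    2. *)
Lemma half_sector F G (sgn th A : R) N :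
  (forall t a, sol a (F ^~ a) (G ^~ a) t) -> sgn = 1 \/ sgn = -1 ->
  (exists x0 M : R, 0 <= M /\ forall a (x : R), bnd A a -> x0 <= x ->
    goodN M N F G a x%:C) ->
  0 <= th -> th < 3 * pi / 2 ->
  exists x0 M : R, 0 <= M /\ forall a (x ph : R), bnd A a -> x0 <= x -> 0 <= ph <= th ->
    goodN M N F G a (x +i* (sgn * (2 * ph / m%:R))).
Proof.
move=> hs hsgn [x0 [M [M0 hM]]] th0 th1; have pi0 := pi_gt0 R.
have h0 : exists x0 M : R, 0 <= M /\ forall a (x : R), bnd A a -> x0 <= x ->
    goodN M N F G a (x +i* (sgn * (2 * 0 / m%:R))).
  by exists x0, M; split=> // a x ha hx; rewrite mulr0 mul0r mulr0; exact: hM.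
have [|||||x1 [M1 [M10 h1]]] := @spiral F G sgn 0 (pi / 2) (3 * pi / 4) (pi / 4) A N hs hsgn
  _ _ _ _ _ h0.
- by lra.
- by apply: sin_gt0_pi; apply/andP; split; lra.
- by lra.
- by lra.
- by move=> ph /andP[p0 p1]; rewrite ler_norml; apply/andP; split; lra.
pose ph1 := Num.max th (pi / 2).
have ph1l : ph1 < 3 * pi / 2 by rewrite gt_max th1 /=; lra.
have ph1g : pi / 2 <= ph1 by rewrite le_max lexx orbT.
have ph1t : th <= ph1 by rewrite le_max lexx.
pose eta := (3 * pi / 2 - ph1) / 2.
have eta0 : 0 < eta by rewrite /eta; lra.
have eta1 : eta <= pi / 2 by rewrite /eta; lra.
have ph1E : ph1 = 3 * pi / 2 - 2 * eta by rewrite /eta; lra.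
have h2 : exists x0 M : R, 0 <= M /\ forall a (x : R), bnd A a -> x0 <= x ->
    goodN M N F G a (x +i* (sgn * (2 * (pi / 2) / m%:R))).
  exists x1, M1; split=> // a x ha hx; apply: h1 => //.
  by apply/andP; split; lra.
have [|||||x2 [M2 [M20 h3]]] := @spiral F G sgn (pi / 2) ph1 eta (pi / 2 - eta) A N hs hsgn
  _ _ _ _ _ h2.
- by [].
- by apply: sin_gt0_pi; apply/andP; split; lra.
- by lra.
- by lra.
- by move=> ph /andP[p0 p1]; rewrite ler_norml; apply/andP; split; lra.
exists (Num.max x1 x2), (M1 + M2); split; first exact: addr_ge0.
move=> a x ph ha; rewrite ge_max => /andP[hx1 hx2] /andP[p0 p1].
have q0 t : 0 <= (rho t : R)^-1 ^+ N by rewrite exprn_ge0 // invr_ge0 ltW // rho_gt0.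
have [hp|hp] := leP ph (pi / 2).
  have hp' : 0 <= ph <= pi / 2 by rewrite p0.
  have [g1 g2] := h1 a x ph ha hx1 hp'.
  by split; [apply: le_trans g1 _|apply: le_trans g2 _]; apply: ler_wpM2r; rewrite ?lerDl.
have hp' : pi / 2 <= ph <= ph1 by rewrite (ltW hp) (le_trans p1).
have [g1 g2] := h3 a x ph ha hx2 hp'.
by split; [apply: le_trans g1 _|apply: le_trans g2 _]; apply: ler_wpM2r; rewrite ?lerDr.
Qed.

Lemma sector_good F G (al be A : R) N :
  (forall t a, sol a (F ^~ a) (G ^~ a) t) ->
  (exists x0 M : R, 0 <= M /\ forall a (x : R), bnd A a -> x0 <= x ->
    goodN M N F G a x%:C) ->
  - (3 * pi / m%:R) < al -> al <= be -> be < 3 * pi / m%:R ->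
  exists x0 M : R, 0 <= M /\ forall a t, bnd A a -> x0 <= complex.Re t ->
    al <= complex.Im t <= be -> goodN M N F G a t.
Proof.
move=> hs h0 al0 albe be0.
have m0 : 0 < m%:R :> R by rewrite ltr0n (w_gt0 X).
pose th0 := Num.max `|al| `|be|; pose th := m%:R / 2 * th0.
have th00 : 0 <= th0 by rewrite le_max normr_ge0.
have tha : th0 < 3 * pi / m%:R.
  by rewrite gt_max !ltr_norml al0 be0 (le_lt_trans albe be0) (lt_le_trans al0 albe).
have th_ge : 0 <= th by rewrite mulr_ge0 // divr_ge0 // ltW.
have th_lt : th < 3 * pi / 2.
  have -> : 3 * (pi : R) / 2 = m%:R / 2 * (3 * pi / m%:R) by field; rewrite gt_eqF.
  by rewrite ltr_pM2l // divr_gt0.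
have [x1 [M1 [M10 h1]]] := half_sector hs (or_introl (erefl (1 : R))) h0 th_ge th_lt.
have [x2 [M2 [M20 h2]]] := half_sector hs (or_intror (erefl (-1 : R))) h0 th_ge th_lt.
exists (Num.max x1 x2), (M1 + M2); split; first exact: addr_ge0.
move=> a [x y]; rewrite [complex.Re _]/= [complex.Im _]/= ge_max => ha /andP[hx1 hx2] /andP[y0 y1].
have q0 t : 0 <= (rho t : R)^-1 ^+ N by rewrite exprn_ge0 // invr_ge0 ltW // rho_gt0.
have ny : `|y| <= th0.
  rewrite ler_norml; apply/andP; split.
    by apply: le_trans y0; rewrite lerNl le_max -normrN ler_norm.
  by apply: le_trans y1 _; rewrite le_max ler_norm orbT.
have hp : 0 <= m%:R / 2 * `|y| <= th.
  have h : 0 <= m%:R / 2 :> R by rewrite divr_ge0 // ltW.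
  by apply/andP; split; [exact: mulr_ge0|exact: ler_wpM2l].
have E : 2 * (m%:R / 2 * `|y|) / m%:R = `|y| by field; rewrite gt_eqF.
have [yp|yn] := leP 0 y.
  have := h1 a x _ ha hx1 hp; rewrite E mul1r ger0_norm // => -[g1 g2].
  by split; [apply: le_trans g1 _|apply: le_trans g2 _]; apply: ler_wpM2r; rewrite ?lerDl.
have := h2 a x _ ha hx2 hp; rewrite E mulN1r ltr0_norm // opprK => -[g1 g2].
by split; [apply: le_trans g1 _|apply: le_trans g2 _]; apply: ler_wpM2r; rewrite ?lerDr.
Qed.
End MainSolution.

(** * Asymptotic expansions *)

Section Expansions.
Variables (R : realType) (m : nat) (X : wkb_data R m).
Local Notation C := R[i].
Local Notation V := 'rV[C]_m.
Implicit Types (t d : C) (a : V).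
Local Notation pva a p t := (pv (wh X a) (yv t) p).

Lemma compact_bnd (K : set V) : compact K -> exists A, forall a, K a -> bnd A a.
Proof.
move=> cK.
have bi (i : 'I_m) : exists A : R, forall a, K a -> normc (a 0 i) <= A.
  pose f (a : V) : R := normc (a 0 i).
  have cf : continuous f.
    move=> a; apply/(@cvgrPdist_le _ _ _ (nbhs a) (nbhs_filter a)) => e e0.
    have /(@cvgrPdist_le _ _ _ (nbhs a) (nbhs_filter a)) /(_ e%:C) :=
      @coord_continuous _ 1 m 0 i a.
    rewrite ltc_real => /(_ e0); apply: filterS => b.
    rewrite normCE lec_real => h; apply: le_trans h.
    rewrite ler_norml; apply/andP; split.
      have := normcD (a 0 i) (b 0 i - a 0 i); rewrite [a 0 i + _]addrC subrK.
      by rewrite [normc (b 0 i - _)]normcBC /f; lra.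
    by have := normcD (b 0 i) (a 0 i - b 0 i); rewrite [b 0 i + _]addrC subrK /f; lra.
  have [M [_ hM]] := compact_bounded (continuous_compact (continuous_subspaceT cf) cK).
  exists (M + 1) => a Ka; have hlt : M < M + 1 by rewrite ltrDl.
  exact: le_trans (ler_norm _) (hM _ hlt (f a) (ex_intro2 _ _ a Ka erefl)).
have [A hA] := choice bi.
exists (\sum_i `|A i|) => a Ka i; apply: le_trans (hA i a Ka) _.
apply: le_trans (ler_norm _) _; rewrite (bigD1 i) //= lerDl.
exact: sumr_ge0.
Qed.

(** [small_at_infinity] with polydiscs for compact sets and Re t = ln |x| for |x|. *)
Definition vanishing (f : C -> V -> C) := forall al be A : R,
  - (3 * pi / m%:R) < al -> al <= be -> be < 3 * pi / m%:R ->
  forall eps : R, 0 < eps -> exists x0 : R, forall a t, bnd A a ->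
    x0 <= complex.Re t -> al <= complex.Im t <= be -> normc (f t a) <= eps.

Lemma vanishing_small f : vanishing f -> small_at_infinity f.
Proof.
move=> hf al be K h1 h2 h3 /compact_bnd[A hA] eps e0.
have [x0 hx] := hf al be A h1 h2 h3 eps e0; exists (expR x0) => t a ht hM Ka.
rewrite normCE lec_real; apply: hx => //; first exact: hA.
by rewrite -ler_expR.
Qed.

Lemma rho_large (B e : R) : 0 < e -> exists x0 : R, forall t, x0 <= complex.Re t ->
  1 <= rho t /\ B / rho t <= e.
Proof.
move=> e0; exists (2 * (`|B| / e)) => t ht.
have h := expR_ge1Dx (complex.Re t / 2); rewrite -/(rho t) in h.
have b0 : 0 <= `|B| / e by rewrite divr_ge0 // ltW.
have r1 : 1 <= rho t by move: h ht b0; clear; lra.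
split=> //; rewrite ler_pdivrMr ?rho_gt0 // mulrC -ler_pdivrMr //.
apply: le_trans (_ : `|B| / e <= _); last by move: h ht; clear; lra.
by rewrite ler_pM2r ?invr_gt0 // ler_norm.
Qed.

Lemma vanishing_of_bound (f : C -> V -> C) N :
  (forall (al be A : R), - (3 * pi / m%:R) < al -> al <= be -> be < 3 * pi / m%:R ->
    exists x0 M : R, forall a t, bnd A a -> x0 <= complex.Re t ->
      al <= complex.Im t <= be -> normc (f t a) <= M * (rho t)^-1 ^+ N.+1) ->
  vanishing (fun t a => powx (N%:R / 2) t * f t a).
Proof.
move=> hf al be A h1 h2 h3 eps e0.
have [x0 [M hM]] := hf al be A h1 h2 h3; have [x1 hx1] := rho_large M e0.
exists (Num.max x0 x1) => a t ha; rewrite ge_max => /andP[hx0 /hx1[r1 hr]] ht.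
have -> : powx (N%:R / 2) t = LL N t by [].
have r0 := rho_gt0 t; rewrite normcM normc_LL.
apply: le_trans hr; apply: le_trans (ler_wpM2l _ (hM a t ha hx0 ht)) _.
  by rewrite exprn_ge0 // ltW.
by rewrite exprVn exprS; apply: ler_eq; field; rewrite gt_eqF // expf_neq0 // gt_eqF.
Qed.

(** The energy controls v' only up to the factor rho^((1-m)/2); the derivative in x comes with y^m,
    of size rho^(-m), which makes up for this loss. *)
Lemma wgt_inv_le t : 1 <= rho t -> (rho t)^-1 ^+ m <= wgt m t.
Proof.
move=> r1; have h : 0 <= complex.Re t / 2 by rewrite -ler_expR expR0.
have m1 : 1 <= m%:R :> R by rewrite ler1n (w_gt0 X).
rewrite /rho /wgt -expRN -expRM_natl ler_expR.
have : 0 <= (m%:R + 1) / 4 * complex.Re t by apply: mulr_ge0; lra.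
lra.
Qed.

Section Solution.
Variables F G : C -> V -> C.
Hypothesis hgood : forall N (al be A : R),
  - (3 * pi / m%:R) < al -> al <= be -> be < 3 * pi / m%:R ->
  exists x0 M : R, 0 <= M /\ forall a t, bnd A a -> x0 <= complex.Re t ->
    al <= complex.Im t <= be -> goodN X M N F G a t.

Lemma expansion_F N : vanishing (fun t a => powx (N%:R / 2) t *
   (nv X (F ^~ a) a t - \sum_(j < N.+1) wh X a (px X j) * yv t ^+ j)).
Proof.
apply: vanishing_of_bound => al be A h1 h2 h3.
(* The estimate of order N + 1 is what makes the remainder of order N a o(x^(-N/2)) rather than a
   O(x^(-N/2)). *)
have [x0 [M [M0 hM]]] := hgood N.+1 A h1 h2 h3.
have [x1 hx1] := rho_large 0 (@ltr01 R).
have [M2 [M20 hM2]] : exists M, 0 <= M /\ forall a t, bnd A a -> 1 <= rho t ->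
    normc (pva a (Vx X N.+1 - Vx X N) t) <= M * (rho t)^-1 ^+ N.+1.
  apply: pvt_bound => n nN; rewrite coefB /Vx !coef_Vpoly ?subrr //.
  exact: ltnW.
exists (Num.max x0 x1), (M + M2) => a t ha; rewrite ge_max => /andP[hx0 /hx1[r1 _]] ht.
have [g1 _] := hM a t ha hx0 ht.
rewrite -/(px X) -pv_Vpoly -/(Vx X N).
have -> : nv X (F ^~ a) a t - pva a (Vx X N) t =
    eN X N.+1 (F ^~ a) a t + pva a (Vx X N.+1 - Vx X N) t.
  by rewrite pvB /eN; ring.
apply: le_trans (normcD _ _) _; rewrite mulrDl; apply: lerD => //.
exact: hM2.
Qed.

(** [formal_ddx] of the formal solution, read through the abstract data. *)
Definition ddcoef (n : nat) : wA X :=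
  (if (m <= n)%N then (wr X - wi X ((n - m)%:R / 2)) * px X (n - m)%N else 0)
  - \sum_(i < n.+1) bd m (wb X) i * px X (n - i)%N.

Lemma expansion_G N : vanishing (fun t a => powx (N%:R / 2) t *
   (yv t ^+ m * (Ei X t a * G t a) - \sum_(j < N.+1) wh X a (ddcoef j) * yv t ^+ j)).
Proof.
apply: vanishing_of_bound => al be A h1 h2 h3.
have [x0 [M [M0 hM]]] := hgood N.+1 A h1 h2 h3.
have [x1 hx1] := rho_large 0 (@ltr01 R).
pose T : {poly wA X} := \poly_(j < N.+1) ddcoef j.
have [M2 [M20 hM2]] : exists M, 0 <= M /\ forall a t, bnd A a -> 1 <= rho t ->
    normc (pva a (Fx X N.+1 - T) t) <= M * (rho t)^-1 ^+ N.+1.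
  apply: pvt_bound => n nN; rewrite coefB coef_poly nN.
  by rewrite (coef_ddx _ _ _ _ _ (ltnW nN)) subrr.
have [M3 [M30 hM3]] : exists M, 0 <= M /\ forall a t, bnd A a -> 1 <= rho t ->
    normc (pva a (rpoly (wr X) * 'X^m - qx X) t) <= M * (rho t)^-1 ^+ 0.
  by apply: pvt_bound.
exists (Num.max x0 x1), (M + M3 * M + M2) => a t ha.
rewrite ge_max => /andP[hx0 /hx1[r1 _]] ht.
have [g1 g2] := hM a t ha hx0 ht.
have {}hM2 := hM2 a t ha r1; have {}hM3 := hM3 a t ha r1.
rewrite expr0 mulr1 in hM3.
have -> : \sum_(j < N.+1) wh X a (ddcoef j) * yv t ^+ j = pva a T t.
  rewrite /pv (@horner_coef_wide _ N.+1).
    by apply: eq_bigr => j _; rewrite coef_map coef_poly ltn_ord.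
  exact: leq_trans (size_poly _ _) (size_poly _ _).
(* x^(-r) e^S F' = v' + (r - x^(m/2) q) v is multiplied by y^m; then v and v' are replaced by their
   truncations plus errors. *)
have E : yv t ^+ m * (Ei X t a * G t a) = yv t ^+ m * fN X N.+1 (F ^~ a) (G ^~ a) a t
   + pva a (rpoly (wr X) * 'X^m - qx X) t * eN X N.+1 (F ^~ a) a t + pva a (Fx X N.+1) t.
  rewrite /Fx pv_Fpoly pvB pvM pvXn /rpoly pvC.
  rewrite /fN /eN /ng /nv -/(qx X) -/(tx _) -/(Vx X N.+1).
  have hL := LLy m t; have L0 := LL_neq0 m t.
  have -> : yv t ^+ m = (LL m t)^-1 by rewrite -[LHS]mul1r -(mulVf L0) -mulrA hL mulr1.
  by field.
rewrite E -addrA -pvB; apply: le_trans (normcD _ _) _; rewrite mulrDl; apply: lerD => //.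
apply: le_trans (normcD _ _) _; rewrite mulrDl !normcM; apply: lerD; last first.
  by rewrite -mulrA; apply: ler_pM; rewrite ?normc_ge0.
apply: le_trans g2; rewrite normcX normc_yv; apply: ler_wpM2r; first exact: normc_ge0.
exact: wgt_inv_le.
Qed.
End Solution.

Lemma cderV (F : C -> C) t l : F t != 0 -> cder F t l ->
  cder (fun z => (F z)^-1) t (- l / F t ^+ 2).
Proof.
move=> F0 [dF eF]; split; first exact: derivableV.
by rewrite deriveV // eF /GRing.scale /= mulNr mulrC mulNr.
Qed.

Lemma cder_real (F : C -> C) (x : R) l : cder F x%:C l ->
  is_derive x (1 : R) (fun s : R => complex.Re (F s%:C)) (complex.Re l) /\
  is_derive x (1 : R) (fun s : R => complex.Im (F s%:C)) (complex.Im l).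
Proof.
have E (s : R) : (0 : C) + s%:C * 1 = s%:C by rewrite add0r mulr1.
move=> h; have : cder F (0 + x%:C * 1) l by rewrite E.
move=> /cder_line; rewrite mul1r.
by under eq_fun do rewrite E; under [in X in _ /\ X]eq_fun do rewrite E.
Qed.

Lemma derive_growth (f f' : R -> R) (s0 c : R) :
  (forall s, s0 <= s -> is_derive s (1 : R) f (f' s)) -> (forall s, s0 <= s -> c <= f' s) ->
  forall s, s0 <= s -> f s0 + c * (s - s0) <= f s.
Proof.
move=> hf hc s hs.
have H1 x : x \in `]s0, s[ -> is_derive x (1 : R) f (f' x).
  by rewrite in_itv /= => /andP[h _]; apply: hf; exact: ltW.
have H2 : {within `[s0, s], continuous f}.
  apply: derivable_within_continuous => x; rewrite in_itv /= => /andP[h _].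
  by have [] := hf x h.
have [x] := MVT_segment hs H1 H2; rewrite in_itv /= => /andP[h _] e.
have := ler_wpM2r (_ : 0 <= s - s0) (hc x h); rewrite subr_ge0 => /(_ hs).
by move: e; clear; lra.
Qed.

(* If H != 0 somewhere then |H| grows faster than |Dh|, hence J = Re (conj u H) and
   then |u|^2, whose derivative is 2 J, tend to infinity. *)
Lemma bounded_rigidity (u H Dh : C -> C) (x0 : R) :
  (forall x : R, x0 <= x -> [/\ cder u x%:C (H x%:C), cder H x%:C (Dh x%:C * H x%:C),
     rho (x%:C : C) ^+ m <= complex.Re (Dh x%:C), normc (Dh x%:C) <= 3 * rho (x%:C : C) ^+ m
     & [/\ normc (u x%:C) <= 1, m%:R + 1 <= 2 * rho (x%:C : C) ^+ m & 1 <= rho (x%:C : C)]]) ->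
  forall x : R, x0 <= x -> H x%:C = 0.
Proof.
move=> hyp x1 hx1; apply/eqP; apply/negPn/negP => H0.
pose h2 (x : R) := normc (H x%:C) ^+ 2.
have dsq (F : C -> C) (x : R) l : cder F x%:C l ->
    is_derive x (1 : R) (fun s : R => normc (F s%:C) ^+ 2) (2 * complex.Re ((F x%:C)^* * l)).
  move=> hF; have := @cder_line_sq _ F 0 1 l x.
  have E (s : R) : (0 : C) + s%:C * 1 = s%:C by rewrite add0r mulr1.
  rewrite E mul1r => /(_ hF).
  by under eq_fun do rewrite E.
(* As e^(m x) = rho^(2m), k is (|H| / rho^m)^2. It satisfies k' >= k and so grows without bound once
   positive. *)
pose k (x : R) := h2 x * expR (- m%:R * x).
pose k' (x : R) := (2 * complex.Re (Dh x%:C) - m%:R) * k x.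
have dk (x : R) : x1 <= x -> is_derive x (1 : R) k (k' x).
  move=> xx; have [_ hH _ _ _] := hyp x (le_trans hx1 xx).
  have g1 := dsq _ _ _ hH.
  have g2 : is_derive x (1 : R) (fun s : R => - m%:R * s) _ :=
    is_deriveZ (- m%:R) (is_derive_id x (1 : R)).
  have g3 : is_derive x (1 : R) (fun s : R => expR (- m%:R * s)) _ :=
    @is_derive1_comp R expR _ x _ _ (is_derive_expR _) g2.
  have g4 : is_derive x (1 : R) k _ := is_deriveM g1 g3.
  apply: is_derive_eq g4 _; rewrite Re_conjMr /k' /k /h2 /GRing.scale /=; ring.
have k0 (x : R) : 0 <= k x by rewrite mulr_ge0 ?sqr_ge0 // expR_ge0.
have kk' (x : R) : x1 <= x -> k x <= k' x.
  move=> xx; have [_ _ hD _ [_ hm _]] := hyp x (le_trans hx1 xx).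
  rewrite -[leLHS]mul1r; apply: ler_wpM2r => //.
  by move: hD hm; clear; lra.
have k1 : 0 < k x1.
  rewrite mulr_gt0 ?expR_gt0 // exprn_gt0 // lt_neqAle normc_ge0 andbT eq_sym.
  by apply: contra H0 => /eqP/eq0_normc ->.
have kmono (x : R) : x1 <= x -> k x1 <= k x.
  move=> xx; have := derive_growth (c := 0) dk _ xx; rewrite mul0r addr0; apply.
  by move=> s /kk' h; exact: le_trans (k0 s) h.
have kgrow (x : R) : x1 <= x -> k x1 + k x1 * (x - x1) <= k x.
  apply: derive_growth dk _ x => s xs; exact: le_trans (kmono s xs) (kk' s xs).
(* From here on k >= 36, that is |H| >= 6 rho^m, twice the bound on |Dh|; with |u| <= 1 this leaves
   J' >= |H|^2 / 2. *)
pose x2 := x1 + 36 / k x1.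
have x12 : x1 <= x2 by rewrite lerDl divr_ge0 // ltW.
have Hbig (x : R) : x2 <= x -> 6 * rho (x%:C : C) ^+ m <= normc (H x%:C).
  move=> xx; have x1x := le_trans x12 xx.
  have h36 : 36 <= k x.
    apply: le_trans (kgrow x x1x).
    have : 36 / k x1 <= x - x1 by move: xx; rewrite /x2; clear; lra.
    rewrite ler_pdivrMr // [_ * k x1]mulrC; move: k1; clear; lra.
  have E : expR (- m%:R * x) * (rho (x%:C : C) ^+ m) ^+ 2 = 1.
    rewrite -exprM /rho -expRM_natl -expRD -[RHS]expR0; congr expR.
    by rewrite natrM [complex.Re _]/=; field.
  have p0 : 0 <= rho (x%:C : C) ^+ m by rewrite exprn_ge0 // ltW // rho_gt0.
  rewrite -(@ler_sqr R) ?nnegrE ?normc_ge0 ?mulr_ge0 //.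
  have -> : normc (H x%:C) ^+ 2 = k x * (rho (x%:C : C) ^+ m) ^+ 2.
    by rewrite /k /h2 -mulrA E mulr1.
  have -> : (6 * rho (x%:C : C) ^+ m) ^+ 2 = 36 * (rho (x%:C : C) ^+ m) ^+ 2 by ring.
  by apply: ler_wpM2r => //; exact: sqr_ge0.
pose J (x : R) := complex.Re (u x%:C) * complex.Re (H x%:C) + complex.Im (u x%:C) * complex.Im (H x%:C).
pose J' (x : R) := h2 x + complex.Re ((u x%:C)^* * (Dh x%:C * H x%:C)).
have dJ (x : R) : x2 <= x -> is_derive x (1 : R) J (J' x).
  move=> xx; have [hu hH _ _ _] := hyp x (le_trans hx1 (le_trans x12 xx)).
  have [u1 u2] := cder_real hu; have [H1 H2] := cder_real hH.
  have g : is_derive x (1 : R) J _ := is_deriveD (is_deriveM u1 H1) (is_deriveM u2 H2).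
  apply: is_derive_eq g _; rewrite /J' /h2 normc_sq /GRing.scale /=.
  case: (u x%:C) => a b; case: (H x%:C) => c d; case: (Dh x%:C) => e f /=.
  by ring.
have J'b (x : R) : x2 <= x -> 1 <= J' x.
  move=> xx; have [_ _ _ hD [hu _ r1]] := hyp x (le_trans hx1 (le_trans x12 xx)).
  have hb := Hbig x xx; have n0 := normc_ge0 (H x%:C).
  have L1 : 1 <= rho (x%:C : C) ^+ m by exact: exprn_ege1.
  have h1 : - complex.Re ((u x%:C)^* * (Dh x%:C * H x%:C)) <= 1 * (3 * rho (x%:C : C) ^+ m * normc (H x%:C)).
    rewrite -raddfN -mulrN; apply: le_trans (Re_conjM_le _ _) _.
    rewrite normcN normcM; apply: ler_pM; rewrite ?normc_ge0 ?mulr_ge0 ?normc_ge0 //.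
    exact: ler_wpM2r.
  have h3 : 6 * rho (x%:C : C) ^+ m * normc (H x%:C) <= normc (H x%:C) * normc (H x%:C).
    exact: ler_wpM2r.
  have h4 : 6 * 1 <= normc (H x%:C) * normc (H x%:C).
    apply: (@le_trans _ _ (6 * 6)); first by apply: ler_wpM2l; rewrite ?ler0n ?ler1n.
    by apply: ler_pM => //; move: hb L1; clear; lra.
  by rewrite /J' /h2 expr2; move: h1 h3 h4; clear; lra.
pose x3 := x2 + (1 + `|J x2|).
have x23 : x2 <= x3 by rewrite lerDl addr_ge0.
have Jpos (x : R) : x3 <= x -> 1 <= J x.
  move=> xx; have := derive_growth dJ J'b (le_trans x23 xx); rewrite mul1r.
  have : - `|J x2| <= J x2 by have := ler_norm (- J x2); rewrite normrN lerNl.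
  by move: xx; rewrite /x3; clear; lra.
have x03 : x0 <= x3 := le_trans hx1 (le_trans x12 x23).
(* Over a length 2 the square |u|^2 gains at least 2, against |u| <= 1. *)
have h32 : x3 <= x3 + 2 by rewrite lerDl.
have h : normc (u x3%:C) ^+ 2 + 1 * (x3 + 2 - x3) <= normc (u (x3 + 2)%:C) ^+ 2.
  apply: (@derive_growth (fun x : R => normc (u x%:C) ^+ 2) (fun x => 2 * J x)) => //.
  - move=> s xs; have [hu _ _ _ _] := hyp s (le_trans x03 xs).
    apply: is_derive_eq (dsq _ _ _ hu) _; rewrite /J.
    by case: (u s%:C) => a b; case: (H s%:C) => c d /=; ring.
  - by move=> s /Jpos; clear; lra.
have h1 : normc (u (x3 + 2)%:C) ^+ 2 <= 1.
  rewrite expr_le1 ?normc_ge0 //.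
  by have [_ _ _ _ []] := hyp (x3 + 2) (le_trans x03 h32).
by have := sqr_ge0 (normc (u x3%:C)); move: h h1; clear; lra.
Qed.
End Expansions.

(** * Uniqueness *)

Section Uniqueness.
Variables (R : realType) (m : nat) (X : wkb_data R m).
Local Notation C := R[i].
Local Notation V := 'rV[C]_m.
Variables F G : C -> V -> C.
Hypothesis hs : forall t a, sol a (F ^~ a) (G ^~ a) t.
Hypothesis hgood : forall N (al be A : R),
  - (3 * pi / m%:R) < al -> al <= be -> be < 3 * pi / m%:R ->
  exists x0 M : R, 0 <= M /\ forall a t, bnd A a -> x0 <= complex.Re t ->
    al <= complex.Im t <= be -> goodN X M N F G a t.

Lemma sector_gt0 : 0 < 3 * pi / m%:R :> R.
Proof. by rewrite divr_gt0 ?ltr0n ?(w_gt0 X) // mulr_gt0 // pi_gt0. Qed.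

Lemma vanishing_real (f : C -> V -> C) a : vanishing f ->
  forall e : R, 0 < e -> exists x0 : R, forall x : R, x0 <= x -> normc (f x%:C a) <= e.
Proof.
move=> hf e e0; have [A hA] := bnd_exists a; have s0 := sector_gt0.
have [||x0 hx] := hf 0 0 A _ (lexx 0) _ e e0; [by rewrite oppr_lt0|by []|].
by exists x0 => x xx; apply: hx => //=; rewrite lexx.
Qed.

Lemma ddcoef0 : ddcoef X 0 = -1.
Proof.
rewrite /ddcoef leqn0 eqn0Ngt (w_gt0 X) /= big_ord1 subn0.
by rewrite bd0 ?(w_gt0 X) ?(w_b0 X) // /px phi0_0 mul1r sub0r.
Qed.

Lemma powx0 (t : C) : powx (0%:R / 2) t = 1.
Proof. by rewrite /powx mul0r mul0r; exact: cexp0. Qed.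

Lemma limit_F a (e : R) : 0 < e -> exists x0 : R, forall x : R, x0 <= x ->
  normc (Ei X x%:C a * F x%:C a - 1) <= e.
Proof.
move=> e0; have [x0 hx] := vanishing_real a (expansion_F hgood 0) e0.
exists x0 => x /hx; rewrite powx0 mul1r big_ord1 expr0 mulr1.
by rewrite /px phi0_0 rmorph1.
Qed.

Lemma limit_G a (e : R) : 0 < e -> exists x0 : R, forall x : R, x0 <= x ->
  normc (yv x%:C ^+ m * (Ei X x%:C a * G x%:C a) + 1) <= e.
Proof.
move=> e0; have [x0 hx] := vanishing_real a (expansion_G hgood 0) e0.
exists x0 => x /hx; rewrite powx0 mul1r big_ord1 expr0 mulr1.
by rewrite ddcoef0 rmorphN1 opprK.
Qed.

Lemma ratio_bound (v w : C) (x y : R) : normc (v - 1) <= 1 / 8 -> normc w <= x -> x <= y * (7 / 8) ->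
  v != 0 /\ normc (w / v) <= y.
Proof.
move=> hv hw xy.
have v1 : 7 / 8 <= normc v.
  have := normcB v (v - 1); rewrite subKr normc1; lra.
have v0 : v != 0 by apply/eqP => E; move: v1; rewrite E normc0; lra.
split=> //; rewrite normcM normcV ler_pdivrMr; last by lra.
have y0 : 0 <= y by have := normc_ge0 w; lra.
apply: le_trans hw (le_trans xy _); exact: ler_wpM2l.
Qed.

Lemma subdominant_unique a (Psi GPsi : C -> C) :
  (forall t, Sigma0 m t -> sol a Psi GPsi t) ->
  (forall e : R, 0 < e -> exists x0 : R, forall x : R, x0 <= x ->
     normc (Ei X x%:C a * Psi x%:C - 1) <= e) ->
  forall t, Sigma0 m t -> Psi t = F t a.
Proof.
move=> hPsi limPsi; have s0 := sector_gt0.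
have realS (x : R) : Sigma0 m (x%:C : C) by rewrite /Sigma0 /= /argx /= normr0.
pose del t := Psi t - F t a; pose del' t := GPsi t - G t a.
have hdel t : Sigma0 m t -> sol a del del' t.
  by move=> ht; exact: sol_sub (hPsi t ht) (hs t a).
have e80 : 0 < 1 / 8 :> R by rewrite divr_gt0.
have [xF hF] := limit_F a e80; have [xG hG] := limit_G a e80; have [xP hP] := limPsi _ e80.
(* The last entry makes rho^m >= m + 3; this gives m + 1 <= 2 rho^m and 1 + (18/7) rho^m <= 3 rho^m,
   as [bounded_rigidity] requires. *)
pose x1 := Num.max (Num.max xF xG) (Num.max xP (2 * (m%:R + 3))).
have hx1 (x : R) : x1 <= x -> [/\ xF <= x, xG <= x, xP <= x & 2 * (m%:R + 3) <= x].
  by rewrite !ge_max => /andP[/andP[-> ->] /andP[-> ->]].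
have rhoL (x : R) : x1 <= x -> m%:R + 3 <= rho (x%:C : C) ^+ m /\ 1 <= rho (x%:C : C).
  move=> /hx1[_ _ _ h]; have h1 := expR_ge1Dx (x / 2); rewrite -rho_real in h1.
  have m00 : 0 <= m%:R :> R by [].
  have r1 : m%:R + 3 <= rho (x%:C : C).
    by move: h h1 m00; clear -hgood; lra.
  split; last by lra.
  by apply: le_trans r1 _; rewrite ler_eXnr ?(w_gt0 X) //; lra.
(* The Wronskian of Psi - F and F. It satisfies w' = w, because F' has coefficient 1 in the
   equation; hence H = w / F^2 = u' has logarithmic derivative 1 - 2 F'/F. *)
pose w t := del' t * F t a - del t * G t a.
pose u t := del t * (F t a)^-1.
pose H t := w t * ((F t a)^-1 * (F t a)^-1).
pose Dh t := 1 - 2 * (G t a / F t a).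
have Fn0 (x : R) : x1 <= x -> F x%:C a != 0.
  move=> /hx1[h _ _ _]; have [] := @ratio_bound _ 0 0 0 (hF x h) _ _.
  - by rewrite normc0.
  - by rewrite mul0r.
  - by move=> h0 _; apply: contra h0 => /eqP ->; rewrite mulr0.
have cu (x : R) : x1 <= x -> cder u x%:C (H x%:C).
  move=> xx; have [d1 _] := hdel _ (realS x); have [f1 _] := hs x%:C a.
  apply: cder_eq (cderM d1 (cderV (Fn0 x xx) f1)) _; rewrite /H /w.
  by field; exact: Fn0.
have cH (x : R) : x1 <= x -> cder H x%:C (Dh x%:C * H x%:C).
  move=> xx; have [d1 d2] := hdel _ (realS x); have [f1 f2] := hs x%:C a.
  have iv := cderV (Fn0 x xx) f1.
  apply: cder_eq (cderM (cderB (cderM d2 f1) (cderM d1 f2)) (cderM iv iv)) _.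
  rewrite /H /Dh /w; move: (Fn0 x xx).
  move: (del x%:C) (del' x%:C) (F x%:C a) (G x%:C a) (Pm _ a) => p q f g P f0.
  by field.
have uE t (v : C) : F t a != 0 -> u t = Ei X t a * del t / (Ei X t a * F t a).
  by move=> f0; rewrite /u; field; rewrite f0 Ei_neq0.
have ub (x e : R) : x1 <= x -> normc (Ei X x%:C a * F x%:C a - 1) <= e ->
    normc (Ei X x%:C a * Psi x%:C - 1) <= e -> normc (u x%:C) <= 4 * e.
  move=> xx h1 h2; rewrite (uE _ 0 (Fn0 x xx)).
  have [hx _ _ _] := hx1 x xx; have e0 := le_trans (normc_ge0 _) h1.
  have [] // := @ratio_bound _ (Ei X x%:C a * del x%:C) (2 * e) (4 * e) (hF x hx) _ _.
    rewrite /del mulrBr; apply: le_trans (normc_dist _ _ 1) _.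
    by rewrite [normc (1 - _)]normcBC; lra.
  lra.
have hyp (x : R) : x1 <= x -> [/\ cder u x%:C (H x%:C), cder H x%:C (Dh x%:C * H x%:C),
     rho (x%:C : C) ^+ m <= complex.Re (Dh x%:C), normc (Dh x%:C) <= 3 * rho (x%:C : C) ^+ m
     & [/\ normc (u x%:C) <= 1, m%:R + 1 <= 2 * rho (x%:C : C) ^+ m & 1 <= rho (x%:C : C)]].
  move=> xx; have [hx1F hx1G hx1P _] := hx1 x xx; have [rL r1] := rhoL x xx.
  have m00 : 0 <= m%:R :> R by [].
  have f0 := Fn0 x xx.
  set L := rho (x%:C : C) ^+ m in rL *.
  pose v := Ei X x%:C a * F x%:C a; pose z := yv x%:C ^+ m * (Ei X x%:C a * G x%:C a) + 1.
  (* The relative error in F'/F ~ -x^(m/2): the errors 1/8 in x^(-r) e^S F and in its derivative,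
     divided by |v| >= 7/8, give |ka| <= 2/7. *)
  pose ka := (- (z + (v - 1))) / v.
  have DhE : Dh x%:C = 1 + 2 * L%:C * (1 + ka).
    have hL := LLy m (x%:C : C); have L0 := LL_neq0 m (x%:C : C).
    have yE : yv x%:C ^+ m = (LL m (x%:C : C))^-1.
      by rewrite -[LHS]mul1r -(mulVf L0) -mulrA hL mulr1.
    rewrite -[L%:C]LL_real /ka /z yE /v /Dh.
    by field; rewrite f0 L0 Ei_neq0.
  have [_ hk] : v != 0 /\ normc ka <= 2 / 7.
    apply: (@ratio_bound v (- (z + (v - 1))) (1 / 4)); [exact: hF| |lra].
    rewrite normcN; apply: le_trans (normcD _ _) _.
    by have h1 := hF x hx1F; have h2 := hG x hx1G; rewrite -/v in h1; rewrite -/z in h2; lra.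
  have [k1 k2] : - (2 / 7) <= complex.Re ka /\ normc (1 + ka) <= 9 / 7.
    split.
      by have := normc_Re ka; rewrite ler_norml => /andP[h _]; lra.
    by apply: le_trans (normcD _ _) _; rewrite normc1; lra.
  split; [exact: cu|exact: cH| | |split].
  - have -> : complex.Re (Dh x%:C) = 1 + 2 * L * (1 + complex.Re ka).
      rewrite DhE; have -> : (2 : C) * L%:C = (2 * L)%:C by rewrite rmorphM rmorph_nat.
      by rewrite ReD ReZ ReD.
    have : 2 * L * (5 / 7) <= 2 * L * (1 + complex.Re ka) by apply: ler_wpM2l; lra.
    by lra.
  - rewrite DhE; apply: le_trans (normcD _ _) _; rewrite normc1 !normcM normcn normc_real.
    rewrite ger0_norm; last by lra.
    have : 2 * L * normc (1 + ka) <= 2 * L * (9 / 7) by apply: ler_wpM2l; lra.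
    by lra.
  - by apply: le_trans (ub x _ xx (hF x hx1F) (hP x hx1P)) _; lra.
  - by lra.
  - exact: r1.
have H0 := bounded_rigidity hyp.
have w0 : w x1%:C = 0.
  have := H0 x1 (lexx x1); rewrite /H => /eqP; rewrite !mulf_eq0 invr_eq0.
  by rewrite (negPf (Fn0 x1 (lexx x1))) !orbF => /eqP.
(* u' = H = 0 on the half-line makes u constant, and u tends to 0; so the Cauchy data of Psi - F
   vanish at x1. *)
have uconst (x : R) : x1 <= x -> u x%:C = u x1%:C.
  move=> xx; have -> : (x%:C : C) = x1%:C + (x - x1)%:C by rewrite -rmorphD /= addrC subrK.
  apply: cder0_const => s /andP[s00 _].
  have -> : (x1%:C : C) + s%:C * (x - x1)%:C = (x1 + s * (x - x1))%:C.
    by rewrite [RHS]rmorphD [in RHS]rmorphM.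
  have h : x1 <= x1 + s * (x - x1) by rewrite lerDl mulr_ge0 // subr_ge0.
  by rewrite -(H0 _ h); exact: cu.
have u0 : u x1%:C = 0.
  apply: (@normc_small_eq R _ _ 4) => // e e0; rewrite subr0.
  have [x2 h2] := limit_F a e0; have [x3 h3] := limPsi e e0.
  pose x := Num.max x1 (Num.max x2 x3).
  have xx : x1 <= x by rewrite le_max lexx.
  rewrite -(uconst x xx); apply: ub => //.
    by apply: h2; rewrite !le_max lexx orbT.
  by apply: h3; rewrite !le_max lexx !orbT.
have del0 : del x1%:C = 0.
  move/eqP: u0; rewrite /u mulf_eq0 invr_eq0 (negPf (Fn0 x1 (lexx x1))) orbF.
  by move/eqP.
have del'0 : del' x1%:C = 0.
  move/eqP: w0; rewrite /w del0 mul0r subr0 mulf_eq0 (negPf (Fn0 x1 (lexx x1))) orbF.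
  by move/eqP.
move=> t ht; have [A hA] := bnd_exists a.
have [Kc [_ hK]] := ode_growth m A (x1%:C : C) (t - x1%:C).
(* The sector is a convex strip in t, so the segment from x1 to t stays in the domain where Psi is a
   solution. *)
have hseg (s : R) : 0 <= s <= 1 -> sol a del del' (x1%:C + s%:C * (t - x1%:C)).
  move=> /andP[s00 s1]; apply: hdel; rewrite /Sigma0 /= /argx.
  have -> : complex.Im ((x1%:C : C) + s%:C * (t - x1%:C)) = s * complex.Im t.
    by case: t {ht hK} => p q /=; rewrite mul0r subr0 addr0 add0r.
  rewrite normrM (ger0_norm s00); apply: le_lt_trans ht.
  by rewrite -[leRHS]mul1r; apply: ler_wpM2r.
have := hK a del del' hA hseg; rewrite [x1%:C + _]addrC subrK del0 del'0.
rewrite normc0 expr0n /= addr0 mulr0 => h.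
have d0 : normc (del t) ^+ 2 <= 0 by apply: le_trans h; rewrite lerDl sqr_ge0.
apply/eqP; rewrite -subr_eq0; apply/eqP/eq0_normc/eqP.
by rewrite -sqrf_eq0 eq_le d0 sqr_ge0.
Qed.
End Uniqueness.

(** * The abstract data realized by polynomials in a *)

Section Instance.
Variables (R : realType) (m : nat) (hm : (0 < m)%N).
Local Notation C := R[i].
Local Notation V := 'rV[C]_m.

Lemma Pcoef_gt k : (m < k)%N -> Pcoef R m k = 0.
Proof.
move=> mk; rewrite /Pcoef big1 => [|i /eqP E]; last first.
  by have := ltn_ord i; rewrite -ltnS E ltnS leqNgt mk.
by rewrite gtn_eqF ?addr0 //; apply: leq_ltn_trans mk.
Qed.

Lemma ent_ev (p : mpoly m C) : ent (fun a : V => ev p a).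
Proof.
have -> : (fun a : V => ev p a) = (fun a : V =>
    \sum_(k <- msupp p) mcoeff k p * \prod_(i < m) a 0 i ^+ k i).
  by apply: funext => a; exact: mevalE.
apply: ent_sum => k _; apply: entM; first exact: ent_cst.
have h (s : seq 'I_m) : ent (fun a : V => \prod_(i <- s) a 0 i ^+ (k i)).
  elim: s => [|i s IH].
    by apply: (ent_ext _ (ent_cst _ 1)) => a; rewrite big_nil.
  have h := entM (entX (k i) (@ent_coord R m i)) IH.
  by apply: (ent_ext _ h) => a; rewrite big_cons.
exact: h.
Qed.

Lemma Pm_Pcoef (x : C) (a : V) :
  Pm x a = \sum_(0 <= k < m.+1) ev (Pcoef R m k) a * x ^+ (m - k).
Proof.
rewrite big_nat_recl // subn0 big_mkord.
have e0 : ev (Pcoef R m 0) a = 1.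
  by rewrite /Pcoef big_pred0 // addr0 /ev rmorph1.
rewrite e0 mul1r; congr (_ + _); apply: eq_bigr => k _.
rewrite /Pcoef /= add0r /ev raddf_sum /= (bigD1 k) //= mevalXU big1 ?addr0 //.
move=> i /andP[/eqP[E] ik]; case/eqP: ik; exact: val_inj.
Qed.

Definition mpoly_data : wkb_data R m := @WkbData R m (mpoly m C) (mpolyC m (R := C))
  (bcoef R m) (Pcoef R m) (rexp R m) (fun a => meval (a 0)) hm Pcoef_gt (bcoef0 R m)
  (@bcoef_sqr R m) erefl (fun a c => mevalC (a 0) c) ent_ev Pm_Pcoef.
End Instance.

(** * The subdominant solution *)

Section Main.
Variables (R : realType) (m : nat).
Local Notation C := R[i].
Local Notation V := 'rV[C]_m.

Lemma ddx_sol (a : V) (F G : C -> C) t : sol a F G t -> ddx F t = G t * cexp (-1 * t).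
Proof.
move=> [hF _]; rewrite /ddx (cder_derive1 hF); congr (_ * _).
by apply: (mulfI (cexp_neq0 t)); rewrite divff ?cexp_neq0 // -cexpD mulN1r subrr; rewrite cexp0.
Qed.

Lemma sol_solution (F G : C -> V -> C) :
  (forall t a, sol a (F ^~ a) (G ^~ a) t) -> solution F.
Proof.
move=> hs t a _; have [hF hG] := hs t a.
have E : ddx (F ^~ a) = fun t => G t a * cexp (-1 * t).
  by apply: funext => s; exact: ddx_sol (hs s a).
have hd := cderM hG (cder_cexpM (-1) t).
split; [exact: cder_derivable hF|by rewrite E; exact: cder_derivable hd|].
rewrite {1}/ddx E (cder_derive1 hd).
have -> : cexp (-1 * t) = (cexp t)^-1.
  by apply: (mulfI (cexp_neq0 t)); rewrite divff ?cexp_neq0 // -cexpD mulN1r subrr; rewrite cexp0.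
by field; exact: cexp_neq0.
Qed.

Lemma solution_sol (F : C -> V -> C) t a : solution F -> Sigma0 m t ->
  sol a (F ^~ a) (fun z => cexp z * ddx (F ^~ a) z) t.
Proof.
move=> hF ht; have [d1 d2 e2] := hF t a ht.
have c1 : cder (F ^~ a) t (cexp t * ddx (F ^~ a) t).
  apply: cder_eq (derivableP d1) _.
  by rewrite /ddx derive1E mulrC divfK // cexp_neq0.
split; first exact: c1.
apply: cder_eq (cderM (cder_cexp t) (derivableP d2)) _.
have <- := derive1E (ddx (F ^~ a)) t.
have -> : derive1 (ddx (F ^~ a)) t = cexp t * ddx (ddx (F ^~ a)) t.
  by rewrite [in RHS]/ddx [RHS]mulrC divfK // cexp_neq0.
rewrite e2; move: (ddx _ t) (Pm _ a) (F t a) (cexp_neq0 t) => D P f c0.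
by field.
Qed.

Lemma small_ext (f g : C -> V -> C) :
  (forall t a, f t a = g t a) -> small_at_infinity f -> small_at_infinity g.
Proof.
move=> fg; have -> : g = f by apply: funext => t; apply: funext => a.
by [].
Qed.

(** The expansion of order 0 on the ray arg x = 0, with the compact set {a}. *)
Lemma condition1_limit (Psi : C -> V -> C) psi a (e : R) : (0 < m)%N ->
  condition1 Psi psi -> 0 < e -> exists x0 : R, forall x : R, x0 <= x ->
    normc (powx (- ev (rexp R m) a) x%:C * cexp (Sfun x%:C a) * Psi x%:C a - 1) <= e.
Proof.
move=> hm [_ [psi0 _] hPsi] e0.
have s0 : 0 < 3 * pi / m%:R :> R by rewrite divr_gt0 ?ltr0n // mulr_gt0 // pi_gt0.
have [|||M hM] := hPsi 0 0 0 [set a] _ (lexx 0) _ _ e e0.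
- by rewrite oppr_lt0.
- by [].
- exact: compact_set1.
exists M => x xM; rewrite -lec_real -normCE.
have := hM x%:C a; rewrite powx0 mul1r big_ord1 psi0 /ev rmorph1 mul1r.
rewrite [X in _ - X](_ : _ = 1); last by rewrite /powx mul0r oppr0 mul0r; exact: cexp0.
apply => //; first by rewrite /argx /= lexx.
apply: le_trans xM _; rewrite /absx /=.
by have := expR_ge1Dx x; lra.
Qed.
End Main.

Theorem theorem2p1 (R : realType) (m : nat) (hm : (1 <= m)%N) :
  exists (Phi0 : R[i] -> 'rV[R[i]]_m -> R[i]) (phi0 : nat -> mpoly m R[i]),
    [/\ solution Phi0 /\ condition1 Phi0 phi0,
        forall (Psi : R[i] -> 'rV[R[i]]_m -> R[i])
               (psi : nat -> mpoly m R[i]),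
          solution Psi -> condition1 Psi psi ->
          forall t a, Sigma0 m t -> Psi t a = Phi0 t a,
        exists Phi : R[i] -> 'rV[R[i]]_m -> R[i],
          [/\ forall t a, Sigma0 m t -> Phi t a = Phi0 t a,
              forall t a, derivable (Phi ^~ a) t 1
            & forall t a, differentiable (Phi t) a]
      & has_expansion (fun t a => ddx (Phi0 ^~ a) t)
          (rexp R m + mpolyC m (m%:R / 2 - 1)) (formal_ddx phi0)
        /\ small_at_infinity (fun t a =>
             powx (- (ev (rexp R m) a + m%:R / 2 - 1)) t * cexp (Sfun t a)
             * ddx (Phi0 ^~ a) t - (-1))].
Proof.
pose X := mpoly_data R hm.
have [F [G [hs hent hax]]] := real_axis_solution X.
have hgood N al be A h1 h2 h3 := @sector_good R m X F G al be A N hs (hax A N) h1 h2 h3.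
have yE (t : R[i]) n : yv t ^+ n = powx (- (n%:R / 2)) t by exact: yvX.
(* d/dx = x^(-1) d/dt adds 1 to the exponent c; for c = m/2 - 1 the remaining factor x^(-m/2) is the
   y^m of [expansion_G]. *)
have ddE (t : R[i]) a c : powx (- (ev (rexp R m) a + c)) t * cexp (Sfun t a) * ddx (F ^~ a) t
    = cexp (- (c + 1) * t) * (Ei X t a * G t a).
  rewrite (ddx_sol (hs t a)) /powx.
  have -> : - (ev (rexp R m) a + c) * t = - ev (rexp R m) a * t + - c * t by ring.
  have -> : - (c + 1) * t = - c * t + -1 * t by ring.
  rewrite /Ei -[wh X a _]/(ev (rexp R m) a) -[Sx X t a]/(Sfun t a).
  move: (Sfun t a) => s; rewrite !cexpD; ring.
have evE c a : ev (rexp R m + mpolyC m c) a = ev (rexp R m) a + c.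
  by rewrite /ev mevalD mevalC.
have mE (t : R[i]) : cexp (- (m%:R / 2 - 1 + 1) * t) = yv t ^+ m by rewrite subrK yE.
have hexp : has_expansion F (rexp R m) (px X).
  move=> N; apply: small_ext (vanishing_small (expansion_F hgood N)) => t a.
  congr (_ * (_ - _)); apply: eq_bigr => j _; by rewrite yE.
exists F, (px X); split.
- split; first exact: sol_solution hs.
  split=> //; first by move=> t a _; have [h _] := hs t a; exact: cder_derivable h.
  split; first exact: phi0_0.
  by move=> em j oj; exact: (phi0_odd _ _ _ (w_Pgt X)).
- move=> Psi psi hPsi h1 t a ht.
  apply: (subdominant_unique hs hgood (Psi := Psi ^~ a)) ht.
    by move=> s hs'; exact: solution_sol.
  by move=> e e0; exact: condition1_limit h1 e0.
(* F is entire in t from its construction and is therefore its own continuation. *)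
- exists F; split=> // t a; last exact: ent_differentiable.
  by have [h _] := hs t a; exact: cder_derivable h.
- split.
    move=> N; apply: small_ext (vanishing_small (expansion_G hgood N)) => t a.
    rewrite (evE _ a) (ddE t a) (mE t).
    by congr (_ * (_ - _)); apply: eq_bigr => j _; rewrite yE.
  (* Order 0 of the same expansion: the leading coefficient -1 is [ddcoef0]. *)
  apply: small_ext (vanishing_small (expansion_G hgood 0)) => t a.
  have <- := addrA (ev (rexp R m) a) (m%:R / 2) (-1).
  rewrite [in RHS](ddE t a) [in RHS](mE t).
  rewrite powx0 mul1r.
  rewrite big_ord1 expr0 mulr1.
  rewrite ddcoef0.
  by rewrite rmorphN1.
Qed.
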